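(* There exists a weakly fan-planar graph that does not admit a strongly fan-planar drawing.
   Context: Graphs are simple. A drawing of a graph maps vertices to distinct points of the plane and edges to Jordan arcs between their endpoints that pass through no other vertex; drawings are simple: two edges share at most one point, which is either a common endpoint or a proper crossing, and adjacent edges do not cross. For an edge $e$ and two edges $e_1,e_2$ crossing $e$ at points $x_1,x_2$, the following patterns are considered. Pattern (I): $e_1$ and $e_2$ do not share an endpoint. If $e_1,e_2$ share an endpoint $u$, let $C$ be the closed curve formed by the part of $e_1$ from $u$ to $x_1$, the part of $e$ between $x_1$ and $x_2$, and the part of $e_2$ from $x_2$ to $u$; Pattern (II): exactly one endpoint of $e$ lies in the bounded region of $C$; Pattern (III): both endpoints of $e$ lie in the bounded region of $C$. A drawing is weakly fan-planar if no triple of edges forms Pattern (I) or (II), and strongly fan-planar if no triple forms Pattern (I), (II) or (III). A graph is weakly (strongly) fan-planar if it admits a weakly (strongly) fan-planar drawing. *)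

(* Defs.v *)
From HB Require Import structures.
From mathcomp Require Import all_boot all_order all_algebra.
From mathcomp Require Import all_classical all_reals all_analysis.

Set Implicit Arguments.
Unset Strict Implicit.
Unset Printing Implicit Defensive.

Import Order.TTheory GRing.Theory Num.Theory.
Import numFieldNormedType.Exports.

Local Open Scope classical_set_scope.
Local Open Scope ring_scope.

Record sgraph := SGraph {
  vertex :> finType;
  adj : rel vertex;
  adj_sym : symmetric adj;
  adj_irrefl : irreflexive adj }.

(* Edges are unordered: an edge is the set of its two endpoints. *)
Definition is_edge (G : sgraph) (e : {set G}) : Prop :=
  exists u v : G, adj u v /\ e = [set u; v]%SET.

Definition share_endpoint (G : sgraph) (e f : {set G}) : Prop :=
  exists u : G, u \in e /\ u \in f.

Section Plane.
Variable R : realType.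

Definition plane := (R * R)%type.

Definition jordan_arc (g : R -> plane) : Prop :=
  {within `[0, 1], continuous g} /\ {in `[0, 1] &, injective g}.

Definition curve (g : R -> plane) : set plane := g @` `[0, 1].

(* For a Jordan arc g through p and q, the parameters s and t are unique. *)
Definition part (g : R -> plane) (p q : plane) : set plane :=
  [set z | exists s t r : R,
     [/\ s \in `[0, 1], t \in `[0, 1], g s = p, g t = q &
         Num.min s t <= r <= Num.max s t /\ z = g r]].

Definition homeomorphism (U V : set plane) (h k : plane -> plane) : Prop :=
  [/\ forall z, U z -> V (h z) /\ k (h z) = z,
      forall w, V w -> U (k w) /\ h (k w) = w,
      {within U, continuous h} &
      {within V, continuous k}].

(* Locally at x, the pair (A, B) looks like the two coordinate axes at the
   origin; in particular x is not an end of A or B, and A and B do not merely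
   touch at x. *)
Definition proper_crossing (A B : set plane) (x : plane) : Prop :=
  exists (U : set plane) (h k : plane -> plane),
    [/\ open U, U x, h x = 0, homeomorphism U (ball (0 : plane) 1) h k &
        forall z, U z -> (A z <-> (h z).2 = 0) /\ (B z <-> (h z).1 = 0)].

(* For a simple closed curve Z, the points in the bounded component of the
   complement of Z. *)
Definition bounded_region (Z : set plane) : set plane :=
  [set p | ~ Z p /\ bounded_set (connected_component (~` Z) p)].

Section Drawing.
Variable G : sgraph.

(* The value of arc on a set that is not an edge is irrelevant. *)
Record drawing := Drawing {
  pos : G -> plane;
  arc : {set G} -> R -> plane;
  pos_inj : injective pos;
  arc_jordan : forall e, is_edge e -> jordan_arc (arc e);
  arc_ends : forall e, is_edge e ->
    exists u v : G, [/\ e = [set u; v]%SET, arc e 0 = pos u & arc e 1 = pos v];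
  arc_vertex : forall e, is_edge e ->
    forall v : G, curve (arc e) (pos v) -> v \in e;
  arcs_meet_once : forall e f, is_edge e -> is_edge f -> e != f ->
    forall p q, (curve (arc e) `&` curve (arc f)) p ->
                (curve (arc e) `&` curve (arc f)) q -> p = q;
  arcs_meet : forall e f, is_edge e -> is_edge f -> e != f ->
    forall p, (curve (arc e) `&` curve (arc f)) p ->
      (exists v : G, [/\ v \in e, v \in f & p = pos v]) \/
      proper_crossing (curve (arc e)) (curve (arc f)) p;
  adjacent_no_cross : forall e f, is_edge e -> is_edge f -> e != f ->
    share_endpoint e f ->
    forall p, ~ proper_crossing (curve (arc e)) (curve (arc f)) p }.

Variable D : drawing.

Definition crosses_at (e f : {set G}) (x : plane) : Prop :=
  [/\ is_edge e, is_edge f, e != f &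
      proper_crossing (curve (arc D e)) (curve (arc D f)) x].

Definition pattern_I (e e1 e2 : {set G}) : Prop :=
  [/\ exists x1, crosses_at e1 e x1,
      exists x2, crosses_at e2 e x2 &
      ~ share_endpoint e1 e2].

Definition closed_curve (e e1 e2 : {set G}) (u : G) (x1 x2 : plane) :
    set plane :=
  part (arc D e1) (pos D u) x1 `|` part (arc D e) x1 x2 `|`
  part (arc D e2) x2 (pos D u).

Definition pattern_II (e e1 e2 : {set G}) : Prop :=
  exists (u : G) (x1 x2 : plane),
    [/\ e1 != e2, crosses_at e1 e x1, crosses_at e2 e x2,
        u \in e1 /\ u \in e2 &
        exists! v : G,
          v \in e /\ bounded_region (closed_curve e e1 e2 u x1 x2) (pos D v)].

Definition pattern_III (e e1 e2 : {set G}) : Prop :=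
  exists (u : G) (x1 x2 : plane),
    [/\ e1 != e2, crosses_at e1 e x1, crosses_at e2 e x2,
        u \in e1 /\ u \in e2 &
        forall v : G,
          v \in e -> bounded_region (closed_curve e e1 e2 u x1 x2) (pos D v)].

Definition weakly_fan_planar_drawing : Prop :=
  forall e e1 e2, ~ pattern_I e e1 e2 /\ ~ pattern_II e e1 e2.

Definition strongly_fan_planar_drawing : Prop :=
  forall e e1 e2,
    [/\ ~ pattern_I e e1 e2, ~ pattern_II e e1 e2 & ~ pattern_III e e1 e2].

End Drawing.

Definition weakly_fan_planar (G : sgraph) : Prop :=
  exists D : drawing G, weakly_fan_planar_drawing D.

Definition strongly_fan_planar (G : sgraph) : Prop :=
  exists D : drawing G, strongly_fan_planar_drawing D.

End Plane.

(* Main.v *)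
From HB Require Import structures.
From Stdlib Require Import ZArith.
From mathcomp Require Import all_boot all_order all_algebra.
From mathcomp Require Import all_classical all_reals all_analysis.
From mathcomp Require Import lra ring ssrZ zify.
Require Import Defs.

(** The graph has a vertex [0] and two disjoint sides, each with a hub [o], a pentagon [u a c d b] around it whose
    edges are thick, a thick edge from [u] to [0], and thin edges [uc ud ab ad bc 0a 0b]; a thick edge is a K7
    through its ends.

    Weak drawing: the thick edges are drawn straight as thin lenses, with the thin edges outside the pentagons.
    Coordinates are integers, so that simplicity and Pattern (I) are decided by orientation signs.  Pattern (II) is
    excluded by polylines that join the two ends of [e] without meeting the closed curve.

    No strong drawing: for curves in general position the number of crossings mod 2 is computed by a winding parity,
    which gives that every K5 has an odd number of independent crossings and that two disjoint triangles cross an even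
    number of times.  Together with the exclusion of Pattern (I) these force, by a finite search, that the crossed
    edges of a K7 connect all its vertices; hence each thick edge contains a path that no edge away from the K7 can
    cross.  Parity then forces [uc] to cross [0a], [ab] and [ad], and [ud] to cross [0b], [ab] and [bc], with [0a]
    the first on [uc].  By the absence of Patterns (II) and (III), [a] lies outside the closed curve formed by [uc],
    [ab] and [ud], so that [0], which is separated from [a] by one crossing, lies inside.  The thick edges through
    [0] then place the closed curve of each side inside that of the other, which is absurd. *)

Set Implicit Arguments.
Unset Strict Implicit.
Unset Printing Implicit Defensive.

Import Order.TTheory GRing.Theory Num.Theory.
Import numFieldNormedType.Exports.

Local Open Scope classical_set_scope.
Local Open Scope ring_scope.

(** * Parity of plane paths *)

(** Patterns (II) and (III) are the only conditions that refer to the unbounded region; all others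
    are unchanged if another face of the sphere is made the unbounded one. Hence one side by itself
    only puts [0] inside its own closed curve. Two sides share [0] so that each of the two closed
    curves would have to surround the other, which a point of largest abscissa on their union
    refutes.

    Being inside is expressed by a boolean winding parity. Along an arc it changes by the parity of
    the crossings with the curve, it is constant on connected sets off the curve, and it vanishes on
    unbounded components.

    The crossing parity of two arcs is a sum of terms that depend on an end and an arc, or on two
    ends. This turns the statements on K5 and on triangles into linear identities over the field
    with two elements. It also lets paths replace edges, which is what makes thick edges usable: in
    a drawing they are only known as paths through a K7. *)

Inductive xexpr := XAtom of nat | XAdd of xexpr & xexpr | XNeg of xexpr | XCst of bool.

Fixpoint xeval (env : seq bool) (x : xexpr) : bool :=
  match x with
  | XAtom i => nth false env i
  | XAdd x1 x2 => xeval env x1 (+) xeval env x2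
  | XNeg x1 => ~~ xeval env x1
  | XCst b => b
  end.

Fixpoint xcoef (x : xexpr) (i : nat) : bool :=
  match x with
  | XAtom j => i == j
  | XAdd x1 x2 => xcoef x1 i (+) xcoef x2 i
  | XNeg x1 => xcoef x1 i
  | XCst b => false
  end.

Fixpoint xconst (x : xexpr) : bool :=
  match x with
  | XAtom j => false
  | XAdd x1 x2 => xconst x1 (+) xconst x2
  | XNeg x1 => ~~ xconst x1
  | XCst b => b
  end.

Lemma xevalE env x : xeval env x =
  xconst x (+) \big[addb/false]_(i <- iota 0 (size env)) (xcoef x i && nth false env i).
Proof.
elim: x => [j|x1 IH1 x2 IH2|x1 IH|b] /=.
- have [jn|nj] := ltnP j (size env).
    rewrite (bigD1_seq j) ?iota_uniq ?mem_iota //= eqxx big1 ?addbF // => i /negPf ->.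
    by [].
  rewrite nth_default // big1_seq // => i; rewrite mem_iota add0n /= => ilt.
  by rewrite ltn_eqF //; apply: leq_trans nj.
- rewrite IH1 IH2 addbACA -big_split /=; congr (_ (+) _); apply: eq_bigr => i _.
  by rewrite andb_addl.
- by rewrite IH addNb.
- by rewrite big1 // addbF.
Qed.

(** Over the field with two elements every expression is affine in its atoms, so constants and
    coefficients decide equality. They are compared by computation. *)
Lemma xeval_eq env x y : xconst x = xconst y ->
  all (fun i => xcoef x i == xcoef y i) (iota 0 (size env)) ->
  xeval env x = xeval env y.
Proof.
move=> c /allP H; rewrite !xevalE c; congr (_ (+) _).
by apply: eq_big_seq => i /H /eqP ->.
Qed.

Lemma xor_use h x y : h = false -> x (+) h = y -> x = y.
Proof. by move=> ->; rewrite addbF. Qed.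

Ltac xor_index x l :=
  lazymatch l with
  | x :: _ => constr:(0%N)
  | _ :: ?l' => let i := xor_index x l' in constr:(S i)
  end.
Ltac xor_env x l :=
  lazymatch x with
  | addb ?a ?b => let l' := xor_env a l in xor_env b l'
  | negb ?a => xor_env a l
  | true => l
  | false => l
  | _ => match l with
         | context [x :: _] => l
         | _ => constr:(x :: l)
         end
  end.
Ltac xor_quote x l :=
  lazymatch x with
  | addb ?a ?b => let a' := xor_quote a l in let b' := xor_quote b l in constr:(XAdd a' b')
  | negb ?a => let a' := xor_quote a l in constr:(XNeg a')
  | true => constr:(XCst true)
  | false => constr:(XCst false)
  | _ => let i := xor_index x l in constr:(XAtom i)
  end.
(* Decides linear identities over the field with two elements. *)
Ltac xor :=
  lazymatch goal with
  | |- ?x = ?y =>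
    let l0 := xor_env x (@nil bool) in
    let l := xor_env y l0 in
    let x' := xor_quote x l in
    let y' := xor_quote y l in
    change (xeval l x' = xeval l y'); apply: xeval_eq; reflexivity
  end.

Section Parity.
Variable R : realType.
Local Notation plane := (plane R).
Implicit Types (z w : plane) (a b c d s t : R) (g : R -> plane).

(** A fundamental domain of the antipodal map away from the origin: exactly one of [z] and [- z] is
    [upper]. For this the horizontal axis is split into its two halves. *)
Definition upper z : bool := (0 < z.2) || ((z.2 == 0) && (0 < z.1)).

(* For nearby [z] and [w] away from the origin: whether the segment from [z] to [w] crosses the negative axis. *)
Definition jump z w : bool := (upper z (+) upper w) && (z.1 < 0).

(** The distance in the maximum norm is less than the norm of [z], so the segment from [z] to [w]
    avoids the origin and signs decide whether it crosses the negative axis. *)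
Definition nearby z w : Prop :=
  `|z.1 - w.1| < Num.max `|z.1| `|z.2| /\ `|z.2 - w.2| < Num.max `|z.1| `|z.2|.

Lemma upperN z : z != 0 -> upper (- z) = ~~ upper z.
Proof.
case: z => x y; rewrite /upper /= => nz.
rewrite oppr_gt0 oppr_eq0 oppr_gt0.
have [y0|y0|y0] := ltgtP y 0 => //=.
have [x0|x0|x0] := ltgtP x 0 => //=.
by move: nz; rewrite x0 y0 eqxx.
Qed.

(** If [upper] differs, then [|z.2 - w.2|] is at least [|z.2|]. So the maximum norm of [z] is
    attained at the first coordinate only, and the other bound preserves the sign of that
    coordinate. *)
Lemma nearby_sign z w : nearby z w -> upper z != upper w ->
  [/\ (z.1 < 0) = (w.1 < 0), z.1 != 0 & (0 < z.1) = (0 < w.1)].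
Proof.
case: z w => [x y] [x' y']; rewrite /nearby /upper /=.
pose M := Num.max `|x| `|y|; rewrite -/M => -[dx dy] ne.
have yM : `|y| < M.
  apply: le_lt_trans dy.
  rewrite ler_normr; move: ne.
  by have [y0|y0|y0] := ltgtP y 0; have [y1|y1|y1] := ltgtP y' 0; rewrite //= => _;
    rewrite ?y0 ?y1 ?normr0 ?(ltr0_norm y0) ?(gtr0_norm y0); apply/orP;
    (left; lra) || (right; lra).
have xM : `|x| = M by apply/eqP; move: yM; rewrite /M maxEle; case: ifP; rewrite ?ltxx ?eqxx.
move: dx; rewrite -xM => dx.
have : x * x' > 0 /\ x != 0.
  have [x0|x0|x0] := ltgtP x 0.
  - move: dx; rewrite ltr_norml (ltr0_norm x0) => /andP[d1 d2]; split => //; nra.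
  - move: dx; rewrite ltr_norml (gtr0_norm x0) => /andP[d1 d2]; split => //; nra.
  - by move: dx; rewrite x0 normr0 ltNge normr_ge0.
move=> [p xN]; split => //.
  by have [x0|x0|x0] := ltgtP x 0; have [x1|x1|x1] := ltgtP x' 0 => //; nra.
by have [x0|x0|x0] := ltgtP x 0; have [x1|x1|x1] := ltgtP x' 0 => //; nra.
Qed.

Lemma jump_cocycle z w v : nearby z w -> nearby z v -> nearby w v ->
  jump z w (+) jump z v = jump w v.
Proof.
move=> zw zv wv; rewrite /jump.
have := nearby_sign zw; have := nearby_sign zv; have := nearby_sign wv.
case: (upper z); case: (upper w); case: (upper v) => //=.
- by move=> /(_ isT)[-> _ _] /(_ isT)[-> _ _].
- by move=> /(_ isT)[-> _ _] _ /(_ isT)[-> _ _]; rewrite addbF.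
- by move=> _ /(_ isT)[-> _ _] /(_ isT)[-> _ _]; rewrite addbb.
- by move=> _ /(_ isT)[-> _ _] /(_ isT)[-> _ _]; rewrite addbb.
- by move=> /(_ isT)[-> _ _] _ /(_ isT)[-> _ _]; rewrite addbF.
- by move=> /(_ isT)[-> _ _] /(_ isT)[-> _ _].
Qed.

(** The negated path crosses the negative axis where the path crosses the positive one, and both
    kinds of crossing together are the changes of [upper]. *)
Lemma jumpN z w : z != 0 -> w != 0 -> nearby z w ->
  jump (- z) (- w) = jump z w (+) upper z (+) upper w.
Proof.
move=> z0 w0 /nearby_sign; rewrite /jump !upperN //= oppr_lt0.
case: (upper z) (upper w) => [] [] //= /(_ isT) [_ + _];
  by case: (ltgtP z.1 0).
Qed.

(** The supremum of the right ends [t] with [Q a t] can be passed unless it is [b]. This is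
    compactness of the interval, used below for lifts, for rectangles, and for distances and bounds
    of curves. *)
Lemma cousin (Q : R -> R -> Prop) a b : a <= b ->
  (forall x, a <= x <= b -> exists2 e, 0 < e & forall s t, a <= s -> s <= x ->
     x <= t -> t <= b -> x - e < s -> t < x + e -> Q s t) ->
  (forall s t r, a <= s -> s <= t -> t <= r -> r <= b ->
     Q s t -> Q t r -> Q s r) ->
  Q a b.
Proof.
move=> ab loc glue.
pose S := [set t | a <= t <= b /\ Q a t].
have Sa : S a.
  split; first by rewrite lexx.
  have [|e e0 H] := loc a; first by rewrite lexx.
  by apply: H; lra.
have Sub : ubound S b by move=> t [/andP[]].
have hS : has_sup S by split; [exists a|exists b].
have am : a <= sup S by apply: ub_le_sup => //; exists b.
have mb : sup S <= b by apply: ge_sup => //; exists a.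
have [|e e0 H] := loc (sup S); first by rewrite am.
have [t St tm] := sup_adherent e0 hS.
have tS : t <= sup S by apply: ub_le_sup => //; exists b.
case: (St) => /andP[at_ tb] Qat.
(* Half of [e] beyond the supremum, cut off at [b]. Gluing makes [m'] itself a good right end, hence
   [m' <= sup S], which leaves only [m' = b]. *)
pose m' := Num.min b (sup S + e / 2).
have mm' : sup S <= m' by rewrite le_min mb /=; lra.
have m'b : m' <= b by rewrite ge_min lexx.
have m'e : m' < sup S + e by rewrite gt_min; apply/orP; right; lra.
have Qam : Q a m'.
  by apply: (glue a t m') => //; [exact: le_trans mm'|apply: H].
have : m' <= sup S.
  by apply: ub_le_sup; [exists b|split => //; rewrite (le_trans am mm')].
rewrite ge_min => /orP[bm|]; last by move=> ?; lra.
have E : m' = b by apply/eqP; rewrite eq_le m'b /=; apply: le_trans mm'.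
by rewrite -E.
Qed.

Lemma nbhsI (T : topologicalType) (x : T) (A B : set T) :
  nbhs x A -> nbhs x B -> nbhs x (A `&` B).
Proof. exact: filterI. Qed.

Definition gpath g a b : Prop :=
  (forall t, a <= t <= b -> g @ within [set s | a <= s <= b] (nbhs t) --> g t) /\
  (forall t, a <= t <= b -> g t != 0).

(** An angle function modulo 2: [sg] tells the parity of the sheet on which the argument of [g] lies
    when the plane is cut along the negative axis. *)
Definition lift g a b (sg : R -> bool) : Prop :=
  forall t, a <= t <= b -> \forall t' \near t, a <= t' <= b ->
    sg t (+) sg t' = jump (g t) (g t').

Lemma max_gt0 z : z != 0 -> 0 < Num.max `|z.1| `|z.2|.
Proof.
case: z => x y nz /=; rewrite lt_max !normr_gt0.
by apply/orP; move: nz; have [->|] := eqVneq x 0; [right; apply: contra_neq nz => ->|left].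
Qed.

Lemma within_nearby (T : topologicalType) (D : set T) (F : T -> plane) (p : T) :
  F @ within D (nbhs p) --> F p -> F p != 0 ->
  \forall q \near p, D q -> nearby (F p) (F q).
Proof.
move=> cF /max_gt0 M0.
pose M := Num.max `|(F p).1| `|(F p).2|.
have /cF : nbhs (F p) (ball (F p) M) by apply: nbhsx_ballx.
move=> H; have {}H : \forall q \near p, D q -> ball (F p) M (F q) := H.
by apply: filterS H => q K Dq; have [] := K Dq.
Qed.

Lemma gpath_sub g a b c d : gpath g a b -> a <= c -> d <= b -> gpath g c d.
Proof.
move=> [cg nz] ac db; split=> t /andP[ct td].
  have /cg cgt : a <= t <= b by rewrite (le_trans ac ct) (le_trans td db).
  apply: cvg_trans cgt; apply: cvg_app; apply: within_subset => s /= /andP[cs sd].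
  by rewrite (le_trans ac cs) (le_trans sd db).
by apply: nz; rewrite (le_trans ac ct) (le_trans td db).
Qed.

Lemma lift_sub g a b c d sg : lift g a b sg -> a <= c -> d <= b -> lift g c d sg.
Proof.
move=> L ac db t /andP[ct td].
have /L : a <= t <= b by rewrite (le_trans ac ct) (le_trans td db).
apply: filterS => s H /andP[cs sd]; apply: H.
by rewrite (le_trans ac cs) (le_trans sd db).
Qed.

Lemma near_interval (P : R -> Prop) x : (\forall t \near x, P t) ->
  exists2 e, 0 < e & forall t, x - e < t -> t < x + e -> P t.
Proof.
move=> /nbhs_ballP[e /= e0 H]; exists e => // t t1 t2; apply: H.
by rewrite /ball /= ltr_norml; apply/andP; split; lra.
Qed.

Lemma lift_uniq g a b sg tu t : a <= t <= b -> lift g a b sg -> lift g a b tu ->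
  sg a (+) sg t = tu a (+) tu t.
Proof.
move=> /andP[a_t tb] Ls Lt.
suff : sg a (+) tu a = sg t (+) tu t.
  by case: (sg a) (tu a) (sg t) (tu t) => [] [] [] [].
apply: (cousin (Q := fun s t => sg s (+) tu s = sg t (+) tu t)) => //; last first.
  by move=> ? ? ? _ _ _ _ -> ->.
move=> x /andP[ax xt]; have xI : a <= x <= b by rewrite ax (le_trans xt tb).
have [e e0 H] := near_interval (filterI (Ls x xI) (Lt x xI)).
exists e => // s r as_ sx xr rt es re.
have sI : a <= s <= b by rewrite as_ (le_trans sx) // (le_trans xt tb).
have rI : a <= r <= b by rewrite (le_trans ax xr) (le_trans rt tb).
have [] := H s es; first by lra.
move=> /(_ sI) h1 /(_ sI) h2.
have [] := H r _ re; first by lra.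
move=> /(_ rI) h3 /(_ rI) h4.
move: (etrans h1 (esym h2)) (etrans h3 (esym h4)).
by case: (sg x) (tu x) (sg s) (tu s) (sg r) (tu r) => [] [] [] [] [] [].
Qed.

Lemma jump_lift g a b c d z : gpath g a b -> a <= c -> d <= b ->
  (forall t, c <= t <= d -> nearby z (g t)) -> lift g c d (fun t => jump z (g t)).
Proof.
move=> gp ac db nb; have gp' := gpath_sub gp ac db => t tI.
have := within_nearby (gp'.1 t tI) (gp'.2 t tI).
by apply: filterS => s H sI; apply: jump_cocycle; [exact: nb|exact: nb|exact: H].
Qed.

Lemma lift_exists g a b : a <= b -> gpath g a b -> exists sg, lift g a b sg.
Proof.
move=> ab gp.
apply: (cousin (Q := fun s t => exists sg, lift g s t sg)) => //.
  move=> x xI.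
  have [e e0 H] := near_interval (within_nearby (gp.1 x xI) (gp.2 x xI)).
  exists e => // s t as_ sx xt tb es te; exists (fun t => jump (g x) (g t)).
  apply: (@jump_lift _ a b) => // r /andP[sr rt]; apply: H => /=; try by lra.
move=> s t r as_ st tr rb [sg Ls] [tu Lt].
(* The second lift is shifted by a constant so that both agree at [t]. *)
exists (fun q => if q <= t then sg q else sg t (+) tu t (+) tu q) => q /andP[sq qr].
have [qt|tq|qt] := ltgtP q t.
- have qI : s <= q <= t by rewrite sq (ltW qt).
  have Hlt : \forall q' \near q, q' < t by exact: lt_nbhsl.
  have HF := nbhsI Hlt (Ls q qI).
  apply: filterS HF => q' [q't H] /andP[sq' _].
  by rewrite (ltW q't) H // sq' (ltW q't).
- have qI : t <= q <= r by rewrite qr (ltW tq).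
  have Hlt : \forall q' \near q, t < q' by exact: lt_nbhsr.
  have HF := nbhsI Hlt (Lt q qI).
  apply: filterS HF => q' [tq' H] /andP[_ q'r].
  rewrite leNgt tq' /= -H ?(ltW tq') //.
  by case: (sg t) (tu t) (tu q) (tu q') => [] [] [] [].
- have q1 : s <= q <= t by rewrite sq qt lexx.
  have q2 : t <= q <= r by rewrite qr qt lexx.
  have HF := nbhsI (Ls q q1) (Lt q q2).
  apply: filterS HF => q' [H1 H2] /andP[sq' q'r].
  have [q't|tq'] := leP q' t; first by rewrite H1 // sq'.
  rewrite -H2 ?(ltW tq') // qt.
  by case: (sg t) (tu t) (tu q') => [] [] [].
Qed.

(* The number of times, mod 2, that the path [g] crosses the negative axis. *)
Definition par g a b : bool := `[< exists sg, lift g a b sg /\ sg a (+) sg b >].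

Lemma parE g a b sg : a <= b -> lift g a b sg -> par g a b = sg a (+) sg b.
Proof.
move=> ab L; apply/asboolP/idP => [[tu [Lt H]]|H]; last by exists sg.
by rewrite (lift_uniq _ L Lt) // ab lexx.
Qed.

Lemma par_cat g a b c : a <= b -> b <= c -> gpath g a c ->
  par g a c = par g a b (+) par g b c.
Proof.
move=> ab bc gp; have ac := le_trans ab bc.
have [sg L] := lift_exists ac gp.
rewrite (parE ac L) (parE ab (lift_sub L (lexx _) bc)) (parE bc (lift_sub L ab (lexx _))).
by case: (sg a) (sg b) (sg c) => [] [] [].
Qed.

Lemma lift_ext g g' a b sg : (forall t, a <= t <= b -> g t = g' t) ->
  lift g a b sg -> lift g' a b sg.
Proof.
move=> E L t tI; move: (L t tI); apply: filterS => s H sI.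
by rewrite -!E // H.
Qed.

Lemma par_ext g g' a b : (forall t, a <= t <= b -> g t = g' t) ->
  par g a b = par g' a b.
Proof.
move=> E; apply/asboolP/asboolP => -[sg [L H]]; exists sg; split => //.
  exact: lift_ext L.
by apply: lift_ext L => t /E.
Qed.

Lemma par_opp g a b : a <= b -> gpath g a b ->
  par (fun t => - g t) a b = par g a b (+) upper (g a) (+) upper (g b).
Proof.
move=> ab gp; have [sg L] := lift_exists ab gp.
rewrite (parE ab L) (@parE _ _ _ (fun t => sg t (+) upper (g t))) //.
  by case: (sg a) (sg b) (upper (g a)) (upper (g b)) => [] [] [] [].
move=> t tI; have H := nbhsI (L t tI) (within_nearby (gp.1 t tI) (gp.2 t tI)).
apply: filterS H => s [H1 H2] sI.
rewrite jumpN //; [|exact: gp.2|exact: gp.2|exact: H2].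
by rewrite -H1 //; case: (sg t) (sg s) (upper _) (upper _) => [] [] [] [].
Qed.

Lemma par_rev g a b : a <= b -> gpath g a b ->
  par (fun t => g (a + b - t)) a b = par g a b.
Proof.
move=> ab gp; have [sg L] := lift_exists ab gp.
rewrite (parE ab L) (@parE _ _ _ (fun t => sg (a + b - t))) //.
  by rewrite addrAC subrr add0r addrK addbC.
move=> t /andP[a_t tb]; have := L (a + b - t); rewrite /= => H.
have /H : a <= a + b - t <= b by apply/andP; split; lra.
move=> /near_interval[e e0 K].
apply/nbhs_ballP; exists e => //= s; rewrite /ball /= ltr_norml => /andP[s1 s2] /andP[as_ sb].
by apply: K; try lra; apply/andP; split; lra.
Qed.

Definition rect a b c d : set (R * R) :=
  [set p | a <= p.1 <= b /\ c <= p.2 <= d].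

Definition gsquare (F : R * R -> plane) a b c d : Prop :=
  (forall p, rect a b c d p -> F @ within (rect a b c d) (nbhs p) --> F p) /\
  (forall p, rect a b c d p -> F p != 0).

(** The winding parity of [F] around the boundary of the rectangle; modulo 2 the orientation of the
    sides is irrelevant. *)
Definition bpar (F : R * R -> plane) a b c d : bool :=
  par (fun s => F (s, c)) a b (+) par (fun s => F (s, d)) a b (+)
  par (fun t => F (a, t)) c d (+) par (fun t => F (b, t)) c d.

Lemma cvg_within_to (T U : topologicalType) (D : set T) (E : set U) (f : T -> U) (p : T) :
  (forall q, D q -> E (f q)) -> f @ within D (nbhs p) --> f p ->
  f @ within D (nbhs p) --> within E (nbhs (f p)).
Proof.
move=> DE cf A; rewrite /within /= => /cf; rewrite /nbhs /= /within /=.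
by apply: filterS => q H Dq; apply: H => //; apply: DE.
Qed.

Lemma cvg_to_pair (T : Type) (F : set_system T) {FF : Filter F}
    (U V : topologicalType) (f : T -> U) (g : T -> V) (u : U) (v : V) :
  f @ F --> u -> g @ F --> v -> (fun x => (f x, g x)) @ F --> (u, v).
Proof.
move=> cf cg A [[B C] /= [uB vC] BC].
have H : F ((f @^-1` B) `&` (g @^-1` C)) by apply: filterI; [exact: cf|exact: cg].
by apply: (@filterS _ F _ _ _ _ H) => x [? ?]; apply: BC.
Qed.

Lemma gsquare_row F a b c d t : gsquare F a b c d -> c <= t <= d ->
  gpath (fun s => F (s, t)) a b.
Proof.
move=> [cF nz] tI; split=> s sI; last by apply: nz.
apply: cvg_comp (cF (s, t) _); last by [].
apply: (@cvg_within_to _ _ _ _ (fun s => (s, t))) => //.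
by apply: cvg_to_pair; [exact: cvg_within|exact: cvg_cst].
Qed.

Lemma gsquare_col F a b c d s : gsquare F a b c d -> a <= s <= b ->
  gpath (fun t => F (s, t)) c d.
Proof.
move=> [cF nz] sI; split=> t tI; last by apply: nz.
apply: cvg_comp (cF (s, t) _); last by [].
apply: (@cvg_within_to _ _ _ _ (fun t => (s, t))) => //.
by apply: cvg_to_pair; [exact: cvg_cst|exact: cvg_within].
Qed.

Lemma bpar_cat1 F a m b c d : a <= m -> m <= b ->
  gpath (fun s => F (s, c)) a b -> gpath (fun s => F (s, d)) a b ->
  bpar F a b c d = bpar F a m c d (+) bpar F m b c d.
Proof.
move=> am mb gc gd.
by rewrite /bpar (par_cat am mb gc) (par_cat am mb gd); xor.
Qed.

Lemma bpar_cat2 F a b c m d : c <= m -> m <= d ->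
  gpath (fun t => F (a, t)) c d -> gpath (fun t => F (b, t)) c d ->
  bpar F a b c d = bpar F a b c m (+) bpar F a b m d.
Proof.
move=> cm md ga gb.
by rewrite /bpar (par_cat cm md ga) (par_cat cm md gb); xor.
Qed.

Lemma gsquare_sub F a b c d a' b' c' d' : gsquare F a b c d ->
  a <= a' -> b' <= b -> c <= c' -> d' <= d -> gsquare F a' b' c' d'.
Proof.
move=> [cF nz] aa bb cc dd.
have S : rect a' b' c' d' `<=` rect a b c d.
  move=> [x y] [/= /andP[x1 x2] /andP[y1 y2]]; split; apply/andP; split => /=; lra.
split=> p Dp; last by apply: nz; apply: S.
by apply: cvg_trans (cF p (S _ Dp)); apply: cvg_app; apply: within_subset.
Qed.

(** Boundary parities add when rectangles are glued, and on a small rectangle around [(x, y)] all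
    four sides have the common lift [jump (F (x, y))], so that the corners cancel. [cousin] is
    applied to the first coordinate and, inside it, to the second. *)
Lemma bpar0 F a b c d : a <= b -> c <= d -> gsquare F a b c d ->
  bpar F a b c d = false.
Proof.
move=> ab cd gF.
apply: (cousin (Q := fun s s' => bpar F s s' c d = false)) => //; last first.
  move=> s t r as_ st tr rb H1 H2.
  have gF' := gsquare_sub gF as_ rb (lexx c) (lexx d).
  rewrite (bpar_cat1 st tr) ?H1 ?H2 //.
    by apply: gsquare_row gF' _; rewrite lexx.
  by apply: gsquare_row gF' _; rewrite lexx andbT.
move=> x /andP[ax xb].
(* The inner statement concerns a strip around [x] whose width [e] may depend on the interval of the
   second coordinate; gluing takes the smaller width. *)
apply: (cousin (Q := fun t t' => exists2 e, 0 < e & forall s s', a <= s ->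
   s <= x -> x <= s' -> s' <= b -> x - e < s -> s' < x + e ->
   bpar F s s' t t' = false)) => //; last first.
  move=> s t r cs st tr rd [e e0 H1] [e' e'0 H2].
  exists (Num.min e e'); first by rewrite lt_min e0.
  move=> q q' aq qx xq' q'b; rewrite ltrBlDr -ltrBlDl lt_min => /andP[h1 h2].
  rewrite -ltrBlDl lt_min => /andP[h3 h4].
  have gF' := gsquare_sub gF aq q'b cs rd.
  rewrite (bpar_cat2 st tr) ?H1 ?H2 //; try lra.
    by apply: gsquare_col gF' _; rewrite lexx (le_trans qx xq').
  by apply: gsquare_col gF' _; rewrite lexx andbT (le_trans qx xq').
move=> y /andP[cy yd].
have Dp : rect a b c d (x, y) by split; apply/andP.
have := within_nearby (gF.1 _ Dp) (gF.2 _ Dp).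
move=> /nbhs_ballP[e /= e0 H]; exists e => // t t' ct ty yt' t'd et et'.
exists e => // s s' as_ sx xs' s'b es es'.
have K q r : s <= q <= s' -> t <= r <= t' -> nearby (F (x, y)) (F (q, r)).
  move=> /andP[q1 q2] /andP[r1 r2]; apply: H.
    by split; rewrite /ball /= ltr_norml; apply/andP; split; lra.
  by split; apply/andP; split => /=; lra.
have ss := le_trans sx xs'; have tt := le_trans ty yt'.
have gF' := gsquare_sub gF as_ s'b ct t'd.
have s1 : s <= s <= s' by rewrite lexx.
have s2 : s <= s' <= s' by rewrite lexx andbT.
have t1 : t <= t <= t' by rewrite lexx.
have t2 : t <= t' <= t' by rewrite lexx andbT.
have L1 r (rI : t <= r <= t') := jump_lift (gsquare_row gF' rI) (lexx _) (lexx _) (fun q qI => K q r qI rI).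
have L2 q (qI : s <= q <= s') := jump_lift (gsquare_col gF' qI) (lexx _) (lexx _) (fun r rI => K q r qI rI).
rewrite /bpar (parE ss (L1 t t1)) (parE ss (L1 t' t2)) (parE tt (L2 s s1)) (parE tt (L2 s' s2)).
by xor.
Qed.

End Parity.

(** * Intersection numbers mod 2 *)

Definition ctn (T U : topologicalType) (D : set T) (f : T -> U) : Prop :=
  forall p, D p -> f @ within D (nbhs p) --> f p.

Section Continuity.
Variable R : realType.
Implicit Types (T U : topologicalType).

Lemma ctnP T U (D : set T) (f : T -> U) : {within D, continuous f} <-> ctn D f.
Proof. exact: subspace_continuousP. Qed.

Lemma ctn_sub T U (D E : set T) (f : T -> U) : D `<=` E -> ctn E f -> ctn D f.
Proof.
move=> DE cf p /DE /cf H; apply: cvg_trans H; apply: cvg_app.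
exact: within_subset.
Qed.

Lemma ctn_comp T U (V : topologicalType) (D : set T) (E : set U) (f : T -> U) (g : U -> V) :
  (forall p, D p -> E (f p)) -> ctn D f -> ctn E g -> ctn D (fun p => g (f p)).
Proof.
move=> DE cf cg p Dp; apply: cvg_comp (cg (f p) (DE _ Dp)).
exact: cvg_within_to (cf p Dp).
Qed.

Lemma ctn_cst T U (D : set T) (u : U) : ctn D (fun=> u).
Proof. by move=> p _; exact: cvg_cst. Qed.

Lemma ctn_id T (D : set T) : ctn D id.
Proof. by move=> p _; exact: cvg_within. Qed.

Lemma ctn_pair T U (V : topologicalType) (D : set T) (f : T -> U) (g : T -> V) :
  ctn D f -> ctn D g -> ctn D (fun p => (f p, g p)).
Proof. by move=> cf cg p Dp; apply: cvg_to_pair; [exact: cf|exact: cg]. Qed.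

Lemma ctn_fst T U (V : topologicalType) (D : set T) (f : T -> U * V) :
  ctn D f -> ctn D (fun p => (f p).1).
Proof. by move=> cf p Dp; apply: cvg_comp (cf p Dp) _; exact: cvg_fst. Qed.

Lemma ctn_snd T U (V : topologicalType) (D : set T) (f : T -> U * V) :
  ctn D f -> ctn D (fun p => (f p).2).
Proof. by move=> cf p Dp; apply: cvg_comp (cf p Dp) _; exact: cvg_snd. Qed.

Lemma ctnD T (V : normedModType R) (D : set T) (f g : T -> V) :
  ctn D f -> ctn D g -> ctn D (fun p => f p + g p).
Proof. by move=> cf cg p Dp; apply: cvgD; [exact: cf|exact: cg]. Qed.

Lemma ctnN T (V : normedModType R) (D : set T) (f : T -> V) :
  ctn D f -> ctn D (fun p => - f p).
Proof. by move=> cf p Dp; apply: cvgN; exact: cf. Qed.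

Lemma ctnM T (D : set T) (f g : T -> R) :
  ctn D f -> ctn D g -> ctn D (fun p => f p * g p).
Proof. by move=> cf cg p Dp; apply: cvgM; [exact: cf|exact: cg]. Qed.

End Continuity.

Section Intersection.
Variable R : realType.
Local Notation plane := (plane R).
Implicit Types (a b c d s t : R) (e f g : R -> plane).

Definition pcont e a b : Prop := ctn [set s | a <= s <= b] e.

Lemma pcont_sub e a b c d : pcont e a b -> a <= c -> d <= b -> pcont e c d.
Proof.
move=> ce ac db; apply: ctn_sub ce => s /= /andP[cs sd].
by rewrite (le_trans ac cs) (le_trans sd db).
Qed.

Lemma gpath_subl e a b (p : plane) : pcont e a b ->
  (forall s, a <= s <= b -> e s != p) -> gpath (fun s => e s - p) a b.
Proof.
move=> ce ne; split => s sI; last by rewrite subr_eq0 ne.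
exact: (ctnD ce (@ctn_cst _ _ _ (- p))).
Qed.

Lemma gpath_subr e a b (p : plane) : pcont e a b ->
  (forall s, a <= s <= b -> e s != p) -> gpath (fun s => p - e s) a b.
Proof.
move=> ce ne; split => s sI; last by rewrite subr_eq0 eq_sym ne.
exact: (ctnD (@ctn_cst _ _ _ p) (ctnN ce)).
Qed.

(** The zeros of [e s - f t] are the common points of the two paths. Its winding parity along the
    boundary of the parameter rectangle counts them modulo 2 when they are proper crossings. *)
Definition inum e a b f c d : bool := bpar (fun p => e p.1 - f p.2) a b c d.

Lemma inum0 e a b f c d : a <= b -> c <= d -> pcont e a b -> pcont f c d ->
  (forall s t, a <= s <= b -> c <= t <= d -> e s != f t) ->
  inum e a b f c d = false.
Proof.
move=> ab cd ce cf ne; apply: bpar0 => //; split => p [p1 p2]; last first.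
  by rewrite subr_eq0 ne.
have := @ctnD _ _ _ (rect a b c d) (fun p => e p.1) (fun p => - f p.2).
apply => //.
  by apply: ctn_comp ce => [q []//|]; apply: ctn_fst; exact: ctn_id.
by apply: ctnN; apply: ctn_comp cf => [q []//|]; apply: ctn_snd; exact: ctn_id.
Qed.

Lemma inum_cat1 e a m b f c d : a <= m -> m <= b -> pcont e a b ->
  (forall s, a <= s <= b -> e s != f c) -> (forall s, a <= s <= b -> e s != f d) ->
  inum e a b f c d = inum e a m f c d (+) inum e m b f c d.
Proof.
by move=> am mb ce nc nd; apply: bpar_cat1 => //; [exact: gpath_subl nc|exact: gpath_subl nd].
Qed.

Lemma inum_cat2 e a b f c m d : c <= m -> m <= d -> pcont f c d ->
  (forall t, c <= t <= d -> f t != e a) -> (forall t, c <= t <= d -> f t != e b) ->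
  inum e a b f c d = inum e a b f c m (+) inum e a b f m d.
Proof.
by move=> cm md cf na nb; apply: bpar_cat2 => //; [exact: gpath_subr na|exact: gpath_subr nb].
Qed.

Definition turn (p : plane) f c d : bool := par (fun t => p - f t) c d.

Definition above (p q : plane) : bool := upper (p - q).

Lemma aboveN p q : p != q -> above q p = ~~ above p q.
Proof. by move=> pq; rewrite /above -opprB upperN // subr_eq0. Qed.

(** On each side of the parameter rectangle one path is viewed from an end of the other. Replacing
    [e s - q] by [q - e s] costs two [above] terms by [par_opp]. Only terms for an end and a path,
    or for two ends, remain; every later cancellation rests on this form. *)
Lemma inum_star e a b f c d : a <= b -> pcont e a b ->
  (forall s, a <= s <= b -> e s != f c) -> (forall s, a <= s <= b -> e s != f d) ->
  inum e a b f c d =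
    turn (e a) f c d (+) turn (e b) f c d (+) turn (f c) e a b (+) turn (f d) e a b (+)
    (above (f c) (e a) (+) above (f c) (e b) (+) above (f d) (e a) (+) above (f d) (e b)).
Proof.
move=> ab ce nc nd; rewrite /inum /bpar /turn /above /=.
have K q : (forall s, a <= s <= b -> e s != q) ->
    par (fun s => e s - q) a b =
    par (fun s => q - e s) a b (+) upper (q - e a) (+) upper (q - e b).
  move=> nq; rewrite -(par_opp ab (gpath_subr ce nq)).
  by apply: par_ext => s _; rewrite opprB.
by rewrite (K _ nc) (K _ nd); xor.
Qed.

(** Each side of the rectangle sweeps out a square free of zeros; the boundary parities of these
    four squares add up to the difference between the two times. *)
Lemma bpar_homotopy (H : R -> R * R -> plane) a b c d : a <= b -> c <= d ->
  gsquare (fun p => H p.1 (p.2, c)) 0 1 a b ->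
  gsquare (fun p => H p.1 (p.2, d)) 0 1 a b ->
  gsquare (fun p => H p.1 (a, p.2)) 0 1 c d ->
  gsquare (fun p => H p.1 (b, p.2)) 0 1 c d ->
  bpar (H 0) a b c d = bpar (H 1) a b c d.
Proof.
move=> ab cd /(bpar0 ler01 ab) h1 /(bpar0 ler01 ab) h2 /(bpar0 ler01 cd) h3 /(bpar0 ler01 cd) h4.
have k1 t : bpar (fun p : R * R => H p.1 (p.2, t)) 0 1 a b =
    par (fun u => H u (a, t)) 0 1 (+) par (fun u => H u (b, t)) 0 1 (+)
    par (fun s => H 0 (s, t)) a b (+) par (fun s => H 1 (s, t)) a b by [].
have k2 s : bpar (fun p : R * R => H p.1 (s, p.2)) 0 1 c d =
    par (fun u => H u (s, c)) 0 1 (+) par (fun u => H u (s, d)) 0 1 (+)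
    par (fun t => H 0 (s, t)) c d (+) par (fun t => H 1 (s, t)) c d by [].
have k3 u : bpar (H u) a b c d =
    par (fun s => H u (s, c)) a b (+) par (fun s => H u (s, d)) a b (+)
    par (fun t => H u (a, t)) c d (+) par (fun t => H u (b, t)) c d by [].
move: h1 h2 h3 h4; rewrite !k1 !k2 !k3 => h1 h2 h3 h4.
by apply: (xor_use h1); apply: (xor_use h2); apply: (xor_use h3); apply: (xor_use h4); xor.
Qed.

Lemma oppr_pair (x y : R) : - (x, y) = (- x, - y) :> plane.
Proof. by []. Qed.

(** The degree of an odd map is odd. The antipodal map exchanges opposite sides, whose parities
    therefore differ by values of [upper] at corners; what is left in the sum is [upper] at two
    antipodal corners, exactly one of which is true. *)
Lemma bpar_odd (G : R * R -> plane) a b c d (A B : R) : a < b -> c < d -> A != 0 -> B != 0 ->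
  (forall w, G (- w) = - G w) ->
  gpath (fun s => G (A * ((s + s - a - b) / (b - a)), - B)) a b ->
  gpath (fun t => G (- A, B * ((t + t - c - d) / (d - c)))) c d ->
  bpar (fun p => G (A * ((p.1 + p.1 - a - b) / (b - a)), B * ((p.2 + p.2 - c - d) / (d - c)))) a b c d = true.
Proof.
move=> ab cd A0 B0 oddG g1 g2.
have -> : bpar (fun p => G (A * ((p.1 + p.1 - a - b) / (b - a)), B * ((p.2 + p.2 - c - d) / (d - c)))) a b c d =
  par (fun s => G (A * ((s + s - a - b) / (b - a)), B * ((c + c - c - d) / (d - c)))) a b (+)
  par (fun s => G (A * ((s + s - a - b) / (b - a)), B * ((d + d - c - d) / (d - c)))) a b (+)
  par (fun t => G (A * ((a + a - a - b) / (b - a)), B * ((t + t - c - d) / (d - c)))) c d (+)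
  par (fun t => G (A * ((b + b - a - b) / (b - a)), B * ((t + t - c - d) / (d - c)))) c d by [].
have ab0 : b - a != 0 by rewrite subr_eq0 gt_eqF.
have cd0 : d - c != 0 by rewrite subr_eq0 gt_eqF.
have ea : (a + a - a - b) / (b - a) = -1 by field.
have eb : (b + b - a - b) / (b - a) = 1 by field.
have ec : (c + c - c - d) / (d - c) = -1 by field.
have ed : (d + d - c - d) / (d - c) = 1 by field.
rewrite ea eb ec ed !mulrN1 !mulr1.
have E1 : par (fun s => G (A * ((s + s - a - b) / (b - a)), B)) a b =
    par (fun s => G (A * ((s + s - a - b) / (b - a)), - B)) a b (+)
    upper (G (- A, - B)) (+) upper (G (A, - B)).
  transitivity (par (fun s => - G (A * ((s + s - a - b) / (b - a)), - B)) a b); last first.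
    by rewrite (par_opp (ltW ab) g1) ea eb mulrN1 mulr1.
  rewrite -[RHS](par_rev (ltW ab)).
    apply: par_ext => s _; rewrite -oddG oppr_pair opprK; congr (G (_, _)).
    by field.
  split=> s sI; last by rewrite oppr_eq0; exact: g1.2.
  by apply: cvgN; exact: g1.1.
have E2 : par (fun t => G (A, B * ((t + t - c - d) / (d - c)))) c d =
    par (fun t => G (- A, B * ((t + t - c - d) / (d - c)))) c d (+)
    upper (G (- A, - B)) (+) upper (G (- A, B)).
  transitivity (par (fun t => - G (- A, B * ((t + t - c - d) / (d - c)))) c d); last first.
    by rewrite (par_opp (ltW cd) g2) ec ed mulrN1 mulr1.
  rewrite -[RHS](par_rev (ltW cd)).
    apply: par_ext => s _; rewrite -oddG oppr_pair opprK; congr (G (_, _)).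
    by field.
  split=> s sI; last by rewrite oppr_eq0; exact: g2.2.
  by apply: cvgN; exact: g2.1.
rewrite E1 E2.
have -> : upper (G (- A, B)) = ~~ upper (G (A, - B)).
  rewrite -upperN; first by rewrite -oddG oppr_pair opprK.
  by have := g1.2 b; rewrite eb mulr1; apply; rewrite (ltW ab) lexx.
have aux x y x' y' : x (+) (x (+) y (+) y') (+) x' (+) (x' (+) y (+) ~~ y') = true by xor.
exact: aux.
Qed.

Section Local.
Variables (k : plane -> plane) (al be : R -> R) (a b c d : R).
Hypotheses (ab : a < b) (cd : c < d).
Hypothesis kc : ctn (ball (0 : plane) 1) k.
Hypothesis kinj : forall p q, ball (0 : plane) 1 p -> ball (0 : plane) 1 q -> k p = k q -> p = q.
Hypotheses (alc : ctn [set s | a <= s <= b] al) (bec : ctn [set t | c <= t <= d] be).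
Hypothesis al1 : forall s, a <= s <= b -> `|al s| < 1.
Hypothesis be1 : forall t, c <= t <= d -> `|be t| < 1.
Hypotheses (alS : al a * al b < 0) (beS : be c * be d < 0).

Let in_ball (x y : R) : `|x| < 1 -> `|y| < 1 -> ball (0 : plane) 1 (x, y).
Proof. by move=> x1 y1; split; rewrite /ball /= sub0r normrN. Qed.

(* Moves the two chart points on the axes to antipodal positions, where their difference is an odd map. *)
Let H1 (u : R) (p : R * R) : plane :=
  k (al p.1 * (1 - u / 2), - (u / 2 * be p.2)) - k (- (u / 2 * al p.1), be p.2 * (1 - u / 2)).

Let scale1 (x u : R) : `|x| < 1 -> 0 <= u <= 1 -> `|x * (1 - u / 2)| < 1.
Proof.
move=> x1 /andP[u0 u1]; rewrite normrM (@ger0_norm _ (1 - u / 2)); last by lra.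
by have := normr_ge0 x; nra.
Qed.

Let scale2 (x u : R) : `|x| < 1 -> 0 <= u <= 1 -> `|- (u / 2 * x)| < 1.
Proof.
move=> x1 /andP[u0 u1]; rewrite normrN normrM (@ger0_norm _ (u / 2)); last by lra.
by have := normr_ge0 x; nra.
Qed.

Let G (w : R * R) : plane := k (w.1 / 2, w.2 / 2) - k (- w.1 / 2, - w.2 / 2).

Let G_odd w : G (- w) = - G w.
Proof. by case: w => x y; rewrite /G /= opprB !opprK. Qed.

Let half_ball (x y : R) : `|x| < 1 -> `|y| < 1 -> ball (0 : plane) 1 (x / 2, y / 2).
Proof.
move=> x1 y1; apply: in_ball; rewrite normrM [`|2^-1|]ger0_norm ?invr_ge0 //.
  by have := normr_ge0 x; lra.
by have := normr_ge0 y; lra.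
Qed.

Let G_neq0 (x y : R) : `|x| < 1 -> `|y| < 1 -> (x != 0) || (y != 0) -> G (x, y) != 0.
Proof.
move=> x1 y1; apply: contraTneq => /eqP; rewrite /G subr_eq0 => /eqP E.
have nx : `|- x| < 1 by rewrite normrN.
have ny : `|- y| < 1 by rewrite normrN.
case: (kinj (half_ball x1 y1) (half_ball nx ny) E) => h1 h2; rewrite negb_or !negbK; apply/andP; split; apply/eqP; lra.
Qed.

Let G_ctn (T : topologicalType) (D : set T) (f g : T -> R) : ctn D f -> ctn D g ->
  (forall p, D p -> `|f p| < 1) -> (forall p, D p -> `|g p| < 1) -> ctn D (fun p => G (f p, g p)).
Proof.
move=> cf cg f1 g1; apply: ctnD; last apply: ctnN.
  apply: ctn_comp kc => [p Dp|]; first by apply: half_ball; [exact: f1|exact: g1].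
  by apply: ctn_pair; (apply: ctnM; [|exact: ctn_cst]).
apply: ctn_comp kc => [p Dp|]; first by apply: half_ball; rewrite normrN; [exact: f1|exact: g1].
by apply: ctn_pair; (apply: ctnM; [exact: ctnN|exact: ctn_cst]).
Qed.

Let H1_ctn (T : topologicalType) (D : set T) (u x y : T -> R) :
  ctn D u -> ctn D x -> ctn D y -> (forall p, D p -> 0 <= u p <= 1) ->
  (forall p, D p -> `|x p| < 1) -> (forall p, D p -> `|y p| < 1) ->
  ctn D (fun p => k (x p * (1 - u p / 2), - (u p / 2 * y p))
                  - k (- (u p / 2 * x p), y p * (1 - u p / 2))).
Proof.
move=> cu cx cy u1 x1 y1.
have ch : ctn D (fun p => u p / 2) by apply: ctnM => //; exact: ctn_cst.
have ch' : ctn D (fun p => 1 - u p / 2).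
  by apply: ctnD; [exact: ctn_cst|exact: ctnN].
apply: ctnD; last apply: ctnN; apply: ctn_comp kc => [p Dp|].
- by apply: in_ball; [apply: scale1|apply: scale2]; auto.
- by apply: ctn_pair; [exact: ctnM|apply: ctnN; exact: ctnM].
- by apply: in_ball; [apply: scale2|apply: scale1]; auto.
- by apply: ctn_pair; [apply: ctnN; exact: ctnM|exact: ctnM].
Qed.

Let H1_neq0 (u x y : R) : 0 <= u <= 1 -> `|x| < 1 -> `|y| < 1 -> (x != 0) || (y != 0) ->
  k (x * (1 - u / 2), - (u / 2 * y)) - k (- (u / 2 * x), y * (1 - u / 2)) != 0.
Proof.
move=> u1 x1 y1; apply: contraTneq => /eqP; rewrite subr_eq0 => /eqP E.
case: (kinj (in_ball (scale1 x1 u1) (scale2 y1 u1)) (in_ball (scale2 x1 u1) (scale1 y1 u1)) E).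
move=> h1 h2; rewrite negb_or !negbK; apply/andP; split; apply/eqP; lra.
Qed.

(** Two homotopies of the boundary values lead to [bpar_odd]. [H1] ends at [G (al, - be)] with [G]
    odd; the two arguments of [k] in it always differ by [(al, - be)], which is nonzero on the
    boundary. [H2] then deforms [al] and [- be] linearly into affine functions with the same signs
    at the ends. *)
Lemma inum_chart (e f : R -> plane) :
  (forall s, a <= s <= b -> e s = k (al s, 0)) ->
  (forall t, c <= t <= d -> f t = k (0, be t)) ->
  inum e a b f c d = true.
Proof.
move=> eE fE.
have ab' := ltW ab; have cd' := ltW cd.
have aI : a <= a <= b by rewrite lexx.
have bI : a <= b <= b by rewrite lexx andbT.
have cI : c <= c <= d by rewrite lexx.
have dI : c <= d <= d by rewrite lexx andbT.
have [al_a al_b] : al a != 0 /\ al b != 0.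
  by split; apply: contraTneq alS => ->; rewrite ?mulr0 ?mul0r ltxx.
have [be_c be_d] : be c != 0 /\ be d != 0.
  by split; apply: contraTneq beS => ->; rewrite ?mulr0 ?mul0r ltxx.
have -> : inum e a b f c d = bpar (H1 0) a b c d.
  rewrite /inum /bpar /H1 /=.
  congr (_ (+) _ (+) _ (+) _); apply: par_ext => s sI;
    rewrite eE // fE // !mul0r !oppr0 addr0 !mulr1 ?mul0r //.
have cfst x y x' y' : ctn (rect x y x' y') (fun p : R * R => p.1) by apply: ctn_fst; exact: ctn_id.
have csnd x y x' y' : ctn (rect x y x' y') (fun p : R * R => p.2) by apply: ctn_snd; exact: ctn_id.
have cal x y : ctn (rect x y a b) (fun p : R * R => al p.2) by apply: ctn_comp alc => // p [].
have cbe x y : ctn (rect x y c d) (fun p : R * R => be p.2) by apply: ctn_comp bec => // p [].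
rewrite (@bpar_homotopy H1) //; try (split => p; [move: p; apply: H1_ctn => //=; try exact: ctn_cst;
   move=> p [p1 p2]; rewrite ?al1 ?be1 //
 | move=> [p1 p2]; apply: H1_neq0; rewrite ?al1 ?be1 // ?al_a ?al_b ?be_c ?be_d ?orbT //]).
(* With these values [aa] and [bb] agree with [al] and [- be] at [b] and [d], and have the same
   signs as these at [a] and [c], so that the linear deformation keeps the relevant coordinate
   nonzero on each side. *)
pose B := - be d; pose A := al b.
have B0 : B != 0 by rewrite oppr_eq0.
pose aa (s : R) := A * ((s + s - a - b) / (b - a)).
pose bb (t : R) := B * ((t + t - c - d) / (d - c)).
have ab0 : 0 < b - a by rewrite subr_gt0.
have cd0 : 0 < d - c by rewrite subr_gt0.
have unit1 (x y s : R) : x < y -> x <= s <= y -> `|(s + s - x - y) / (y - x)| <= 1.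
  move=> xy /andP[xs sy]; have yx : 0 < y - x by rewrite subr_gt0.
  rewrite normrM [`|(y - x)^-1|]ger0_norm ?invr_ge0 ?(ltW yx) // ler_pdivrMr // mul1r.
  by rewrite ler_norml; apply/andP; split; lra.
have aa1 s : a <= s <= b -> `|aa s| < 1.
  move=> sI; rewrite normrM.
  have := unit1 a b s ab sI; have := al1 bI; rewrite -/A.
  by have := normr_ge0 A; have := normr_ge0 ((s + s - a - b) / (b - a)); nra.
have bb1 t : c <= t <= d -> `|bb t| < 1.
  move=> tI; rewrite normrM.
  have := unit1 c d t cd tI; have := be1 dI; rewrite -(normrN (be d)) -/B.
  by have := normr_ge0 B; have := normr_ge0 ((t + t - c - d) / (d - c)); nra.
pose H2 (u : R) (p : R * R) : plane :=
  G ((1 - u) * al p.1 + u * aa p.1, (1 - u) * (- be p.2) + u * bb p.2).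
have aaa : aa a = - al b.
  by rewrite /aa /A; field; rewrite subr_eq0 gt_eqF.
have aab : aa b = al b.
  by rewrite /aa /A; field; rewrite subr_eq0 gt_eqF.
have bbc : bb c = be d.
  by rewrite /bb /B; field; rewrite subr_eq0 gt_eqF.
have bbd : bb d = - be d.
  by rewrite /bb /B; field; rewrite subr_eq0 gt_eqF.
have caff (T : topologicalType) (D : set T) (x y z w : R) (h : T -> R) : ctn D h ->
    ctn D (fun p => z * ((h p + h p - x - y) / w)).
  move=> ch; apply: ctnM; first exact: ctn_cst.
  apply: ctnM; last exact: ctn_cst.
  by apply: ctnD; [apply: ctnD; [exact: ctnD|exact: ctn_cst]|exact: ctn_cst].
have mix (x y u : R) : `|x| < 1 -> `|y| < 1 -> 0 <= u <= 1 -> `|(1 - u) * x + u * y| < 1.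
  rewrite !ltr_norml => /andP[x0 x1] /andP[y0 y1] /andP[u0 u1].
  have [-> |ne] := eqVneq u 1; first by apply/andP; split; lra.
  have u1' : 0 < 1 - u by rewrite subr_gt0 lt_neqAle ne.
  have X1 : 0 < (1 - u) * (1 - x) by apply: mulr_gt0 => //; lra.
  have X2 : 0 < (1 - u) * (1 + x) by apply: mulr_gt0 => //; lra.
  have Y1 : 0 <= u * (1 - y) by apply: mulr_ge0 => //; lra.
  have Y2 : 0 <= u * (1 + y) by apply: mulr_ge0 => //; lra.
  by apply/andP; split; lra.
have cmix (T : topologicalType) (D : set T) (u x y : T -> R) : ctn D u -> ctn D x -> ctn D y ->
    ctn D (fun p => (1 - u p) * x p + u p * y p).
  move=> cu cx cy; apply: ctnD; last exact: ctnM.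
  by apply: ctnM => //; apply: ctnD; [exact: ctn_cst|exact: ctnN].
have mixn0 (x y u : R) : x * y > 0 -> 0 <= u <= 1 -> (1 - u) * x + u * y != 0.
  move=> xy /andP[u0 u1]; apply/eqP => E.
  have XE : (1 - u) * (x * x) + u * (x * y) = 0 by rewrite -(mulr0 x) -E; ring.
  have x0 : x != 0 by apply: contraTneq xy => ->; rewrite mul0r ltxx.
  have xx : 0 < x * x by rewrite -expr2 exprn_even_gt0 //= x0.
  have [u1'|ne] := eqVneq u 1; first by rewrite u1' in XE; lra.
  have X1 : 0 < (1 - u) * (x * x).
    by apply: mulr_gt0 => //; rewrite subr_gt0 lt_neqAle ne.
  have X2 : 0 <= u * (x * y) by apply: mulr_ge0 => //; exact: ltW.
  lra.
have -> : bpar (H1 1) a b c d = bpar (H2 0) a b c d.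
  rewrite /bpar /H1 /H2 /G /=.
  congr (_ (+) _ (+) _ (+) _); apply: par_ext => s sI;
    by congr (k (_, _) - k (_, _)); field.
have hA : 0 < al a * aa a by rewrite aaa mulrN oppr_gt0.
have hB : 0 < al b * aa b by rewrite aab -expr2 exprn_even_gt0.
have hC : 0 < - be c * bb c by rewrite bbc mulNr oppr_gt0.
have hD : 0 < - be d * bb d by rewrite bbd mulrNN -expr2 exprn_even_gt0.
have nB : `|- B| < 1 by rewrite opprK be1.
have nA : `|- A| < 1 by rewrite normrN al1.
rewrite (@bpar_homotopy H2) //; try (split => p; [move: p; apply: G_ctn;
   [apply: cmix => //=; try exact: ctn_cst; try exact: caff
   |apply: cmix => //=; try exact: ctn_cst; try exact: caff; try exact: ctnN
   |move=> p [p1 p2]; apply: mix; rewrite ?al1 ?aa1 //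
   |move=> p [p1 p2]; apply: mix; rewrite ?normrN ?be1 ?bb1 //]
  | move=> [p1 p2]; apply: G_neq0;
    [apply: mix; rewrite ?al1 ?aa1 //|apply: mix; rewrite ?normrN ?be1 ?bb1 //|
     apply/orP; first [by left; exact: mixn0 hA p1 | by left; exact: mixn0 hB p1
        | by right; exact: mixn0 hC p1 | by right; exact: mixn0 hD p1]]]).
have -> : bpar (H2 1) a b c d = bpar (fun p => G (aa p.1, bb p.2)) a b c d.
  rewrite /bpar /H2 /=.
  by congr (_ (+) _ (+) _ (+) _); apply: par_ext => s sI; rewrite !subrr !mul0r !add0r !mul1r.
apply: bpar_odd => //; split => s sI.
- apply: (@G_ctn _ [set s | a <= s <= b] aa (fun=> - B)) => //.
  + by apply: caff; exact: ctn_id.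
  + exact: ctn_cst.
- apply: G_neq0; rewrite ?aa1 //.
  by rewrite oppr_eq0 B0 orbT.
- apply: (@G_ctn _ [set s | c <= s <= d] (fun=> - A) bb) => //.
  + exact: ctn_cst.
  + by apply: caff; exact: ctn_id.
- apply: G_neq0; rewrite ?bb1 //.
  by rewrite oppr_eq0 al_b.
Qed.

End Local.

End Intersection.

(** * A proper crossing counts once *)

Section Crossing.
Variable R : realType.
Local Notation plane := (plane R).
Implicit Types (a b c d s t : R) (e f g : R -> plane).

Lemma ctn_itv (f : R -> R) a b : ctn [set s | a <= s <= b] f ->
  {within `[a, b], continuous f}.
Proof. by move=> cf; apply/ctnP; rewrite set_itvcc. Qed.

(** If both ends had the same sign, the end value of smaller modulus would be attained on both sides
    of [s0]; by injectivity only at [s0] itself, where the value is zero. *)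
Lemma inj_sign_change (f : R -> R) a s0 b : a < s0 -> s0 < b ->
  ctn [set s | a <= s <= b] f ->
  (forall s t, a <= s <= b -> a <= t <= b -> f s = f t -> s = t) ->
  f s0 = 0 -> f a * f b < 0.
Proof.
move=> as0 s0b cf inj f0.
have aI : a <= a <= b by rewrite lexx; lra.
have bI : a <= b <= b by rewrite lexx andbT; lra.
have sI : a <= s0 <= b by apply/andP; split; lra.
have fa : f a != 0.
  by apply/eqP => fa; have := inj _ _ aI sI; rewrite fa f0 => /(_ erefl); lra.
have fb : f b != 0.
  by apply/eqP => fb; have := inj _ _ bI sI; rewrite fb f0 => /(_ erefl); lra.
rewrite ltNge; apply/negP => H.
have ca : ctn [set s | a <= s <= s0] f by apply: ctn_sub cf => s /=; lra.
have cb : ctn [set s | s0 <= s <= b] f by apply: ctn_sub cf => s /=; lra.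
have K v : Num.min (f a) 0 <= v <= Num.max (f a) 0 ->
    Num.min 0 (f b) <= v <= Num.max 0 (f b) -> v != 0 -> False.
  move=> va vb v0.
  have [|x] := @IVT _ f a s0 v (ltW as0) (ctn_itv ca); first by rewrite f0.
  rewrite in_itv /= => /andP[x1 x2] xv.
  have [|y] := @IVT _ f s0 b v (ltW s0b) (ctn_itv cb); first by rewrite f0.
  rewrite in_itv /= => /andP[y1 y2] yv.
  have xy : x = y by apply: inj; rewrite ?xv ?yv //; lra.
  have xs : x = s0 by lra.
  by move: v0; rewrite -xv xs f0 eqxx.
have [fa0|fa0] := ltP (f a) 0.
  have fb0 : f b < 0 by rewrite lt_neqAle fb /=; nra.
  apply: (K (Num.max (f a) (f b))).
  - by rewrite (min_l (ltW fa0)) (max_r (ltW fa0)) le_max lexx ge_max (ltW fa0) (ltW fb0).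
  - by rewrite (min_r (ltW fb0)) (max_l (ltW fb0)) le_max lexx orbT ge_max (ltW fa0) (ltW fb0).
  - by rewrite lt_eqF // gt_max fa0.
have {}fa0 : 0 < f a by rewrite lt_neqAle eq_sym fa.
have fb0 : 0 < f b by rewrite lt_neqAle eq_sym fb /=; nra.
apply: (K (Num.min (f a) (f b))).
- by rewrite (min_r (ltW fa0)) (max_l (ltW fa0)) ge_min lexx le_min (ltW fa0) (ltW fb0).
- by rewrite (min_l (ltW fb0)) (max_r (ltW fb0)) ge_min lexx orbT le_min (ltW fa0) (ltW fb0).
- by rewrite gt_eqF // lt_min fa0.
Qed.

Lemma nbhd_interval e a b s0 (U : set plane) : a < s0 -> s0 < b -> pcont e a b ->
  open U -> U (e s0) -> exists s1 s2,
  [/\ a < s1, s1 < s0, s0 < s2, s2 < b & forall s, s1 <= s <= s2 -> U (e s)].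
Proof.
move=> as0 s0b ce oU Ux.
have sI : a <= s0 <= b by apply/andP; split; lra.
have : nbhs (e s0) U by apply: open_nbhs_nbhs.
move=> /(ce s0 sI) H.
have {}H : \forall s \near s0, a <= s <= b -> U (e s) := H.
have [ep ep0 {}H] := near_interval H.
pose m := Num.min ep (Num.min (s0 - a) (b - s0)).
have m0 : 0 < m by rewrite !lt_min ep0; lra.
have m1 : m <= ep by rewrite ge_min lexx.
have m2 : m <= s0 - a by rewrite ge_min ge_min lexx orbT.
have m3 : m <= b - s0 by rewrite ge_min ge_min lexx !orbT.
exists (s0 - m / 2), (s0 + m / 2); split; try lra.
by move=> s /andP[s1 s2]; apply: H; try lra; apply/andP; split; lra.
Qed.

(** Near the crossing the chart straightens both arcs to the axes, and injectivity makes the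
    coordinate of each change sign, so [inum_chart] applies. The remaining parts of the parameter
    rectangle contain no common point and are cut off one after the other. *)
Lemma inum_crossing e f a b c d s0 t0 (A B : set plane) :
  a < s0 -> s0 < b -> c < t0 -> t0 < d -> pcont e a b -> pcont f c d ->
  (forall s, a <= s <= b -> A (e s)) -> (forall t, c <= t <= d -> B (f t)) ->
  (forall s s', a <= s <= b -> a <= s' <= b -> e s = e s' -> s = s') ->
  (forall s s', c <= s <= d -> c <= s' <= d -> f s = f s' -> s = s') ->
  e s0 = f t0 -> proper_crossing A B (e s0) ->
  (forall s t, a <= s <= b -> c <= t <= d -> e s = f t -> s = s0 /\ t = t0) ->
  inum e a b f c d = true.
Proof.
move=> as0 s0b ct0 t0d ce cf eA fB einj finj ef [U [h [k [oU Ux hx [hk kh hc kc] AB]]]] uniq.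
have [s1 [s2 [as1 s1s s2s s2b sU]]] := nbhd_interval as0 s0b ce oU Ux.
have [t1 [t2 [ct1 t1t t2t t2d tU]]] : exists t1 t2,
  [/\ c < t1, t1 < t0, t0 < t2, t2 < d & forall t, t1 <= t <= t2 -> U (f t)].
  by apply: nbhd_interval => //; rewrite -ef.
have ss s : s1 <= s <= s2 -> a <= s <= b by move=> ?; lra.
have tt t : t1 <= t <= t2 -> c <= t <= d by move=> ?; lra.
have hcc := (ctnP _ _).1 hc.
have core : inum e s1 s2 f t1 t2 = true.
  have he s : s1 <= s <= s2 -> h (e s) = ((h (e s)).1, 0).
    move=> sI; have /eA /(AB _ (sU _ sI)).1 := ss _ sI.
    by case: (h (e s)) => x y /= ->.
  have hf t : t1 <= t <= t2 -> h (f t) = (0, (h (f t)).2).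
    move=> tI; have /fB /(AB _ (tU _ tI)).2 := tt _ tI.
    by case: (h (f t)) => x y /= ->.
  have ce' : ctn [set s | s1 <= s <= s2] (fun s => h (e s)).
    by apply: ctn_comp hcc => //; apply: ctn_sub ce => s /= /ss.
  have cf' : ctn [set t | t1 <= t <= t2] (fun t => h (f t)).
    by apply: ctn_comp hcc => //; apply: ctn_sub cf => s /= /tt.
  have einj' s s' : s1 <= s <= s2 -> s1 <= s' <= s2 -> (h (e s)).1 = (h (e s')).1 -> s = s'.
    move=> sI sI' E; apply: einj; [exact: ss|exact: ss|].
    rewrite -(hk _ (sU _ sI)).2 -(hk _ (sU _ sI')).2.
    by rewrite he // E -he.
  have finj' s s' : t1 <= s <= t2 -> t1 <= s' <= t2 -> (h (f s)).2 = (h (f s')).2 -> s = s'.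
    move=> sI sI' E; apply: finj; [exact: tt|exact: tt|].
    rewrite -(hk _ (tU _ sI)).2 -(hk _ (tU _ sI')).2.
    by rewrite hf // E -hf.
  apply: (@inum_chart _ k (fun s => (h (e s)).1) (fun t => (h (f t)).2)).
  - lra.
  - lra.
  - exact/ctnP.
  - by move=> p q Bp Bq E; rewrite -(kh _ Bp).2 -(kh _ Bq).2 E.
  - exact: ctn_fst ce'.
  - exact: ctn_snd cf'.
  - move=> s sI; have [[]] := (hk _ (sU _ sI)).1.
    by rewrite /ball /= sub0r normrN.
  - move=> t tI; have [[]] := (hk _ (tU _ tI)).1.
    by rewrite /ball /= !sub0r !normrN.
  - by apply: (@inj_sign_change (fun s => (h (e s)).1) s1 s0 s2) => //; [exact: ctn_fst ce'|rewrite hx].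
  - by apply: (@inj_sign_change (fun t => (h (f t)).2) t1 t0 t2) => //; [exact: ctn_snd cf'|rewrite -ef hx].
  - by move=> s sI; rewrite -he //; rewrite (hk _ (sU _ sI)).2.
  - by move=> t tI; rewrite -hf //; rewrite (hk _ (tU _ tI)).2.
have ne s t : a <= s <= b -> c <= t <= d -> (s != s0) || (t != t0) -> e s != f t.
  by move=> sI tI; apply: contraTneq => /(uniq _ _ sI tI) [-> ->]; rewrite !eqxx.
have z x y x' y' : x <= y -> x' <= y' -> a <= x -> y <= b -> c <= x' -> y' <= d ->
    (y < s0) || (s0 < x) || (y' < t0) || (t0 < x') -> inum e x y f x' y' = false.
  move=> xy xy' ax yb cx yd H; apply: inum0 => //.
  - by apply: pcont_sub ce _ _.
  - by apply: pcont_sub cf _ _.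
  move=> s t /andP[sI1 sI2] /andP[tI1 tI2]; apply: ne; try by apply/andP; split; lra.
  move: H; rewrite -!orbA => /or4P[H|H|H|H]; apply/orP.
  - by left; rewrite lt_eqF //; lra.
  - by left; rewrite gt_eqF //; lra.
  - by right; rewrite lt_eqF //; lra.
  - by right; rewrite gt_eqF //; lra.
rewrite (@inum_cat1 _ e a s1); try lra; first last.
- by move=> s sI; apply: ne => //; [lra|rewrite (@gt_eqF _ _ d) ?orbT //; lra].
- by move=> s sI; apply: ne => //; [lra|rewrite (@lt_eqF _ _ c) ?orbT //; lra].
- by [].
rewrite (z a s1) ?s1s //; try lra; rewrite addFb.
rewrite (@inum_cat1 _ e s1 s2); try lra; first last.
- by move=> s sI; apply: ne => //; [lra|lra|rewrite (@gt_eqF _ _ d) ?orbT //; lra].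
- by move=> s sI; apply: ne => //; [lra|lra|rewrite (@lt_eqF _ _ c) ?orbT //; lra].
- by apply: pcont_sub ce _ _; lra.
rewrite (z s2 b) ?s2s ?orbT //; try lra; rewrite addbF.
rewrite (@inum_cat2 _ e s1 s2 f c t1); try lra; first last.
- by move=> t tI; rewrite eq_sym; apply: ne => //; [lra|rewrite gt_eqF //; lra].
- by move=> t tI; rewrite eq_sym; apply: ne => //; [lra|rewrite lt_eqF //; lra].
- by [].
rewrite (z s1 s2 c t1) ?t1t ?orbT //; try lra; rewrite addFb.
rewrite (@inum_cat2 _ e s1 s2 f t1 t2); try lra; first last.
- by move=> t tI; rewrite eq_sym; apply: ne => //; [lra|lra|rewrite gt_eqF //; lra].
- by move=> t tI; rewrite eq_sym; apply: ne => //; [lra|lra|rewrite lt_eqF //; lra].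
- by apply: pcont_sub cf _ _; lra.
by rewrite (z s1 s2 t2 d) ?t2t ?orbT ?addbF //; try lra.
Qed.

End Crossing.

(** * Winding parity of closed chains *)

Section Winding.
Variable R : realType.
Local Notation plane := (plane R).
Implicit Types (x y : plane).

Definition piece := ((R -> plane) * R * R)%type.
Implicit Types (p q : piece) (L : seq piece).

Definition pstart p : plane := p.1.1 p.1.2.
Definition pend p : plane := p.1.1 p.2.
Definition pimg p : set plane := [set x | exists2 r, p.1.2 <= r <= p.2 & x = p.1.1 r].
Definition pwf p : Prop := p.1.2 <= p.2 /\ pcont p.1.1 p.1.2 p.2.
Definition pall (P : piece -> Prop) L : Prop := foldr (fun q r => P q /\ r) True L.
Definition pinum p q : bool := inum p.1.1 p.1.2 p.2 q.1.1 q.1.2 q.2.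
Definition pturn x q : bool := turn x q.1.1 q.1.2 q.2.
Definition wind L x : bool := \big[addb/false]_(q <- L) pturn x q.
Definition limg L : set plane := [set x | foldr (fun q r => pimg q x \/ r) False L].

(* Every endpoint occurs an even number of times. *)
Definition cycle L : Prop :=
  forall phi : plane -> bool, \big[addb/false]_(q <- L) (phi (pstart q) (+) phi (pend q)) = false.

Lemma pall_imp (P Q : piece -> Prop) L : (forall q, P q -> Q q) -> pall P L -> pall Q L.
Proof. by move=> PQ; elim: L => //= q L IH [/PQ ? /IH]. Qed.

(** In [inum_star] the terms at the ends of a piece [q] of [L] are values of one function [phi] of
    these ends. They cancel over a cycle, and the turns of [L] around the two ends of [p] remain. *)
Lemma wind_inum L p : cycle L -> pwf p -> pall pwf L ->
  pall (fun q => ~ pimg p (pstart q) /\ ~ pimg p (pend q)) L ->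
  \big[addb/false]_(q <- L) pinum p q = wind L (pstart p) (+) wind L (pend p).
Proof.
move=> cL [wp cp] wL nL.
pose phi y := pturn y p (+) above y (pstart p) (+) above y (pend p).
apply: (xor_use (cL phi)); rewrite /wind.
elim: L wL nL {cL} => [|q L IH] /=; first by rewrite !big_nil.
move=> [[wq cq] wL] [[n1 n2] nL]; rewrite !big_cons.
have {}IH : _ (+) _ = false := etrans (congr1 (addb _) (esym (IH wL nL))) (addbb _).
apply: (xor_use IH).
have -> : pinum p q = pturn (pstart p) q (+) pturn (pend p) q (+) (phi (pstart q) (+) phi (pend q)).
  rewrite /pinum (inum_star wp cp).
  - by rewrite /phi /pturn /pstart /pend; xor.
  - by move=> s sI; apply/eqP => E; apply: n1; exists s.
  - by move=> s sI; apply/eqP => E; apply: n2; exists s.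
by xor.
Qed.

Lemma wind_cycles L L' : cycle L -> cycle L' -> pall pwf L -> pall pwf L' ->
  pall (fun p => pall (fun q => ~ pimg p (pstart q) /\ ~ pimg p (pend q)) L) L' ->
  \big[addb/false]_(p <- L') \big[addb/false]_(q <- L) pinum p q = false.
Proof.
move=> cL cL' wL wL' n.
transitivity (\big[addb/false]_(p <- L') (wind L (pstart p) (+) wind L (pend p))); last exact: cL'.
elim: L' wL' n {cL'} => [|p L' IH] /=; first by rewrite !big_nil.
by move=> [wp wL'] [n1 n2]; rewrite !big_cons wind_inum // IH.
Qed.

Lemma par_nojump (g : R -> plane) (s t : R) : s <= t ->
  (forall r r', s <= r <= t -> s <= r' <= t -> jump (g r) (g r') = false) ->
  par g s t = false.
Proof.
move=> st H; rewrite (@parE _ _ _ _ (fun=> false)) // => r rI.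
by apply/nbhs_ballP; exists 1 => //= r' _ r'I; rewrite H.
Qed.

Lemma turn_right x (g : R -> plane) (s t : R) : s <= t ->
  (forall r, s <= r <= t -> (g r).1 <= x.1) -> turn x g s t = false.
Proof.
move=> st H; apply: par_nojump => // r r' /H rI _.
by rewrite /jump [(_ - _).1]/= subr_lt0 ltNge rI andbF.
Qed.

Lemma turn_up x (g : R -> plane) (s t : R) : s <= t ->
  (forall r, s <= r <= t -> (g r).2 < x.2) -> turn x g s t = false.
Proof.
move=> st H; apply: par_nojump => // r r' /H rI /H rI'.
by rewrite /jump /upper ![(_ - _).2]/= !subr_gt0 rI rI'.
Qed.

Lemma turn_down x (g : R -> plane) (s t : R) : s <= t ->
  (forall r, s <= r <= t -> x.2 < (g r).2) -> turn x g s t = false.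
Proof.
move=> st H; apply: par_nojump => // r r' /H rI /H rI'.
by rewrite /jump /upper ![(_ - _).2]/= !subr_gt0 !subr_eq0 !(lt_gtF rI, lt_gtF rI', lt_eqF rI, lt_eqF rI').
Qed.

Lemma turn_left x (g : R -> plane) (s t : R) : s <= t ->
  (forall r, s <= r <= t -> x.1 < (g r).1) ->
  turn x g s t = upper (x - g s) (+) upper (x - g t).
Proof.
move=> st H; rewrite /turn (@parE _ _ _ _ (fun r => upper (x - g r))) // => r rI.
apply/nbhs_ballP; exists 1 => //= r' _ r'I; rewrite /jump [(_ - _).1]/= subr_lt0 H //.
by rewrite andbT.
Qed.

(** The inequality is weak, so that a point of largest abscissa is covered even when it lies on [L];
    [cycles_nested] depends on this. *)
Lemma wind_right L x : pall pwf L ->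
  pall (fun q => forall r, q.1.2 <= r <= q.2 -> (q.1.1 r).1 <= x.1) L -> wind L x = false.
Proof.
rewrite /wind; elim: L => [|q L IH] /=; first by rewrite big_nil.
move=> [[wq _] wL] [H1 H2]; rewrite big_cons IH // addbF.
exact: turn_right.
Qed.

Lemma ball_apart x y : x != y -> exists2 ep : R, 0 < ep & ~ ball x ep y.
Proof.
move=> xy; exists (Num.max `|(x - y).1| `|(x - y).2|).
  by apply: max_gt0; rewrite subr_eq0.
by case=> /=; rewrite /ball /= !lt_max !ltxx /= orbF => h1 h2; lra.
Qed.

Lemma piece_apart q x : pwf q -> ~ pimg q x ->
  exists2 ep : R, 0 < ep & forall r, q.1.2 <= r <= q.2 -> ~ ball x ep (q.1.1 r).
Proof.
case: q => [[g s] t] [/= st cg] nx.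
apply: (cousin (Q := fun s t => exists2 ep : R, 0 < ep & forall r, s <= r <= t -> ~ ball x ep (g r))) => //.
  move=> r0 rI.
  have [|ep ep0 H] := @ball_apart x (g r0).
    by apply/eqP => E; apply: nx; exists r0.
  have K : \forall r \near r0, s <= r <= t -> ball (g r0) (ep / 2) (g r).
    have K : nbhs (g r0) (ball (g r0) (ep / 2)) by apply: nbhsx_ballx; lra.
    exact: (cg r0 rI _ K).
  have [de de0 {}K] := near_interval K.
  exists de => // a b sa ar rb bt a1 b1; exists (ep / 2); first by lra.
  move=> r /andP[ra rb'] bx; apply: H; apply: ball_split bx _.
  by apply: ball_sym; apply: K; try lra; apply/andP; split; lra.
move=> a b c _ ab bc _ [e1 e10 H1] [e2 e20 H2].
exists (Num.min e1 e2); first by rewrite lt_min e10.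
move=> r /andP[ar rc] B; have [rb|br] := leP r b.
  by apply: (H1 r); [rewrite ar|apply: le_ball B; rewrite ge_min lexx].
by apply: (H2 r); [rewrite (ltW br)|apply: le_ball B; rewrite ge_min lexx orbT].
Qed.

Lemma piece_bounded q : pwf q -> exists M : R, forall r, q.1.2 <= r <= q.2 ->
  `|(q.1.1 r).1| <= M /\ `|(q.1.1 r).2| <= M.
Proof.
case: q => [[g s] t] [/= st cg].
apply: (cousin (Q := fun s t => exists M : R, forall r, s <= r <= t -> `|(g r).1| <= M /\ `|(g r).2| <= M)) => //.
  move=> r0 rI.
  have K : \forall r \near r0, s <= r <= t -> ball (g r0) 1 (g r).
    have K : nbhs (g r0) (ball (g r0) 1) by apply: nbhsx_ballx.
    exact: (cg r0 rI _ K).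
  have [de de0 {}K] := near_interval K.
  exists de => // a b sa ar rb bt a1 b1; exists (`|(g r0).1| + `|(g r0).2| + 1).
  move=> r /andP[ra rb'].
  have [|||] := K r; try lra.
  rewrite /ball /= => h1 h2; have := normr_ge0 (g r0).1; have := normr_ge0 (g r0).2.
  have := ler_normB (g r0).1 ((g r0).1 - (g r).1); have := ler_normB (g r0).2 ((g r0).2 - (g r).2).
  by rewrite !subKr => *; split; lra.
move=> a b c _ ab bc _ [M1 H1] [M2 H2]; exists (Num.max M1 M2).
move=> r /andP[ar rc]; have [rb|br] := leP r b.
  have [|h1 h2] := H1 r; first by rewrite ar.
  by rewrite !le_max h1 h2.
have [|h1 h2] := H2 r; first by rewrite (ltW br).
by rewrite !le_max h1 h2 !orbT.
Qed.

(** Moving [x] along a segment inside a ball that misses [L] gives, for each piece, a square without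
    zeros. Hence the turn of the piece changes by the values of [phi] at its two ends, and these
    cancel over a cycle. *)
Lemma wind_locally_constant L x : cycle L -> pall pwf L -> ~ limg L x ->
  exists2 ep : R, 0 < ep & forall y, ball x ep y -> ~ limg L y /\ wind L y = wind L x.
Proof.
move=> cL wL nx.
have [ep ep0 H] : exists2 ep : R, 0 < ep & pall (fun q => forall r, q.1.2 <= r <= q.2 -> ~ ball x ep (q.1.1 r)) L.
  elim: L wL nx {cL} => [|q L IH] /=; first by exists 1.
  move=> [wq wL] nx.
  have [|e1 e10 H1] := @piece_apart q x wq; first by move=> ?; apply: nx; left.
  have [|e2 e20 H2] := IH wL; first by move=> ?; apply: nx; right.
  exists (Num.min e1 e2); first by rewrite lt_min e10.
  split=> [r rI B|].
    by apply: (H1 r rI); apply: le_ball B; rewrite ge_min lexx.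
  apply: pall_imp H2 => q' H2 r rI B.
  by apply: (H2 r rI); apply: le_ball B; rewrite ge_min lexx orbT.
exists ep => // y xy; split.
  rewrite /limg /=; elim: L H {nx cL wL} => [|q L IH] /=; first by move=> _ [].
  move=> [H1 H2] [[r rI E]|]; last exact: IH.
  by apply: (H1 r rI); rewrite -E.
pose sg (u : R) : plane := (x.1 + u * (y.1 - x.1), x.2 + u * (y.2 - x.2)).
pose phi (z : plane) := par (fun u => sg u - z) 0 1.
apply: (xor_use (cL phi)); rewrite /wind -big_split /=.
elim: L wL H {nx cL} => [|q L IH] /=; first by rewrite !big_nil.
move=> [[wq cq] wL] [H1 H2]; rewrite !big_cons {}IH //; congr (_ (+) _).
have gs : gsquare (fun p : R * R => sg p.1 - q.1.1 p.2) 0 1 q.1.2 q.2.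
  split=> p [p1 p2].
    have caff (a b : R) : ctn (rect 0 1 q.1.2 q.2) (fun p : R * R => a + p.1 * b).
      apply: ctnD; first exact: ctn_cst.
      by apply: ctnM; [apply: ctn_fst; exact: ctn_id|exact: ctn_cst].
    have := @ctnD _ _ _ (rect 0 1 q.1.2 q.2) (fun p : R * R => sg p.1) (fun p : R * R => - q.1.1 p.2).
    apply => //; first by apply: ctn_pair; exact: caff.
    by apply: ctnN; apply: ctn_comp cq => [? []//|]; apply: ctn_snd; exact: ctn_id.
  rewrite subr_eq0; apply/eqP => E; apply: (H1 _ p2); rewrite -E.
  case: xy => b1 b2; move: p1 => /andP[u0 u1].
  have K (v w : R) : ball v ep w -> ball v ep (v + p.1 * (w - v)).
    rewrite /ball /= opprD addrA subrr sub0r normrN normrM (ger0_norm u0) distrC => b.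
    by have := normr_ge0 (v - w); rewrite -(distrC w v) in b *; nra.
  by split; apply: K.
have := bpar0 ler01 wq gs; rewrite /bpar /=.
have -> : sg 0 = x by rewrite /sg !mul0r !addr0 -surjective_pairing.
have -> : sg 1 = y by rewrite /sg !mul1r !(addrC x.1) !(addrC x.2) !subrK -surjective_pairing.
have aux A B C D : A (+) B (+) C (+) D = false -> D (+) (A (+) B) = C.
  by case: A B C D => [] [] [] [].
exact: aux.
Qed.

Lemma wind_connected L (E : set plane) x y : cycle L -> pall pwf L ->
  connected E -> (forall z, E z -> ~ limg L z) -> E x -> E y -> wind L x = wind L y.
Proof.
move=> cL wL cE En Ex Ey.
have op b : open [set z | ~ limg L z /\ wind L z = b].
  rewrite openE => z [nz wz]; have [ep ep0 H] := wind_locally_constant cL wL nz.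
  apply/nbhs_ballP; exists ep => //= w /H [nw ww]; split => //.
  by rewrite ww.
pose B := E `&` [set z | ~ limg L z /\ wind L z = wind L x].
have <- : B y -> wind L x = wind L y by move=> [_ [_ ->]].
  by [].
suff -> : B = E by [].
apply: cE.
- by exists x; split => //; split => //; exact: En.
- by exists [set z | ~ limg L z /\ wind L z = wind L x].
- exists (~` [set z | ~ limg L z /\ wind L z = ~~ wind L x]); first by apply: open_closedC.
  apply/seteqP; split => z [Ez].
    by move=> [nz wz]; split => // -[_]; rewrite wz; case: (wind _ _).
  move=> K; split => //; split; first exact: En.
  apply: contrapT => W; apply: K; split; first exact: En.
  by move: W; case: (wind L z); case: (wind L x).
Qed.

Lemma boundedP (A : set plane) (M : R) : (forall z, A z -> `|z.1| <= M /\ `|z.2| <= M) -> bounded_set A.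
Proof.
move=> H; exists M; split; first exact: num_real.
move=> N /ltW MN z /H [h1 h2].
by rewrite /= prod_normE ge_max (le_trans h1 MN) (le_trans h2 MN).
Qed.

(** An unbounded component contains a point far from [L]. If [L] lies to the right of that point,
    each turn is the difference of [upper] at the ends of the piece, and the sum vanishes over a
    cycle; in the other three directions every single turn vanishes. *)
Lemma wind_unbounded L x (Z : set plane) : cycle L -> pall pwf L -> limg L `<=` Z ->
  ~ Z x -> ~ bounded_set (connected_component (~` Z) x) -> wind L x = false.
Proof.
move=> cL wL LZ nx nb.
have [M HM] : exists M : R, pall (fun q => forall r, q.1.2 <= r <= q.2 ->
    `|(q.1.1 r).1| <= M /\ `|(q.1.1 r).2| <= M) L.
  elim: L wL {cL LZ} => [|q L IH] /=; first by exists 0.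
  move=> [/piece_bounded[M1 H1] /IH[M2 H2]]; exists (Num.max M1 M2); split.
    by move=> r /H1[h1 h2]; rewrite !le_max h1 h2.
  by apply: pall_imp H2 => q' H r /H[h1 h2]; rewrite !le_max h1 h2 !orbT.
have [y Ey far] : exists2 y, connected_component (~` Z) x y & ~ (`|y.1| <= M /\ `|y.2| <= M).
  apply: contrapT => H; apply: nb; apply: (@boundedP _ M) => z Ez.
  by apply: contrapT => K; apply: H; exists z.
have -> : wind L x = wind L y.
  apply: (@wind_connected _ (connected_component (~` Z) x)) => //.
  - exact: component_connected.
  - by move=> z /connected_component_sub nz /LZ.
  - exact: connected_component_refl.
have : [\/ M < y.1, y.1 < - M, M < y.2 | y.2 < - M].
  apply: contrapT => K; apply: far; rewrite !ler_norml.
  by split; apply/andP; split; rewrite leNgt; apply/negP => ?; apply: K;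
    [constructor 2|constructor 1|constructor 4|constructor 3].
move=> FAR; case: FAR => FAR.
- apply: wind_right => //; apply: pall_imp HM => q H r /H[]; rewrite !ler_norml => *; lra.
- rewrite -(cL (fun z => upper (y - z))) /wind.
  elim: L wL HM {cL LZ} => [|q L IH] /=; first by rewrite !big_nil.
  move=> [[wq _] wL] [H1 H2]; rewrite !big_cons IH //; congr (_ (+) _).
  by apply: turn_left => // r /H1[]; rewrite !ler_norml => *; lra.
- rewrite /wind; elim: L wL HM {cL LZ} => [|q L IH] /=; first by rewrite !big_nil.
  move=> [[wq _] wL] [H1 H2]; rewrite !big_cons IH // addbF.
  by apply: turn_up => // r /H1[]; rewrite !ler_norml => *; lra.
- rewrite /wind; elim: L wL HM {cL LZ} => [|q L IH] /=; first by rewrite !big_nil.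
  move=> [[wq _] wL] [H1 H2]; rewrite !big_cons IH // addbF.
  by apply: turn_down => // r /H1[]; rewrite !ler_norml => *; lra.
Qed.

End Winding.

(** * Crossing parities in a drawing *)

Section Drawn.
Variables (R : realType) (G : sgraph) (D : drawing R G).
Local Notation plane := (plane R).
Implicit Types (u v w p q x y : G).

Definition indep u v p q : bool := [&& u != p, u != q, v != p & v != q].

Lemma indepC u v p q : indep u v p q = indep p q u v.
Proof. by rewrite /indep !(eq_sym p) !(eq_sym q); do ![case: (_ != _)]. Qed.

Lemma adj_neq u v : adj u v -> u != v.
Proof. by apply: contraTneq => ->; rewrite adj_irrefl. Qed.

Lemma edge_adj u v : adj u v -> is_edge [set u; v]%SET.
Proof. by move=> uv; exists u, v. Qed.

Lemma indep_neq u v p q : indep u v p q -> [set u; v]%SET != [set p; q]%SET.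
Proof.
move=> /and4P[up uq _ _]; apply/eqP => /setP /(_ u).
by rewrite !inE eqxx (negPf up) (negPf uq).
Qed.

(** The arc of an unordered edge is stored in an arbitrary direction; here it is reversed if
    necessary so as to run from [u] to [v]. *)
Definition darc u v : R -> plane :=
  let g := arc D [set u; v]%SET in
  if g 0 == pos D u then g else fun t => g (1 - t).

Lemma darc_ends u v : adj u v -> darc u v 0 = pos D u /\ darc u v 1 = pos D v.
Proof.
move=> uv; have [u' [v' [E g0 g1]]] := arc_ends D (edge_adj uv).
rewrite /darc; case: eqP => [e0|n0].
  split => //; rewrite g1; congr pos.
  move: e0; rewrite g0 => /pos_inj eu.
  have : v \in [set u'; v']%SET by rewrite -E !inE eqxx orbT.
  by rewrite !inE eu eq_sym (negPf (adj_neq uv)) => /eqP.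
rewrite subr0 subrr g1 g0.
have uu : u != u' by apply/eqP => eu; apply: n0; rewrite g0 eu.
have : u \in [set u'; v']%SET by rewrite -E !inE eqxx.
rewrite !inE (negPf uu) => /eqP <-; split => //; congr pos.
have : u' \in [set u; v]%SET by rewrite E !inE eqxx.
by rewrite !inE eq_sym (negPf uu) => /eqP.
Qed.

Lemma darc_cont u v : adj u v -> pcont (darc u v) 0 1.
Proof.
move=> uv; have [/ctnP + _] := arc_jordan D (edge_adj uv).
rewrite set_itvcc => c; rewrite /darc; case: ifP => _; first exact: c.
apply: ctn_comp c => [t /=|]; first by lra.
by apply: ctnD; [exact: ctn_cst|apply: ctnN; exact: ctn_id].
Qed.

Lemma darc_inj u v s t : adj u v -> 0 <= s <= 1 -> 0 <= t <= 1 ->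
  darc u v s = darc u v t -> s = t.
Proof.
move=> uv sI tI; have [_ inj] := arc_jordan D (edge_adj uv).
rewrite /darc; case: ifP => _; first by apply: inj; rewrite in_itv.
move=> /inj; rewrite !in_itv /= => H; suff : 1 - s = 1 - t by lra.
by apply: H; lra.
Qed.

Lemma darc_curve u v t : 0 <= t <= 1 -> curve (arc D [set u; v]%SET) (darc u v t).
Proof.
move=> tI; rewrite /darc; case: ifP => _.
  by exists t => //; rewrite /= in_itv.
by exists (1 - t) => //; rewrite /= in_itv /=; lra.
Qed.

Lemma curve_darc u v z : curve (arc D [set u; v]%SET) z ->
  exists2 t, 0 <= t <= 1 & z = darc u v t.
Proof.
move=> [t]; rewrite /= in_itv /= => tI <-; rewrite /darc; case: ifP => _.
  by exists t.
by exists (1 - t); [lra|rewrite subKr].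
Qed.

Lemma darc_vertex u v w t : adj u v -> 0 <= t <= 1 -> darc u v t = pos D w ->
  (w == u) || (w == v).
Proof.
move=> uv /(darc_curve u v) H E; rewrite E in H.
by have := arc_vertex (edge_adj uv) H; rewrite !inE.
Qed.

Definition crs u v p q : Prop := exists z,
  proper_crossing (curve (arc D [set u; v]%SET)) (curve (arc D [set p; q]%SET)) z.

Lemma crossing_curves (A B : set plane) z : proper_crossing A B z -> A z /\ B z.
Proof.
move=> [U [h [k [_ Uz hz _ AB]]]].
by have [hA hB] := AB _ Uz; split; [apply/hA|apply/hB]; rewrite hz.
Qed.

Lemma meet_crossing u v p q z : adj u v -> adj p q -> indep u v p q ->
  curve (arc D [set u; v]%SET) z -> curve (arc D [set p; q]%SET) z ->
  proper_crossing (curve (arc D [set u; v]%SET)) (curve (arc D [set p; q]%SET)) z.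
Proof.
move=> uv pq i zu zp.
have [[w []]|//] := arcs_meet (edge_adj uv) (edge_adj pq) (indep_neq i) (conj zu zp).
rewrite !inE => w1 w2 _; exfalso; move: i => /and4P[i1 i2 i3 i4].
by move: w1 w2 => /orP[] /eqP -> ; rewrite ?(negPf i1) ?(negPf i2) ?(negPf i3) ?(negPf i4).
Qed.

Lemma crsC u v p q : adj u v -> adj p q -> indep u v p q -> crs u v p q -> crs p q u v.
Proof.
move=> uv pq i [z cz]; have [zu zp] := crossing_curves cz; exists z.
by apply: meet_crossing => //; rewrite indepC.
Qed.

Lemma crs_params u v p q : adj u v -> adj p q -> indep u v p q -> crs u v p q ->
  exists s t, [/\ 0 < s < 1, 0 < t < 1, darc u v s = darc p q t &
    proper_crossing (curve (arc D [set u; v]%SET)) (curve (arc D [set p; q]%SET)) (darc u v s)].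
Proof.
move=> uv pq i [z cz]; have [zu zp] := crossing_curves cz.
have [s sI zs] := curve_darc zu; have [t tI zt] := curve_darc zp.
exists s, t; rewrite -zs -zt; split => //.
- have [e0 e1] := darc_ends uv; move: i => /and4P[i1 i2 i3 i4].
  have [s0|s0] := eqVneq s 0.
    have := @darc_vertex p q u t pq tI; rewrite -zt zs s0 e0 => /(_ erefl).
    by rewrite (negPf i1) (negPf i2).
  have [s1|s1] := eqVneq s 1.
    have := @darc_vertex p q v t pq tI; rewrite -zt zs s1 e1 => /(_ erefl).
    by rewrite (negPf i3) (negPf i4).
  by rewrite !lt_neqAle s1 eq_sym s0.
- have [e0 e1] := darc_ends pq; move: i => /and4P[i1 i2 i3 i4].
  have [s0|s0] := eqVneq t 0.
    have := @darc_vertex u v p s uv sI; rewrite -zs zt s0 e0 => /(_ erefl).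
    by rewrite !(eq_sym p) (negPf i1) (negPf i3).
  have [s1|s1] := eqVneq t 1.
    have := @darc_vertex u v q s uv sI; rewrite -zs zt s1 e1 => /(_ erefl).
    by rewrite !(eq_sym q) (negPf i2) (negPf i4).
  by rewrite !lt_neqAle s1 eq_sym s0.
Qed.

Lemma meet_unique u v p q s t s' t' : adj u v -> adj p q ->
  [set u; v]%SET != [set p; q]%SET ->
  0 <= s <= 1 -> 0 <= t <= 1 -> 0 <= s' <= 1 -> 0 <= t' <= 1 ->
  darc u v s = darc p q t -> darc u v s' = darc p q t' -> s' = s /\ t' = t.
Proof.
move=> uv pq i sI tI sI' tI' E E'.
have H : darc u v s' = darc u v s.
  apply: (arcs_meet_once (edge_adj uv) (edge_adj pq) i).
    by split; [exact: darc_curve|rewrite E'; exact: darc_curve].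
  by split; [exact: darc_curve|rewrite E; exact: darc_curve].
split; first exact: darc_inj H.
by apply: (darc_inj pq tI' tI); rewrite -E -E'.
Qed.

Lemma inum_subarcs u v p q s t a b c d : adj u v -> adj p q -> indep u v p q ->
  0 <= a -> a < s -> s < b -> b <= 1 -> 0 <= c -> c < t -> t < d -> d <= 1 ->
  darc u v s = darc p q t -> inum (darc u v) a b (darc p q) c d = true.
Proof.
move=> uv pq i a0 as_ sb b1 c0 ct td d1 E.
have sI : 0 <= s <= 1 by lra.
have tI : 0 <= t <= 1 by lra.
apply: (@inum_crossing _ _ _ _ _ _ _ s t (curve (arc D [set u; v]%SET)) (curve (arc D [set p; q]%SET))) => //.
- exact: pcont_sub (darc_cont uv) _ _.
- exact: pcont_sub (darc_cont pq) _ _.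
- by move=> r rI; apply: darc_curve; lra.
- by move=> r rI; apply: darc_curve; lra.
- by move=> r r' rI rI'; apply: darc_inj => //; lra.
- by move=> r r' rI rI'; apply: darc_inj => //; lra.
- by apply: meet_crossing => //; [exact: darc_curve|rewrite E; exact: darc_curve].
- by move=> r r' rI rI'; apply: meet_unique => //; [exact: indep_neq|lra|lra].
Qed.

Definition chi u v p q : bool := inum (darc u v) 0 1 (darc p q) 0 1.

(** Independent edges share at most one point, and that point is a proper crossing, so the parity is
    the number of crossings. *)
Lemma chiP u v p q : adj u v -> adj p q -> indep u v p q ->
  reflect (crs u v p q) (chi u v p q).
Proof.
move=> uv pq i; apply: (iffP idP) => [|c].
  apply: contraTP => nc; rewrite /chi inum0 ?ler01 //; [exact: darc_cont|exact: darc_cont|].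
  move=> s t sI tI; apply/eqP => E; apply: nc; exists (darc u v s).
  by apply: meet_crossing => //; [exact: darc_curve|rewrite E; exact: darc_curve].
have [s [t [/andP[s0 s1] /andP[t0 t1] E _]]] := crs_params uv pq i c.
exact: (inum_subarcs uv pq i _ s0 s1 _ _ t0 t1 _ E).
Qed.

Lemma chi_disjoint u v p q s t : adj u v -> adj p q -> indep u v p q ->
  chi u v p q = false -> 0 <= s <= 1 -> 0 <= t <= 1 -> darc u v s != darc p q t.
Proof.
move=> uv pq i c sI tI; apply/eqP => E.
move: c => /negP; apply; apply/chiP => //; exists (darc u v s).
by apply: meet_crossing => //; [exact: darc_curve|rewrite E; exact: darc_curve].
Qed.

Lemma chiC u v p q : adj u v -> adj p q -> indep u v p q -> chi u v p q = chi p q u v.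
Proof.
move=> uv pq i; have i' : indep p q u v by rewrite indepC.
by apply/chiP/chiP => //; exact: crsC.
Qed.

Lemma chi_swap u v p q : adj u v -> adj p q -> indep u v p q -> chi u v p q = chi v u p q.
Proof.
move=> uv pq i; have vu : adj v u by rewrite adj_sym.
have i' : indep v u p q by move: i => /and4P[? ? ? ?]; apply/and4P.
by apply/chiP/chiP => //; rewrite /crs finset.setUC.
Qed.

Definition wturn w p q : bool := turn (pos D w) (darc p q) 0 1.
Definition vabove p u : bool := above (pos D p) (pos D u).

Lemma vaboveN p q : p != q -> vabove q p = ~~ vabove p q.
Proof. by move=> pq; apply: aboveN; apply: contra_neq pq => /pos_inj. Qed.

Lemma chi_star u v p q : adj u v -> adj p q -> indep u v p q ->
  chi u v p q = wturn u p q (+) wturn v p q (+) wturn p u v (+) wturn q u v (+)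
    (vabove p u (+) vabove p v (+) vabove q u (+) vabove q v).
Proof.
move=> uv pq /and4P[i1 i2 i3 i4]; rewrite /chi inum_star ?ler01 //.
- by have [-> ->] := darc_ends uv; have [-> ->] := darc_ends pq.
- exact: darc_cont.
- move=> s sI; have [-> _] := darc_ends pq; apply/eqP => /(darc_vertex uv sI).
  by rewrite !(eq_sym p) (negPf i1) (negPf i3).
- move=> s sI; have [_ ->] := darc_ends pq; apply/eqP => /(darc_vertex uv sI).
  by rewrite !(eq_sym q) (negPf i2) (negPf i4).
Qed.

Fixpoint chi1 u v y (qs : seq G) : bool :=
  if qs is q :: qs' then chi u v y q (+) chi1 u v q qs' else false.
Fixpoint chi2 x (ps : seq G) y (qs : seq G) : bool :=
  if ps is p :: ps' then chi1 x p y qs (+) chi2 p ps' y qs else false.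
Fixpoint wturn1 w y (qs : seq G) : bool :=
  if qs is q :: qs' then wturn w y q (+) wturn1 w q qs' else false.

Definition apart (s t : seq G) : bool := all (fun w => w \notin t) s.

Lemma chi1_star x p y qs : adj x p -> path (@adj G) y qs -> apart [:: x; p] (y :: qs) ->
  chi1 x p y qs = wturn1 x y qs (+) wturn1 p y qs (+) wturn y x p (+) wturn (last y qs) x p (+)
    (vabove y x (+) vabove y p (+) vabove (last y qs) x (+) vabove (last y qs) p).
Proof.
move=> xp; elim: qs y => [|q qs IH] y /=; first by move=> _ _; xor.
move=> /andP[yq qqs]; rewrite /apart /= !inE !negb_or => /and3P[/and3P[x1 x2 x3] /and3P[p1 p2 p3] _].
rewrite (IH q qqs) ?/apart /= ?inE ?negb_or ?x2 ?x3 ?p2 ?p3 //.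
rewrite chi_star //; last by rewrite /indep x1 x2 p1 p2.
by xor.
Qed.

(** Terms at inner vertices of the paths occur twice. A path thus has the same formula as a single
    edge between its ends. *)
Lemma chi2_star x ps y qs : path (@adj G) x ps -> path (@adj G) y qs -> apart (x :: ps) (y :: qs) ->
  chi2 x ps y qs = wturn1 x y qs (+) wturn1 (last x ps) y qs (+) wturn1 y x ps (+)
      wturn1 (last y qs) x ps (+)
    (vabove y x (+) vabove y (last x ps) (+) vabove (last y qs) x (+) vabove (last y qs) (last x ps)).
Proof.
move=> + yqs; elim: ps x => [|p ps IH] x /=; first by move=> _ _; xor.
move=> /andP[xp pps] /and3P[a1 a2 a3].
rewrite (IH p pps) ?/apart /= ?a2 //.
rewrite chi1_star ?/apart //= ?a1 ?a2 //.
by xor.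
Qed.

Section K5.
Variables (v0 v1 v2 v3 v4 : G) (p01 p02 p03 p04 p12 p13 p14 p23 p24 p34 : seq G).

Definition vpath x ps y : Prop := path (@adj G) x ps /\ last x ps = y.

(** The turn of a path around a vertex outside it occurs twice, once for each of the two paths from
    that vertex to the other two vertices. Each pair of vertices contributes six [above] terms; the
    total number of those read in the reverse direction is odd, and by [vaboveN] each of them adds
    one. *)
Lemma K5_odd :
  vpath v0 p01 v1 -> vpath v0 p02 v2 -> vpath v0 p03 v3 -> vpath v0 p04 v4 ->
  vpath v1 p12 v2 -> vpath v1 p13 v3 -> vpath v1 p14 v4 -> vpath v2 p23 v3 ->
  vpath v2 p24 v4 -> vpath v3 p34 v4 ->
  apart (v0 :: p01) (v2 :: p23) -> apart (v0 :: p01) (v2 :: p24) -> apart (v0 :: p01) (v3 :: p34) ->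
  apart (v0 :: p02) (v1 :: p13) -> apart (v0 :: p02) (v1 :: p14) -> apart (v0 :: p02) (v3 :: p34) ->
  apart (v0 :: p03) (v1 :: p12) -> apart (v0 :: p03) (v1 :: p14) -> apart (v0 :: p03) (v2 :: p24) ->
  apart (v0 :: p04) (v1 :: p12) -> apart (v0 :: p04) (v1 :: p13) -> apart (v0 :: p04) (v2 :: p23) ->
  apart (v1 :: p12) (v3 :: p34) -> apart (v1 :: p13) (v2 :: p24) -> apart (v1 :: p14) (v2 :: p23) ->
  chi2 v0 p01 v2 p23 (+) chi2 v0 p01 v2 p24 (+) chi2 v0 p01 v3 p34 (+)
  chi2 v0 p02 v1 p13 (+) chi2 v0 p02 v1 p14 (+) chi2 v0 p02 v3 p34 (+)
  chi2 v0 p03 v1 p12 (+) chi2 v0 p03 v1 p14 (+) chi2 v0 p03 v2 p24 (+)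
  chi2 v0 p04 v1 p12 (+) chi2 v0 p04 v1 p13 (+) chi2 v0 p04 v2 p23 (+)
  chi2 v1 p12 v3 p34 (+) chi2 v1 p13 v2 p24 (+) chi2 v1 p14 v2 p23 = true.
Proof.
move=> [a01 l01] [a02 l02] [a03 l03] [a04 l04] [a12 l12] [a13 l13] [a14 l14] [a23 l23] [a24 l24] [a34 l34].
move=> d1 d2 d3 d4 d5 d6 d7 d8 d9 d10 d11 d12 d13 d14 d15.
have ne12 : v1 != v2.
  by move/allP: d1 => /(_ v1); rewrite -l01 mem_last inE negb_or l01 => /(_ isT) /andP[].
have ne13 : v1 != v3.
  by move/allP: d3 => /(_ v1); rewrite -l01 mem_last inE negb_or l01 => /(_ isT) /andP[].
have ne23 : v2 != v3.
  by move/allP: d6 => /(_ v2); rewrite -l02 mem_last inE negb_or l02 => /(_ isT) /andP[].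
have ne24 : v2 != v4.
  move/allP: d5 => /(_ v2); rewrite -{1}l02 mem_last => /(_ isT).
  by apply: contra => /eqP ->; rewrite -l14 mem_last.
have ne34 : v3 != v4.
  move/allP: d8 => /(_ v3); rewrite -{1}l03 mem_last => /(_ isT).
  by apply: contra => /eqP ->; rewrite -l14 mem_last.
have ne14 : v1 != v4.
  move/allP: d2 => /(_ v1); rewrite -{1}l01 mem_last => /(_ isT).
  by apply: contra => /eqP ->; rewrite -l24 mem_last.
rewrite !chi2_star // l01 l02 l03 l04 l12 l13 l14 l23 l24 l34.
rewrite (vaboveN ne12) (vaboveN ne13) (vaboveN ne14) (vaboveN ne23) (vaboveN ne24) (vaboveN ne34).
by xor.
Qed.

End K5.

(** Each vertex lies on two sides of its triangle, so every turn occurs twice and every [above] term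
    four times, always in the same direction. *)
Lemma triangles_even a b c a' b' c' : adj a b -> adj b c -> adj a c ->
  adj a' b' -> adj b' c' -> adj a' c' -> apart [:: a; b; c] [:: a'; b'; c'] ->
  chi a b a' b' (+) chi a b b' c' (+) chi a b a' c' (+)
  chi b c a' b' (+) chi b c b' c' (+) chi b c a' c' (+)
  chi a c a' b' (+) chi a c b' c' (+) chi a c a' c' = false.
Proof.
move=> ab bc ac ab' bc' ac'; rewrite /apart /= !inE !negb_or.
move=> /and4P[/and3P[n1 n2 n3] /and3P[n4 n5 n6] /and3P[n7 n8 n9] _].
rewrite !chi_star //; last first; try by rewrite /indep ?n1 ?n2 ?n3 ?n4 ?n5 ?n6 ?n7 ?n8 ?n9.
by xor.
Qed.

Lemma chi2_false x ps y qs : (forall u v p q, u \in x :: ps -> v \in x :: ps ->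
     p \in y :: qs -> q \in y :: qs -> (u, v) \in zip (x :: ps) ps ->
     (p, q) \in zip (y :: qs) qs -> chi u v p q = false) ->
  chi2 x ps y qs = false.
Proof.
elim: ps x => //= p ps IH x H; rewrite IH ?addbF; last first.
  by move=> u v r s hu hv hr hs h1 h2; apply: H; rewrite // inE ?hu ?hv ?h1 orbT.
have {IH} : forall r s, r \in y :: qs -> s \in y :: qs -> (r, s) \in zip (y :: qs) qs -> chi x p r s = false.
  by move=> r s hr hs h; apply: H; rewrite ?inE ?eqxx ?orbT.
elim: qs y {H} => //= q qs IH y H; rewrite H ?inE ?eqxx ?orbT // IH // => r s hr hs h.
by apply: H; rewrite // inE ?hr ?hs ?h orbT.
Qed.

Section Fan.
Hypothesis noI : forall e e1 e2, ~ pattern_I D e e1 e2.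

(** All later consequences of the absence of Pattern (I) are drawn from this form. *)
Lemma fan u v p q r s : adj u v -> adj p q -> adj r s -> indep p q u v -> indep r s u v ->
  chi p q u v -> chi r s u v -> ~~ indep p q r s.
Proof.
move=> uv pq rs i1 i2 /(chiP pq uv i1)[z cz] /(chiP rs uv i2)[z' cz'].
apply/negP => i; apply: (@noI [set u; v]%SET [set p; q]%SET [set r; s]%SET); split.
- by exists z; split => //; [exact: edge_adj|exact: edge_adj|exact: indep_neq].
- by exists z'; split => //; [exact: edge_adj|exact: edge_adj|exact: indep_neq].
move=> [w []]; rewrite !inE; move: i => /and4P[n1 n2 n3 n4].
by move=> /orP[] /eqP ->; rewrite ?(negPf n1) ?(negPf n2) ?(negPf n3) ?(negPf n4).
Qed.

End Fan.

End Drawn.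

(** * Segments and polylines with integer vertices *)

Section Segments.
Variable R : realType.
Local Notation plane := (plane R).
Implicit Types (p q r s x z : plane) (t : R).

Definition lerp p q t : plane := (p.1 + t * (q.1 - p.1), p.2 + t * (q.2 - p.2)).
Definition seg p q : set plane := [set z | exists2 t, 0 <= t <= 1 & z = lerp p q t].
Definition orient p q z : R := (q.1 - p.1) * (z.2 - p.2) - (q.2 - p.2) * (z.1 - p.1).

Lemma orient_lerp p q r s t :
  orient p q (lerp r s t) = (1 - t) * orient p q r + t * orient p q s.
Proof. by rewrite /orient /lerp /=; ring. Qed.

Lemma orient_line p q t : orient p q (lerp p q t) = 0.
Proof. by rewrite /orient /lerp /=; ring. Qed.

Lemma orient_start p q : orient p q p = 0.
Proof. by rewrite /orient; ring. Qed.

Lemma lerp0 p q : lerp p q 0 = p.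
Proof. by case: p => a b; rewrite /lerp /= !mul0r !addr0. Qed.

Lemma lerp1 p q : lerp p q 1 = q.
Proof. by case: q => a b; rewrite /lerp /= !mul1r ![_ + (_ - _)]addrC !subrK. Qed.

Lemma lerpC p q t : lerp p q t = lerp q p (1 - t).
Proof. by congr pair => /=; ring. Qed.

Lemma segC p q : seg p q = seg q p.
Proof.
suff H p' q' : seg p' q' `<=` seg q' p' by apply/seteqP; split; exact: H.
move=> z [t t01 ->]; exists (1 - t); last exact: lerpC.
by move: t01 => /andP[? ?]; apply/andP; split; lra.
Qed.

Lemma lerp_inj p q t t' : p != q -> lerp p q t = lerp p q t' -> t = t'.
Proof.
move=> pq [e1 e2].
have {e1 e2} [e1 e2] : (t - t') * (q.1 - p.1) = 0 /\ (t - t') * (q.2 - p.2) = 0.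
  by split; rewrite mulrBl; [move: e1|move: e2] => /addrI ->; rewrite subrr.
apply/eqP; rewrite -subr_eq0; apply: contraT => d0; move: pq; apply: contraNT => _.
move/eqP: e1; move/eqP: e2; rewrite !mulf_eq0 (negPf d0) /= !subr_eq0 => /eqP e2 /eqP e1.
by rewrite [p]surjective_pairing [q]surjective_pairing e1 e2.
Qed.

(** [orient p q] vanishes on the first segment, while on the second it is affine and keeps a strict
    sign. *)
Lemma seg_sep p q r s z : 0 < orient p q r * orient p q s -> seg p q z -> ~ seg r s z.
Proof.
move=> rs [a _ ->] [b /andP[b0 b1] E].
have := orient_line p q a; rewrite E orient_lerp => E0.
have : (1 - b) * (orient p q r * orient p q r) + b * (orient p q r * orient p q s) = 0.
  by rewrite mulrCA [X in _ + X]mulrCA -mulrDr E0 mulr0.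
have : 0 < orient p q r * orient p q r.
  by rewrite -expr2 exprn_even_gt0 //=; apply: contraTneq rs => ->; rewrite mul0r ltxx.
move: (orient p q r * orient p q r) (orient p q r * orient p q s) rs => X Y Y0 X0 E1.
have h1 : 0 <= (1 - b) * X by apply: mulr_ge0; lra.
have h2 : 0 <= b * Y by apply: mulr_ge0; lra.
have [b12|b12] := leP b (1 / 2).
  have : 0 < (1 - b) * X by apply: mulr_gt0; lra.
  lra.
have : 0 < b * Y by apply: mulr_gt0; lra.
lra.
Qed.

Lemma seg_touch p q r z : orient p q r != 0 -> seg p q z -> seg p r z -> z = p.
Proof.
move=> o0 [a _ ->] [b _ E]; have := orient_line p q a.
rewrite E orient_lerp orient_start mulr0 add0r => /eqP.
by rewrite mulf_eq0 (negPf o0) orbF => /eqP ->; rewrite lerp0.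
Qed.

Lemma seg_opposite p q r s t : orient p q r * orient p q s < 0 -> orient p q (lerp r s t) = 0 ->
  t = orient p q r / (orient p q r - orient p q s) /\ 0 < t < 1.
Proof.
rewrite orient_lerp; move: (orient p q r) (orient p q s) => X Y XY E.
have d : X - Y != 0 by apply: contraTneq XY => d; have -> : X = Y by [lra]; rewrite -leNgt -expr2 sqr_ge0.
have Et : t = X / (X - Y) by apply: (mulIf d); rewrite divfK //; lra.
split => //; rewrite Et.
have [X0|X0] := ltP 0 X.
  have Y0 : Y < 0 by move: XY; rewrite pmulr_rlt0.
  by rewrite divr_gt0 ?ltr_pdivrMr //=; lra.
have {}X0 : X < 0 by rewrite lt_neqAle X0 andbT; apply: contraTneq XY => ->; rewrite mul0r ltxx.
have Y0 : 0 < Y by move: XY; rewrite nmulr_rlt0.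
have -> : X / (X - Y) = (- X) / (Y - X) by rewrite -[Y - X]opprB invrN mulrNN.
by rewrite divr_gt0 ?ltr_pdivrMr //=; lra.
Qed.

Lemma seg_cross_uniq p q r s z z' : orient p q r * orient p q s < 0 ->
  seg p q z -> seg r s z -> seg p q z' -> seg r s z' -> z = z'.
Proof.
move=> rs [a _ Ea] [b _ Eb] [a' _ Ea'] [b' _ Eb'].
have [|E0 _] := @seg_opposite p q r s b rs; first by rewrite -Eb Ea orient_line.
have [|E' _] := @seg_opposite p q r s b' rs; first by rewrite -Eb' Ea' orient_line.
by rewrite Eb Eb' E' E0.
Qed.

Lemma lerp_cont p q a b : pcont (lerp p q) a b.
Proof.
apply: ctn_pair; apply: ctnD; try exact: ctn_cst.
all: by apply: ctnM; [exact: ctn_id|exact: ctn_cst].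
Qed.

Lemma seg_apart p q x : ~ seg p q x -> exists2 ep : R, 0 < ep & forall z, ball x ep z -> ~ seg p q z.
Proof.
move=> nx; have [||ep ep0 H] := @piece_apart R (lerp p q, 0, 1) x.
- by split; [exact: ler01|exact: lerp_cont].
- by move=> [t /= tI E]; apply: nx; exists t.
by exists ep => // z bz [t tI E]; apply: (H t tI) => /=; rewrite -E.
Qed.

Section Chart.
Variables (p q r s x : plane) (a b ep : R).
Hypothesis xa : x = lerp p q a.
Hypothesis xb : x = lerp r s b.
Hypothesis ep0 : 0 < ep.
Let A := (q.1 - p.1, q.2 - p.2).
Let B := (s.1 - r.1, s.2 - r.2).
Let Delta := A.1 * B.2 - A.2 * B.1.
Hypothesis Delta0 : Delta != 0.

(** Affine coordinates at [x] along the directions [A] and [B] of the two segments, scaled by [ep];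
    [chart] recovers them by Cramer's rule with determinant [Delta]. *)
Definition chart_inv (w : plane) : plane :=
  (x.1 + ep * (w.1 * A.1 + w.2 * B.1), x.2 + ep * (w.1 * A.2 + w.2 * B.2)).
Definition chart (z : plane) : plane :=
  (((z.1 - x.1) * B.2 - (z.2 - x.2) * B.1) / (ep * Delta), (A.1 * (z.2 - x.2) - A.2 * (z.1 - x.1)) / (ep * Delta)).

Lemma chartK : cancel chart chart_inv.
Proof.
move=> z; have D0 := Delta0; rewrite /Delta /A /B /= in D0.
rewrite [RHS]surjective_pairing /chart /chart_inv /Delta /A /B /=.
by congr pair; field; rewrite D0 (gt_eqF ep0).
Qed.

Lemma chart_invK : cancel chart_inv chart.
Proof.
move=> z; have D0 := Delta0; rewrite /Delta /A /B /= in D0.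
rewrite [RHS]surjective_pairing /chart /chart_inv /Delta /A /B /=.
by congr pair; field; rewrite D0 (gt_eqF ep0).
Qed.

Lemma chart_cont D : ctn D chart.
Proof.
have c1 : ctn D (fun z : plane => z.1) by apply: ctn_fst; exact: ctn_id.
have c2 : ctn D (fun z : plane => z.2) by apply: ctn_snd; exact: ctn_id.
apply: ctn_pair; apply: ctnM; try exact: ctn_cst; apply: ctnD; try apply: ctnN.
all: apply: ctnM; try exact: ctn_cst; apply: ctnD => //; exact: ctn_cst.
Qed.

Lemma chart_inv_cont D : ctn D chart_inv.
Proof.
have c1 : ctn D (fun z : plane => z.1) by apply: ctn_fst; exact: ctn_id.
have c2 : ctn D (fun z : plane => z.2) by apply: ctn_snd; exact: ctn_id.
apply: ctn_pair; apply: ctnD; try exact: ctn_cst; apply: ctnM; try exact: ctn_cst; apply: ctnD.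
all: apply: ctnM => //; exact: ctn_cst.
Qed.

Lemma chart_crossing (S T : set plane) : (forall z, ball (0 : plane) 1 (chart z) -> S z <-> (chart z).2 = 0) ->
  (forall z, ball (0 : plane) 1 (chart z) -> T z <-> (chart z).1 = 0) -> proper_crossing S T x.
Proof.
move=> HS HT.
have cx : chart x = 0 by rewrite /chart !subrr !mul0r !mulr0 subrr !mul0r.
exists (chart @^-1` ball (0 : plane) 1), chart, chart_inv; split => //.
- apply: open_comp; last by apply: ball_open; exact: ltr01.
  move=> z _ V HV.
  have : nbhs z [set w | setT w -> V (chart w)] := @chart_cont setT z I V HV.
  by apply: filterS => w /=; exact.
- by rewrite /= cx; exact: ballxx.
- split.
  + by move=> z Uz; split => //; exact: chartK.
  + by move=> w Vw; rewrite /= chart_invK.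
  + by apply/ctnP; exact: chart_cont.
  + by apply/ctnP; exact: chart_inv_cont.
- by move=> z Uz; split; [exact: HS|exact: HT].
Qed.

Lemma chart_axis1 t : (chart (lerp p q t)).2 = 0.
Proof. by rewrite /chart /= xa /lerp /=; apply/eqP; rewrite mulf_eq0; apply/orP; left; apply/eqP; ring. Qed.

Lemma chart_axis2 t : (chart (lerp r s t)).1 = 0.
Proof. by rewrite /chart /= xb /lerp /=; apply/eqP; rewrite mulf_eq0; apply/orP; left; apply/eqP; ring. Qed.

Lemma axis1_lerp z : (chart z).2 = 0 -> z = lerp p q (a + ep * (chart z).1).
Proof.
move=> h; rewrite -{1}(chartK z) /chart_inv h xa /lerp /=.
by congr pair; rewrite /A /=; ring.
Qed.

Lemma axis2_lerp z : (chart z).1 = 0 -> z = lerp r s (b + ep * (chart z).2).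
Proof.
move=> h; rewrite -{1}(chartK z) /chart_inv h xb /lerp /=.
by congr pair; rewrite /B /=; ring.
Qed.

Lemma chart_small de z : ep * (`|A.1| + `|A.2| + `|B.1| + `|B.2|) < de ->
  ball (0 : plane) 1 (chart z) -> ball x de z.
Proof.
move=> small [/=]; rewrite /ball /= !sub0r !normrN => h1 h2.
have K (u v c d : R) : `|u| < 1 -> `|v| < 1 -> `|u * c + v * d| <= `|c| + `|d|.
  move=> u1 v1; apply: (le_trans (ler_normD _ _)); rewrite !normrM.
  by apply: lerD; rewrite ler_piMl // ltW.
have C1 := K _ _ A.1 B.1 h1 h2; have C2 := K _ _ A.2 B.2 h1 h2.
have D1 := normr_ge0 A.1; have D2 := normr_ge0 A.2; have D3 := normr_ge0 B.1; have D4 := normr_ge0 B.2.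
rewrite -(chartK z) /chart_inv; split; rewrite /ball /= opprD addrA subrr sub0r normrN normrM (gtr0_norm ep0);
  apply: le_lt_trans small; rewrite ler_pM2l //.
- by apply: (le_trans C1); rewrite -addrA; move: D1 D2 D3 D4; lra.
- by apply: (le_trans C2); move: D1 D2 D3 D4; lra.
Qed.

End Chart.

End Segments.

(** * Sign tests on integer coordinates *)

Definition pt := (Z * Z)%type.

Definition orientZ (p q r : pt) : Z :=
  Z.sub (Z.mul (Z.sub q.1 p.1) (Z.sub r.2 p.2)) (Z.mul (Z.sub q.2 p.2) (Z.sub r.1 p.1)).

(** Positive if both ends of [b] are strictly on one side of the line of [a], negative if they are
    strictly on opposite sides, zero if one of them is on the line. *)
Definition sideZ (a b : pt * pt) : Z :=
  Z.mul (Z.sgn (orientZ a.1 a.2 b.1)) (Z.sgn (orientZ a.1 a.2 b.2)).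

Definition before (f : pt -> Z) (a b : pt * pt) : bool :=
  Z.ltb (Z.max (f a.1) (f a.2)) (Z.min (f b.1) (f b.2)).

(** A sufficient test for disjointness: separated bounding boxes, or one segment strictly on one
    side of the line of the other. The cheap comparisons come first, and conditionals in place of
    disjunctions stop the evaluation early. *)
Definition sepZ (a b : pt * pt) : bool :=
  if before fst a b then true else if before fst b a then true else
  if before snd a b then true else if before snd b a then true else
  if Z.ltb Z0 (sideZ a b) then true else Z.ltb Z0 (sideZ b a).

Definition crossZ (a b : pt * pt) : bool :=
  if Z.ltb (sideZ a b) Z0 then Z.ltb (sideZ b a) Z0 else false.

Definition has_end (a : pt * pt) (w : pt) : bool := (a.1 == w) || (a.2 == w).
Definition other_end (a : pt * pt) (w : pt) : pt := if a.1 == w then a.2 else a.1.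

Definition touchZ (a b : pt * pt) (w : pt) : bool :=
  [&& has_end a w, has_end b w & orientZ w (other_end a w) (other_end b w) != Z0].

Fixpoint psegs (p : pt) (s : seq pt) : seq (pt * pt) :=
  if s is q :: s' then (p, q) :: psegs q s' else [::].

Fixpoint simple (p : pt) (s : seq pt) : bool :=
  match s with
  | [::] => false
  | [:: q] => p != q
  | q :: (r :: s'') as s' => [&& orientZ q p r != Z0, all (sepZ (p, q)) (psegs r s'') & simple q s']
  end.

Section Polylines.
Variable R : realType.
Local Notation plane := (plane R).
Implicit Types (p q r w : pt) (s : seq pt) (a b : pt * pt) (L : seq (pt * pt)) (x z : plane) (t : R).

Definition zr (n : Z) : R := (int_of_Z n)%:~R.

Lemma zrB m n : zr (Z.sub m n) = zr m - zr n.
Proof. by rewrite /zr -intrB; congr intr; lia. Qed.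

Lemma zrM m n : zr (Z.mul m n) = zr m * zr n.
Proof. by rewrite /zr -intrM; congr intr; lia. Qed.

Lemma zr_gt0 n : Z.lt Z0 n -> 0 < zr n.
Proof. by move=> n0; rewrite /zr ltr0z; lia. Qed.

Lemma zr_lt0 n : Z.lt n Z0 -> zr n < 0.
Proof. by move=> n0; rewrite /zr ltrz0; lia. Qed.

Lemma zr_inj : injective zr.
Proof. by move=> m n /eqP; rewrite eqr_int => /eqP; lia. Qed.

Definition zp p : plane := (zr p.1, zr p.2).

Lemma zp_inj : injective zp.
Proof. by move=> [a b] [c d] [/zr_inj -> /zr_inj ->]. Qed.

Lemma orient_zp p q r : orient (zp p) (zp q) (zp r) = zr (orientZ p q r).
Proof. by rewrite /orientZ !(zrB, zrM). Qed.

Lemma orientZ_neq0 p q r : orientZ p q r != Z0 -> orient (zp p) (zp q) (zp r) != 0.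
Proof. by apply: contraNneq; rewrite orient_zp -[0]/(zr Z0) => /zr_inj ->. Qed.

Definition zseg a : set plane := seg (zp a.1) (zp a.2).

Lemma before_apart a b z (f : pt -> Z) (g : plane -> R) : zseg a z -> zseg b z ->
  (forall p q t, g (lerp (zp p) (zp q) t) = zr (f p) + t * (zr (f q) - zr (f p))) -> ~~ before f a b.
Proof.
move=> [t /andP[t0 t1] ->] [t' /andP[t0' t1'] E] Hg; apply/negP => /Z.ltb_spec0 h.
have {}E : zr (f a.1) + t * (zr (f a.2) - zr (f a.1)) = zr (f b.1) + t' * (zr (f b.2) - zr (f b.1)).
  by rewrite -!Hg E.
have H m n : Z.lt m n -> zr m < zr n by rewrite /zr ltr_int; lia.
have h1 : zr (f a.1) < zr (f b.1) by apply: H; lia.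
have h2 : zr (f a.1) < zr (f b.2) by apply: H; lia.
have h3 : zr (f a.2) < zr (f b.1) by apply: H; lia.
have h4 : zr (f a.2) < zr (f b.2) by apply: H; lia.
move: (zr (f a.1)) (zr (f a.2)) (zr (f b.1)) (zr (f b.2)) E h1 h2 h3 h4 => p q r s E h1 h2 h3 h4.
pose m := Num.max p q.
have [m1 m2] : p <= m /\ q <= m by rewrite /m !le_max !lexx orbT.
have [m3 m4] : m < r /\ m < s by rewrite /m !gt_max h1 h2 h3 h4.
have k1 : p + t * (q - p) <= m.
  have : (1 - t) * (m - p) + t * (m - q) >= 0 by apply: addr_ge0; apply: mulr_ge0; lra.
  lra.
have k2 : m < r + t' * (s - r).
  have e1 : 0 <= (1 - t') * (r - m) by apply: mulr_ge0; lra.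
  have e2 : 0 <= t' * (s - m) by apply: mulr_ge0; lra.
  have [th|th] := leP t' (1 / 2).
    have : 0 < (1 - t') * (r - m) by apply: mulr_gt0; lra.
    lra.
  have : 0 < t' * (s - m) by apply: mulr_gt0; lra.
  lra.
lra.
Qed.

Lemma zseg_sep a b z : sepZ a b -> zseg a z -> ~ zseg b z.
Proof.
have S c d : Z.ltb Z0 (sideZ c d) -> 0 < orient (zp c.1) (zp c.2) (zp d.1) * orient (zp c.1) (zp c.2) (zp d.2).
  rewrite /sideZ -Z.sgn_mul !orient_zp -zrM => /Z.ltb_spec0 h; apply: zr_gt0.
  by apply/(iffLR (Z.sgn_pos_iff _)); lia.
move=> sp az bz; have B1 := before_apart az bz; have B2 := before_apart bz az.
move: sp; rewrite /sepZ.
rewrite (negPf (B1 fst fst _)) // (negPf (B2 fst fst _)) // (negPf (B1 snd snd _)) // (negPf (B2 snd snd _)) //.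
by case: ifP => [/S h _|_ /S h]; [exact: seg_sep h az bz|exact: seg_sep h bz az].
Qed.

Lemma side_opp a b : Z.ltb (sideZ a b) Z0 -> orient (zp a.1) (zp a.2) (zp b.1) * orient (zp a.1) (zp a.2) (zp b.2) < 0.
Proof.
rewrite /sideZ -Z.sgn_mul !orient_zp -zrM => /Z.ltb_spec0 h; apply: zr_lt0.
by apply/(iffLR (Z.sgn_neg_iff _)); lia.
Qed.

Lemma zseg_other a w : has_end a w -> zseg a = seg (zp w) (zp (other_end a w)).
Proof.
rewrite /zseg /has_end /other_end; case: eqP => [<- //|_] /= /eqP <-.
exact: segC.
Qed.

Lemma zseg_touch a b w z : touchZ a b w -> zseg a z -> zseg b z -> z = zp w.
Proof.
move=> /and3P[/zseg_other -> /zseg_other -> /orientZ_neq0 o0].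
exact: seg_touch.
Qed.

Lemma zseg_cross_uniq a b z z' : crossZ a b -> zseg a z -> zseg b z -> zseg a z' -> zseg b z' -> z = z'.
Proof. by rewrite /crossZ; case: ifP => // /side_opp h _; exact: seg_cross_uniq. Qed.

Definition cov L : set plane := [set z | exists2 a, a \in L & zseg a z].

Lemma cov_apart L a0 x : (forall a, a \in L -> zseg a x -> a = a0) ->
  exists2 ep : R, 0 < ep & forall z, ball x ep z -> cov L z -> zseg a0 z.
Proof.
elim: L => [|a L IH] H; first by exists 1; [exact: ltr01|move=> z _ []].
have [|ep ep0 {}IH] := IH; first by move=> b bL; apply: H; rewrite inE bL orbT.
have [a0E|aa0] := eqVneq a a0.
  exists ep => // z bz [b]; rewrite inE => /orP[/eqP ->|bL] zb; first by rewrite -a0E.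
  by apply: (IH z bz); exists b.
have [|de de0 K] := @seg_apart R (zp a.1) (zp a.2) x.
  by move=> ax; move/eqP: aa0; apply; apply: H => //; exact: mem_head.
exists (Num.min ep de); first by rewrite lt_min ep0.
move=> z bz [b]; rewrite inE => /orP[/eqP -> zb|bL zb].
  by case: (K z _ zb); apply: le_ball bz; rewrite ge_min lexx orbT.
by apply: (IH z); [apply: le_ball bz; rewrite ge_min lexx|exists b].
Qed.

Lemma cross_proper L M a b x : a \in L -> b \in M -> crossZ a b -> zseg a x -> zseg b x ->
  (forall c, c \in L -> zseg c x -> c = a) -> (forall c, c \in M -> zseg c x -> c = b) ->
  proper_crossing (cov L) (cov M) x.
Proof.
rewrite /crossZ; case: ifP => // /side_opp ab aL bM /side_opp ba ax bx uL uM.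
have [e1 e10 H1] := cov_apart uL; have [e2 e20 H2] := cov_apart uM.
move: ax bx => [ta _ Ea] [tb _ Eb].
have [|_ /andP[tb0 tb1]] := @seg_opposite R _ _ _ _ tb ab; first by rewrite -Eb Ea orient_line.
have [|_ /andP[ta0 ta1]] := @seg_opposite R _ _ _ _ ta ba; first by rewrite -Ea Eb orient_line.
have {}ab : orient (zp a.1) (zp a.2) (zp b.1) != orient (zp a.1) (zp a.2) (zp b.2).
  by apply: contraTneq ab => ->; rewrite -leNgt -expr2 sqr_ge0.
move: ab Ea Eb H1 H2; rewrite /zseg; set p := zp a.1; set q := zp a.2; set r := zp b.1; set s := zp b.2.
move=> ab Ea Eb H1 H2.
have D0 : (q.1 - p.1) * (s.2 - r.2) - (q.2 - p.2) * (s.1 - r.1) != 0.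
  apply: contraNneq ab => D0; apply/eqP; apply/esym/eqP; rewrite -subr_eq0; apply/eqP.
  by rewrite -[RHS]D0 /orient; ring.
pose N := `|q.1 - p.1| + `|q.2 - p.2| + `|s.1 - r.1| + `|s.2 - r.2|.
have N0 : 0 <= N by rewrite !addr_ge0.
(* [m] bounds how far one can go along both segments before an end, and the distance of [x] from all
   other segments of [L] and [M]. With [ep = m / (N + 1)] the chart domain lies in the ball of
   radius [m]. *)
pose m := Num.min (Num.min (Num.min ta (1 - ta)) (Num.min tb (1 - tb))) (Num.min e1 e2).
have m0 : 0 < m by rewrite !lt_min ta0 tb0 e10 e20 !subr_gt0 ta1 tb1.
pose ep := m / (N + 1).
have N1 : 0 < N + 1 by lra.
have ep0 : 0 < ep by apply: divr_gt0.
have epm : ep <= m by rewrite ler_pdivrMr // ler_peMr ?(ltW m0) // lerDr.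
have epN : ep * N < m by rewrite /ep mulrAC ltr_pdivrMr // ltr_pM2l // ltrDl ltr01.
have mm : [/\ m <= ta, m <= 1 - ta, m <= tb, m <= 1 - tb & m <= e1 /\ m <= e2].
  by split; rewrite ?ge_min ?lexx ?orbT //.
have [m1 m2 m3 m4 [m5 m6]] := mm.
have near z : ball (0 : plane) 1 (chart p q r s x ep z) -> ball x m z by exact: chart_small.
have small u c : `|u| < 1 -> m <= c -> m <= 1 - c -> 0 <= c + ep * u <= 1.
  move=> u1 c1 c2; have : `|ep * u| <= m.
    by rewrite normrM (gtr0_norm ep0); apply: le_trans epm; rewrite ler_piMr ?ltW.
  by rewrite ler_norml => /andP[? ?]; apply/andP; split; lra.
apply: (chart_crossing (p := p) (q := q) (r := r) (s := s) (ep := ep)) => // z bz.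
  split => [Lz|h].
    have [|t _ ->] := H1 z _ Lz; first exact: le_ball m5 _ (near z bz).
    exact: chart_axis1 Ea t.
  exists a => //; exists (ta + ep * (chart p q r s x ep z).1); last exact: axis1_lerp.
  by apply: small => //; case: bz; rewrite /ball /= sub0r normrN.
split => [Mz|h].
  have [|t _ ->] := H2 z _ Mz; first exact: le_ball m6 _ (near z bz).
  exact: chart_axis2 Eb t.
exists b => //; exists (tb + ep * (chart p q r s x ep z).2); last exact: axis2_lerp.
by apply: small => //; case: bz => _; rewrite /ball /= sub0r normrN.
Qed.

(* Near an endpoint a polyline is a half-open segment, on which the position along the segment has a minimum;
   a crossing would make it change sign. *)
Lemma end_not_crossing L a w (B : set plane) : has_end a w -> a.1 != a.2 ->
  (forall b, b \in L -> zseg b (zp w) -> b = a) -> ~ proper_crossing (cov L) B (zp w).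
Proof.
move=> aw a12 uL [U [h [k [oU Uw hw [hk kh ch ck] HAB]]]].
have [ep ep0 near] := cov_apart uL.
rewrite (zseg_other aw) in near.
have wq : zp w != zp (other_end a w).
  rewrite (inj_eq zp_inj); move: a12 aw; rewrite /has_end /other_end.
  by have [<- //|_ a12 /= /eqP <-] := eqVneq a.1 w; rewrite eq_sym.
move: (zp (other_end a w)) near wq hw HAB Uw => q; move: (zp w) => p near pq hp HAB Up {uL aw a12}.
pose e t := k (t, 0).
have V t : -1 < t < 1 -> ball (0 : plane) 1 (t, 0).
  move=> /andP[t0 t1]; split; rewrite /ball /= sub0r normrN ?normr0 ?ltr01 // ltr_norml t0.
  by [].
have ce : pcont e (- (1 / 2)) (1 / 2).
  apply: (ctn_comp (E := ball (0 : plane) 1)); last exact/ctnP.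
    by move=> t /= /andP[t0 t1]; apply: V; apply/andP; split; lra.
  by apply: ctn_pair; [exact: ctn_id|exact: ctn_cst].
have e0 : e 0 = p by rewrite /e -(hk _ Up).2 hp.
have [||||s1 [s2 [h1 h2 h3 h4 H]]] := @nbhd_interval R e (- (1 / 2)) (1 / 2) 0 (ball p ep) _ _ ce.
- lra.
- lra.
- exact: ball_open.
- by rewrite e0; exact: ballxx.
pose f t := ((e t).1 - p.1) * (q.1 - p.1) + ((e t).2 - p.2) * (q.2 - p.2).
pose n := (q.1 - p.1) ^+ 2 + (q.2 - p.2) ^+ 2.
have n0 : 0 < n.
  rewrite lt_neqAle addr_ge0 ?sqr_ge0 // andbT eq_sym paddr_eq0 ?sqr_ge0 // !sqrf_eq0 !subr_eq0.
  apply: contra pq => /andP[/eqP E1 /eqP E2].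
  by rewrite [p]surjective_pairing [q]surjective_pairing E1 E2.
have on t : s1 <= t <= s2 -> exists2 c, 0 <= c <= 1 & e t = lerp p q c.
  move=> tI; have : -1 < t < 1 by move: tI => /andP[? ?]; apply/andP; split; lra.
  move=> /V /kh [Ue he]; apply: near; first exact: H.
  by apply/(HAB _ Ue).1; rewrite he.
have fc t c : e t = lerp p q c -> f t = c * n by move=> E; rewrite /f E /lerp /n /=; ring.
have f0 : f 0 = 0 by rewrite /f e0 !subrr !mul0r addr0.
have := @inj_sign_change R f s1 0 s2 h2 h3 _ _ f0.
have s1I : s1 <= s1 <= s2 by rewrite lexx; lra.
have s2I : s1 <= s2 <= s2 by rewrite lexx andbT; lra.
have [c1 /andP[c10 _] /fc ->] := on _ s1I; have [c2 /andP[c20 _] /fc ->] := on _ s2I.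
suff : 0 <= c1 * n * (c2 * n).
  rewrite leNgt => /negP nf K; apply: nf; apply: K.
    have : pcont e s1 s2 by apply: pcont_sub ce _ _; lra.
    move=> c; apply: ctnD; apply: ctnM; try exact: ctn_cst; apply: ctnD; try exact: ctn_cst.
      exact: ctn_fst c.
    exact: ctn_snd c.
  move=> t t' tI tI'; have [c _ Ec] := on _ tI; have [c' _ Ec'] := on _ tI'.
  rewrite (fc _ _ Ec) (fc _ _ Ec') => /mulIf cc; have {}cc := cc (lt0r_neq0 n0).
  have : h (e t) = h (e t') by rewrite Ec Ec' cc.
  have J u : s1 <= u <= s2 -> ball (0 : plane) 1 (u, 0).
    by move=> /andP[? ?]; apply: V; apply/andP; split; lra.
  by rewrite /e (kh _ (J _ tI)).2 (kh _ (J _ tI')).2 => -[].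
by rewrite !mulr_ge0 // ltW.
Qed.

(** The first segment takes half of the parameter interval and the rest of the polyline the other
    half, which keeps the recursion on the list of vertices simple. *)
Fixpoint pl p s t : plane :=
  match s with
  | [::] => zp p
  | [:: q] => lerp (zp p) (zp q) t
  | q :: s' => if t <= 1 / 2 then lerp (zp p) (zp q) (2 * t) else pl q s' (2 * t - 1)
  end.

Lemma plS p q r s t : pl p [:: q, r & s] t =
  if t <= 1 / 2 then lerp (zp p) (zp q) (2 * t) else pl q (r :: s) (2 * t - 1).
Proof. by []. Qed.

Lemma pl0 p s : pl p s 0 = zp p.
Proof.
case: s => [//|q [|r s]] /=; first exact: lerp0.
by have -> : (0 : R) <= 1 / 2 by [lra]; rewrite mulr0 lerp0.
Qed.

Lemma pl1 p s : pl p s 1 = zp (last p s).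
Proof.
elim: s p => [//|q [|r s] IH] p; first exact: lerp1.
rewrite plS -[RHS](IH q).
have -> : ((1 : R) <= 1 / 2) = false by apply/negbTE; rewrite -ltNge; lra.
by congr (pl _ _ _); ring.
Qed.

Lemma ctn_eq (T U : topologicalType) (D : set T) (f g : T -> U) :
  (forall y, D y -> f y = g y) -> ctn D f -> ctn D g.
Proof.
move=> fg cf y Dy V; rewrite /= -(fg y Dy) => HV.
have : nbhs y [set v | D v -> V (f v)] := cf y Dy V HV.
suff : nbhs y [set v | D v -> V (f v)] -> nbhs y [set v | D v -> V (g v)] by exact.
by apply: filterS => v /= H Dv; rewrite -fg //; exact: H.
Qed.

Lemma pl_cont p s : pcont (pl p s) 0 1.
Proof.
elim: s p => [|q [|r s] IH] p; [exact: ctn_cst|exact: lerp_cont|].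
rewrite /pcont; have -> : [set t : R | 0 <= t <= 1] = `[0, 1 / 2] `|` `[1 / 2, 1].
  apply/seteqP; split => t /=; rewrite !in_itv /=.
    by move=> /andP[-> ->]; rewrite andbT; case: (leP t); [left|right; rewrite ltW].
  by case=> /andP[t0 t1]; apply/andP; split; lra.
apply/ctnP; apply: withinU_continuous; try exact: interval_closed.
  apply/ctnP; apply: (@ctn_eq _ _ _ (fun t => lerp (zp p) (zp q) (2 * t))) => [t|].
    by rewrite /= in_itv /= => /andP[_ ->].
  apply: (ctn_comp (E := [set t : R | 0 <= t <= 1]) (f := fun t : R => 2 * t) (g := lerp (zp p) (zp q)));
    last exact: lerp_cont.
    by move=> t; rewrite /= in_itv /= => /andP[t0 t1]; apply/andP; split; lra.
  by apply: ctnM; [exact: ctn_cst|exact: ctn_id].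
apply/ctnP; apply: (@ctn_eq _ _ _ (fun t => pl q (r :: s) (2 * t - 1))) => [t|].
  move=> tI; have /andP[t1 _] : 1 / 2 <= t <= 1 by move: tI; rewrite /= in_itv.
  rewrite plS; case: (leP t) => // t2.
  have -> : t = 1 / 2 by apply/eqP; rewrite eq_le t2 t1.
  by rewrite (_ : 2 * (1 / 2) = 1 :> R) ?subrr ?lerp1; [exact: pl0|lra].
apply: (ctn_comp (E := [set t : R | 0 <= t <= 1]) (f := fun t : R => 2 * t - 1) (g := pl q (r :: s))); last exact: IH.
  by move=> t; rewrite /= in_itv /= => /andP[t0 t1]; apply/andP; split; lra.
by apply: ctnD; [apply: ctnM; [exact: ctn_cst|exact: ctn_id]|exact: ctn_cst].
Qed.

Lemma pl_cov p s t : s != [::] -> 0 <= t <= 1 -> cov (psegs p s) (pl p s t).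
Proof.
elim: s p t => [//|q [|r s] IH] p t _ /andP[t0 t1].
  by exists (p, q); [exact: mem_head|exists t => //; rewrite t0].
rewrite plS; case: leP => t2.
  by exists (p, q); [exact: mem_head|exists (2 * t) => //; apply/andP; split; lra].
have [|a aL az] := IH q (2 * t - 1) isT; first by apply/andP; split; lra.
by exists a => //; rewrite inE aL orbT.
Qed.

Lemma cov_pl p s z : cov (psegs p s) z -> exists2 t, 0 <= t <= 1 & z = pl p s t.
Proof.
elim: s p => [|q [|r s] IH] p; first by case.
  by case=> a; rewrite /= inE => /eqP -> [t tI ->]; exists t.
case=> a; rewrite inE => /orP[/eqP -> [t /andP[t0 t1] ->]|aL az].
  exists (t / 2); first by apply/andP; split; lra.
  rewrite plS; have -> : t / 2 <= 1 / 2 by lra.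
  by congr lerp; field.
have [|t /andP[t0 t1] ->] := IH q; first by exists a.
have [-> |tn0] := eqVneq t 0.
  exists (1 / 2); first by apply/andP; split; lra.
  by rewrite pl0 plS lexx (_ : 2 * (1 / 2) = 1 :> R) ?lerp1; [|lra].
have {t0}tn0 : 0 < t by rewrite lt_neqAle eq_sym tn0.
exists ((t + 1) / 2); first by apply/andP; split; lra.
rewrite plS; case: leP => h; first by exfalso; lra.
by congr (pl _ _ _); field.
Qed.

Lemma curve_pl p s : s != [::] -> curve (pl p s) = cov (psegs p s).
Proof.
move=> s0; apply/seteqP; split => z.
  by move=> [t]; rewrite /= in_itv /= => tI <-; exact: pl_cov.
by move=> /cov_pl[t tI ->]; exists t => //=; rewrite in_itv.
Qed.

Lemma simple_joint p q r s z : simple p [:: q, r & s] -> zseg (p, q) z ->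
  cov (psegs q (r :: s)) z -> z = zp q.
Proof.
move=> /and3P[n0 /allP sp _] az [b]; rewrite inE => /orP[/eqP -> bz|/sp pb bz].
  by apply: (seg_touch (orientZ_neq0 n0)) => //; rewrite segC.
by case: (zseg_sep pb az bz).
Qed.

Lemma simple_neq p q s : simple p (q :: s) -> p != q.
Proof.
case: s => [//|r s] /and3P[n0 _ _]; apply: contraNneq n0 => ->.
by rewrite /orientZ !Z.sub_diag.
Qed.

Lemma pl_inj p s t t' : simple p s -> 0 <= t <= 1 -> 0 <= t' <= 1 -> pl p s t = pl p s t' -> t = t'.
Proof.
elim: s p t t' => [//|q [|r s] IH] p t t' sp tI tI'.
  by apply: lerp_inj; rewrite (inj_eq zp_inj).
have pq : zp p != zp q by rewrite (inj_eq zp_inj); exact: simple_neq sp.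
have sq : simple q (r :: s) by case/and3P: sp.
wlog tt' : t t' tI tI' / t <= t'.
  by move=> W; have [h|/ltW h] := leP t t' => E; [exact: W|apply/esym; exact: W].
move: tI tI' => /andP[t0 t1] /andP[t0' t1'].
rewrite !plS; case: leP => h; case: leP => h' E.
- by have := lerp_inj pq E; lra.
- have I' : 0 <= 2 * t' - 1 <= 1 by apply/andP; split; lra.
  have J : pl q (r :: s) (2 * t' - 1) = zp q.
    rewrite -E; apply: (simple_joint sp); first by exists (2 * t) => //; apply/andP; split; lra.
    by rewrite E; exact: pl_cov.
  have := IH q (2 * t' - 1) 0 sq I'; rewrite lexx ler01 pl0 J => /(_ isT erefl).
  lra.
- lra.
- have := IH q (2 * t - 1) (2 * t' - 1) sq _ _ E.
  move=> K; have : 2 * t - 1 = 2 * t' - 1 by apply: K; apply/andP; split; lra.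
  lra.
Qed.

Lemma pl_jordan p s : simple p s -> jordan_arc (pl p s).
Proof.
move=> sp; split; first by apply/ctnP; rewrite set_itvcc; exact: pl_cont.
by move=> t t'; rewrite !in_itv /= => tI tI'; exact: pl_inj.
Qed.

Lemma cov_connected p s : s != [::] -> connected (cov (psegs p s)).
Proof.
move=> s0; rewrite -curve_pl //; apply: connected_continuous_connected.
  by apply/connected_intervalP; exact: interval_is_interval.
by apply/ctnP; rewrite set_itvcc; exact: pl_cont.
Qed.

End Polylines.

Local Close Scope ring_scope.
Local Close Scope classical_set_scope.

(** * Crossings of a K7 *)

Section Search.

(* [((i, j), (k, l))] stands for the parity of the crossings of the edges [ij] and [kl] of a K7. *)
Definition xvar := ((nat * nat) * (nat * nat))%type.
Definition xcon := (seq xvar * bool)%type.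

Definition xorl (s : seq bool) : bool := foldr addb false s.

Definition disj2 (e f : nat * nat) : bool :=
  [&& e.1 != f.1, e.1 != f.2, e.2 != f.1 & e.2 != f.2].

Definition conflict (v w : xvar) : bool :=
  [|| (v.1 == w.1) && disj2 v.2 w.2, (v.1 == w.2) && disj2 v.2 w.1,
      (v.2 == w.1) && disj2 v.1 w.2 | (v.2 == w.2) && disj2 v.1 w.1].

Definition holds (c : xcon) (asg : seq xvar) : bool :=
  xorl [seq w \in asg | w <- c.1] == c.2.

(** Each variable is listed with the constraints that become decided when it is assigned: they
    contain it, and otherwise only earlier variables. *)
Fixpoint steps (cons : seq xcon) (done todo : seq xvar) : seq (xvar * seq xcon) :=
  if todo is v :: todo' then
    (v, [seq c <- cons | (v \in c.1) && all (mem (v :: done)) c.1])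
      :: steps cons (v :: done) todo'
  else [::].

(* Backtracking over the set [asg] of crossing pairs; [conflict] is Pattern (I). *)
Fixpoint refute (st : seq (xvar * seq xcon)) (asg : seq xvar) : bool :=
  if st is (v, cs) :: st' then
    if (if all (holds^~ asg) cs then refute st' asg else true) then
      if has (conflict v) asg then true
      else if all (holds^~ (v :: asg)) cs then refute st' (v :: asg) else true
    else false
  else false.

(** Along the branch that follows [f], the list [asg] consists of the assigned variables that hold
    under [f]. No constraint and no conflict closes this branch, and at its end [refute] answers
    [false]. *)
Lemma refute_sound (f : xvar -> bool) (cons : seq xcon) (done todo : seq xvar) :
  (forall c, c \in cons -> xorl (map f c.1) = c.2) ->
  (forall v w, v \in todo -> w \in done ++ todo -> f v -> f w -> conflict v w = false) ->
  refute (steps cons done todo) [seq v <- done | f v] -> False.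
Proof.
move=> hc; elim: todo done => //= v todo IH done hf; case: ifP => // r0 r1.
have ok : all (holds^~ [seq w <- v :: done | f w])
    [seq c <- cons | (v \in c.1) && all (mem (v :: done)) c.1].
  apply/allP => c; rewrite mem_filter => /andP[/andP[_ /allP cd] /hc cE].
  rewrite /holds -cE; apply/eqP; congr xorl.
  by apply/eq_in_map => w /cd wd; rewrite mem_filter [w \in _]wd andbT.
apply: (IH (v :: done)).
  move=> w w' wt w'd; apply: hf; first by rewrite inE wt orbT.
  by move: w'd; rewrite !mem_cat !inE; case: (_ == v); case: (_ \in done); case: (_ \in todo).
move: ok r0 r1 => /=; case: ifP => fv ok; last by rewrite ok.
rewrite ok /= => _; case: ifP => // /hasP[w]; rewrite mem_filter => /andP[fw wd].
by rewrite hf // ?inE ?eqxx // mem_cat wd.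
Qed.

Definition cvar (i j k l : nat) : xvar := if i < k then ((i, j), (k, l)) else ((k, l), (i, j)).

(** All 105 pairs of disjoint edges of a K7, three for each set of four vertices. *)
Definition fours : seq xvar :=
  flatten [seq flatten [seq flatten [seq flatten [seq
    [:: ((a, b), (c, d)); ((a, c), (b, d)); ((a, d), (b, c))]
    | a <- iota 0 b] | b <- iota 0 c] | c <- iota 0 d] | d <- iota 0 7].

Definition K5con (a b c d e : nat) : xcon :=
  ([:: ((a, b), (c, d)); ((a, b), (c, e)); ((a, b), (d, e));
       ((a, c), (b, d)); ((a, c), (b, e)); ((a, c), (d, e));
       ((a, d), (b, c)); ((a, d), (b, e)); ((a, d), (c, e));
       ((a, e), (b, c)); ((a, e), (b, d)); ((a, e), (c, d));
       ((b, c), (d, e)); ((b, d), (c, e)); ((b, e), (c, d))], true).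

Definition tricon (a b c a' b' c' : nat) : xcon :=
  ([:: cvar a b a' b'; cvar a b b' c'; cvar a b a' c';
       cvar b c a' b'; cvar b c b' c'; cvar b c a' c';
       cvar a c a' b'; cvar a c b' c'; cvar a c a' c'], false).

Definition subs3 : seq (nat * nat * nat) :=
  flatten [seq flatten [seq [seq (a, b, c) | a <- iota 0 b] | b <- iota 0 c] | c <- iota 0 7].

Definition five (s : seq nat) : seq xcon :=
  if s is [:: a; b; c; d; e] then [:: K5con a b c d e] else [::].

Definition K5cons : seq xcon :=
  flatten [seq flatten [seq five [seq i <- iota 0 7 | (i != p) && (i != q)] | p <- iota 0 q] | q <- iota 0 7].

(** The 70 pairs of disjoint triangles; comparing the smallest vertices lists each pair once. *)
Definition tricons : seq xcon :=
  flatten [seq [seq tricon s.1.1 s.1.2 s.2 t.1.1 t.1.2 t.2 | t <- subs3 &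
     (s.1.1 < t.1.1) && all (fun i => i \notin [:: t.1.1; t.1.2; t.2]) [:: s.1.1; s.1.2; s.2]] | s <- subs3].

Definition cutv (A : seq bool) (v : xvar) : bool :=
  (nth false A v.1.1 != nth false A v.1.2) || (nth false A v.2.1 != nth false A v.2.2).

(** If no edge between the two classes of [A] were crossed, every variable that involves such an
    edge would be zero. These variables are dropped from the constraints, and what remains is to be
    contradictory. *)
Definition refute_cut (A : seq bool) : bool :=
  refute (steps [seq ([seq v <- c.1 | ~~ cutv A v], c.2) | c <- K5cons ++ tricons]
            [::] [seq v <- fours | ~~ cutv A v]) [::].

Fixpoint bitseqs (n : nat) : seq (seq bool) :=
  if n is n'.+1 then [seq true :: s | s <- bitseqs n'] ++ [seq false :: s | s <- bitseqs n'] else [:: [::]].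

Lemma mem_bitseqs (A : seq bool) : A \in bitseqs (size A).
Proof.
elim: A => // b A IH /=; rewrite mem_cat; case: b.
  by rewrite map_f.
by rewrite orbC map_f.
Qed.

(** Vertex 0 is placed in the class [true], so the 63 sequences other than the constant one are the
    cuts of a K7. *)
Lemma refute_cuts : all (fun A => if all id A then true else refute_cut (true :: A)) (bitseqs 6).
Proof. by vm_compute. Qed.

Lemma fours_wf : all (fun v : xvar => [&& v.1.1 < 7, v.1.2 < 7, v.2.1 < 7, v.2.2 < 7,
  v.1.1 != v.1.2, v.2.1 != v.2.2 & disj2 v.1 v.2]) fours.
Proof. by vm_compute. Qed.

Lemma K5cons_wf : all (fun c : xcon => has (fun s => c == K5con (nth 0 s 0) (nth 0 s 1) (nth 0 s 2) (nth 0 s 3) (nth 0 s 4))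
   [seq s <- [seq [seq i <- iota 0 7 | (i != p.1) && (i != p.2)] | p <- [seq (p, q) | p <- iota 0 7, q <- iota 0 7]] | size s == 5]) K5cons.
Proof. by vm_compute. Qed.

End Search.

Section K7.
Variables (R : realType) (G : sgraph) (D : drawing R G).
Hypothesis noI : forall e e1 e2, ~ pattern_I D e e1 e2.
Variable m : nat -> G.
Hypothesis madj : forall i j, i < 7 -> j < 7 -> i != j -> adj (m i) (m j).

Let fm (v : xvar) : bool := chi D (m v.1.1) (m v.1.2) (m v.2.1) (m v.2.2).

Let mneq i j : i < 7 -> j < 7 -> i != j -> m i != m j.
Proof. by move=> i7 j7 ij; apply: adj_neq; apply: madj. Qed.

Let mindep i j k l : i < 7 -> j < 7 -> k < 7 -> l < 7 -> disj2 (i, j) (k, l) ->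
  indep (m i) (m j) (m k) (m l).
Proof. by move=> i7 j7 k7 l7 /and4P[? ? ? ?]; apply/and4P; split; apply: mneq. Qed.

Let fm_cvar i j k l : i < 7 -> j < 7 -> k < 7 -> l < 7 -> i != j -> k != l -> disj2 (i, j) (k, l) ->
  fm (cvar i j k l) = chi D (m i) (m j) (m k) (m l).
Proof.
move=> i7 j7 k7 l7 ij kl d; rewrite /fm /cvar; case: ifP => //= _.
by rewrite chiC //; [exact: madj|exact: madj|rewrite indepC; exact: mindep].
Qed.

Let K5_fm (s : seq nat) : uniq s -> size s = 5 -> all (fun i => i < 7) s ->
  let c := K5con (nth 0 s 0) (nth 0 s 1) (nth 0 s 2) (nth 0 s 3) (nth 0 s 4) in
  xorl (map fm c.1) = c.2.
Proof.
case: s => [|a [|b [|c [|d [|e [|? ?]]]]]] //=; rewrite !inE !negb_or.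
move=> /and5P[/and4P[ab ac ad ae] /and3P[bc bd be] /andP[cd ce] de _] _ /and5P[a7 b7 c7 d7 /andP[e7 _]].
have A i j : i < 7 -> j < 7 -> i != j -> vpath (G := G) (m i) [:: m j] (m j).
  by move=> i7 j7 ij; split => //=; rewrite madj.
have P i j k l : i < 7 -> j < 7 -> k < 7 -> l < 7 -> i != k -> i != l -> j != k -> j != l ->
    apart [:: m i; m j] [:: m k; m l].
  by move=> *; rewrite /apart /= !inE !negb_or !mneq.
have := @K5_odd _ _ D (m a) (m b) (m c) (m d) (m e) [:: m b] [:: m c] [:: m d] [:: m e] [:: m c] [:: m d] [:: m e] [:: m d] [:: m e] [:: m e].
rewrite /= => H; rewrite -H; try (exact: A); try (by apply: P; rewrite // eq_sym).
by rewrite /fm /=; xor.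
Qed.

Let tri_fm (s t : nat * nat * nat) : s \in subs3 -> t \in subs3 ->
  all (fun i => i \notin [:: t.1.1; t.1.2; t.2]) [:: s.1.1; s.1.2; s.2] ->
  let c := tricon s.1.1 s.1.2 s.2 t.1.1 t.1.2 t.2 in xorl (map fm c.1) = c.2.
Proof.
have wf : all (fun s : nat * nat * nat => [&& s.1.1 < 7, s.1.2 < 7, s.2 < 7, s.1.1 != s.1.2, s.1.2 != s.2 & s.1.1 != s.2]) subs3.
  by vm_compute.
move=> /(allP wf) + /(allP wf); case: s t => [[a b] c] [[a' b'] c'] /=.
move=> /and5P[a7 b7 c7 ab /andP[bc ac]] /and5P[a'7 b'7 c'7 ab' /andP[bc' ac']].
rewrite !inE !negb_or => /and4P[/and3P[n1 n2 n3] /and3P[n4 n5 n6] /and3P[n7 n8 n9] _].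
have := @triangles_even _ _ D (m a) (m b) (m c) (m a') (m b') (m c').
rewrite !madj // => /(_ isT isT isT isT isT isT) H; apply: etrans (H _); last first.
  by rewrite /apart /= !inE !negb_or !mneq.
rewrite !fm_cvar // /disj2 /= ?n1 ?n2 ?n3 ?n4 ?n5 ?n6 ?n7 ?n8 ?n9 //.
by xor.
Qed.

Definition crossed i j : Prop := exists k l,
  [/\ k < 7, l < 7, k != l, disj2 (k, l) (i, j) & chi D (m k) (m l) (m i) (m j)].

Lemma K7_cut (A : nat -> bool) i0 j0 : i0 < 7 -> j0 < 7 -> A i0 -> ~~ A j0 ->
  exists i j, [/\ i < 7, j < 7, A i, ~~ A j & crossed i j].
Proof.
move=> i07 j07 Ai0 Aj0; apply: contrapT => none.
(* Comparing with the class of vertex 0 normalizes the cut so that its first bit is [true]. *)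
pose A' i := A i == A 0; pose B' := map A' (iota 1 6); pose B := true :: B'.
have BA i : i < 7 -> nth false B i = A' i.
  case: i => [|i] i7; first by rewrite /= /A' eqxx.
  by rewrite /= (nth_map 0) ?size_iota // nth_iota.
have BB i j : i < 7 -> j < 7 -> (nth false B i != nth false B j) = (A i != A j).
  by move=> i7 j7; rewrite !BA // /A'; case: (A i); case: (A j); case: (A 0).
have := allP refute_cuts B' (mem_bitseqs B').
have -> : all id B' = false.
  apply/negP => /allP H; have K i : i < 7 -> A i = A 0.
    case: i => // i i7; apply/eqP; apply: (H (A' i.+1)); apply: map_f.
    by rewrite mem_iota.
  by move: Ai0 Aj0; rewrite (K i0) // (K j0) // => ->.
rewrite -/B /refute_cut.
have wf v : v \in fours -> [&& v.1.1 < 7, v.1.2 < 7, v.2.1 < 7, v.2.2 < 7,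
  v.1.1 != v.1.2, v.2.1 != v.2.2 & disj2 v.1 v.2] by move/(allP fours_wf).
have cut0 i j k l : i < 7 -> j < 7 -> k < 7 -> l < 7 -> i != j -> k != l ->
    disj2 (i, j) (k, l) -> A i != A j -> chi D (m i) (m j) (m k) (m l) = false.
  move=> i7 j7 k7 l7 ij kl d cut; apply/negP => c; apply: none.
  have d' : disj2 (k, l) (i, j) by move: d => /and4P[/= *]; apply/and4P; split; rewrite /= eq_sym.
  have c1 : crossed i j.
    by exists k, l; split => //; rewrite -chiC //; [exact: madj|exact: madj|exact: mindep].
  have c2 : crossed j i.
    exists k, l; split => //; first by move: d' => /and4P[/= *]; apply/and4P; split.
    rewrite chiC; [|exact: madj|by apply: madj; rewrite // eq_sym|]; last first.
      by apply: mindep => //; move: d' => /and4P[/= *]; apply/and4P; split.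
    by rewrite -chi_swap //; [exact: madj|exact: madj|exact: mindep].
  case Ai : (A i) cut; case Aj : (A j) => // _.
    by exists i, j; rewrite Ai Aj.
  by exists j, i; rewrite Ai Aj.
apply: (@refute_sound fm).
- have inc c : c \in K5cons ++ tricons ->
      xorl (map fm c.1) = c.2 /\ all (fun v : xvar => [&& v.1.1 < 7, v.1.2 < 7, v.2.1 < 7, v.2.2 < 7,
  v.1.1 != v.1.2, v.2.1 != v.2.2 & disj2 v.1 v.2]) c.1.
    rewrite mem_cat => cI; split; last first.
      have W : all (fun c : xcon => all (fun v : xvar => [&& v.1.1 < 7, v.1.2 < 7, v.2.1 < 7, v.2.2 < 7,
         v.1.1 != v.1.2, v.2.1 != v.2.2 & disj2 v.1 v.2]) c.1) (K5cons ++ tricons) by vm_compute.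
      by apply: (allP W); rewrite mem_cat.
    case/orP: cI => [/(allP K5cons_wf)|].
      move=> /hasP[s]; rewrite mem_filter => /andP[/eqP s5 /mapP[p _ sE]] /eqP ->.
      apply: K5_fm => //; first by rewrite sE filter_uniq // iota_uniq.
      by apply/allP => i; rewrite sE mem_filter mem_iota => /andP[_ /andP[]].
    move=> /flatten_mapP[s sI] /mapP[t]; rewrite mem_filter => /andP[/andP[_ d] tI] ->.
    exact: tri_fm.
  move=> c' /mapP[c /inc[cE /allP cW] ->] /=; rewrite -cE.
  elim: c.1 cW {cE} => //= v ls IH cW.
  have {IH} <- : xorl [seq fm i | i <- ls & ~~ cutv B i] = xorl [seq fm i | i <- ls].
    by apply: IH => w wl; apply: cW; rewrite inE wl orbT.
  case: ifP => //= /negbFE cv; suff -> : fm v = false by [].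
  have := cW v; rewrite inE eqxx => /(_ isT).
  case: v cv {cW} => [[i j] [k l]] /= cv /and5P[i7 j7 k7 l7 /and3P[ij kl d]].
  move: cv; rewrite /cutv !BB // => /orP[cv|cv]; first exact: cut0.
  rewrite /fm /= chiC; [|exact: madj|exact: madj|exact: mindep].
  by apply: cut0 => //; move: d => /and4P[/= *]; apply/and4P; split; rewrite /= eq_sym.
- move=> v w; rewrite !mem_filter => /andP[_ /wf +] /andP[_ /wf].
  case: v w => [[a b] [c d]] [[a' b'] [c' d']] /=.
  move=> /and5P[a7 b7 c7 d7 /and3P[ab cd dv]] /and5P[a'7 b'7 c'7 d'7 /and3P[ab' cd' dw]] fv fw.
  have F i j k l p q : i < 7 -> j < 7 -> k < 7 -> l < 7 -> p < 7 -> q < 7 ->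
      i != j -> k != l -> p != q -> disj2 (i, j) (k, l) -> disj2 (p, q) (k, l) ->
      chi D (m i) (m j) (m k) (m l) -> chi D (m p) (m q) (m k) (m l) -> disj2 (i, j) (p, q) = false.
    move=> i7 j7 k7 l7 p7 q7 ij kl pq d1 d2 h1 h2; apply/negP => d3.
    have := @fan _ _ D noI (m k) (m l) (m i) (m j) (m p) (m q).
    rewrite !madj // => /(_ isT isT isT (mindep i7 j7 k7 l7 d1) (mindep p7 q7 k7 l7 d2) h1 h2).
    by rewrite mindep.
  have sym i j k l : disj2 (i, j) (k, l) -> disj2 (k, l) (i, j).
    by move=> /and4P[/= *]; apply/and4P; split; rewrite /= eq_sym.
  have fs i j k l : i < 7 -> j < 7 -> k < 7 -> l < 7 -> i != j -> k != l -> disj2 (i, j) (k, l) ->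
     chi D (m i) (m j) (m k) (m l) -> chi D (m k) (m l) (m i) (m j).
    by move=> *; rewrite -chiC //; [exact: madj|exact: madj|exact: mindep].
  rewrite /conflict /=; apply/negP => /or4P[] /andP[/eqP[? ?] H]; subst.
  + by move: H; rewrite (F c d a' b' c' d') //; [exact: sym|exact: sym|exact: fs|exact: fs].
  + by move: H; rewrite (F c d c' d' a' b') //; [exact: sym|exact: fs].
  + by move: H; rewrite (F a b a' b' c' d') //; [exact: sym|exact: fs].
  + by move: H; rewrite (F a b c' d' a' b').
Qed.

End K7.

Lemma path_zip (T : eqType) (e : rel T) x s u v : path e x s -> (u, v) \in zip (x :: s) s -> e u v.
Proof.
elim: s x => //= y s IH x /andP[xy ys]; rewrite inE => /orP[/eqP[-> ->]//|].
exact: IH.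
Qed.

Lemma zip_cat_path (T : eqType) (x : T) s t : zip (x :: s ++ t) (s ++ t) = zip (x :: s) s ++ zip (last x s :: t) t.
Proof. by elim: s x => //= y s IH x; rewrite -IH. Qed.

(** * Paths that foreign edges cannot cross *)

Section Thick.
Variables (R : realType) (G : sgraph) (D : drawing R G).
Hypothesis noI : forall e e1 e2, ~ pattern_I D e e1 e2.
Implicit Types (u v w x y p q : G) (M ps qs : seq G).

(* By Pattern (I) an edge crossing [uv] then shares an endpoint with [pq]. *)
Definition protected M u v : Prop :=
  exists p q, [/\ p \in M, q \in M, adj p q, indep p q u v & chi D p q u v].

Definition thick x ps y M : Prop :=
  [/\ vpath x ps y, all (mem M) (x :: ps) &
      forall u v, (u, v) \in zip (x :: ps) ps -> protected M u v].

Lemma K7_thick M x y : uniq M -> size M = 7 -> {in M &, forall u v, u != v -> adj u v} ->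
  x \in M -> y \in M -> exists ps, thick x ps y M.
Proof.
move=> uM sM aM xM yM.
pose m i := nth x M i.
have mM i : i < 7 -> m i \in M by move=> i7; rewrite mem_nth // sM.
have mne i j : i < 7 -> j < 7 -> i != j -> m i != m j.
  by move=> i7 j7 ij; rewrite nth_uniq // sM.
have madj i j : i < 7 -> j < 7 -> i != j -> adj (m i) (m j).
  by move=> i7 j7 ij; apply: aM; rewrite ?mM ?mne.
pose r (i j : 'I_7) := (i != j) && `[< crossed D m i j >].
have ix : index x M < 7 by rewrite -sM index_mem.
have iy : index y M < 7 by rewrite -sM index_mem.
have : connect r (Ordinal ix) (Ordinal iy).
  apply: contrapT => /negP nc.
  (* The cut between the vertices reachable from [x] along crossed edges and the others; a crossed
     edge across it would reach a further vertex. *)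
  pose A i := if insub i is Some o then connect r (Ordinal ix) o else false.
  have AE (o : 'I_7) : A o = connect r (Ordinal ix) o by rewrite /A valK.
  have [||i [j [i7 j7 Ai Aj c]]] := @K7_cut _ _ D noI m madj A _ _ ix iy.
  - by rewrite (AE (Ordinal ix)) connect0.
  - by rewrite (AE (Ordinal iy)).
  move: (Aj); rewrite (AE (Ordinal j7)) => /negP; apply.
  have Ai' : connect r (Ordinal ix) (Ordinal i7) by rewrite -AE.
  apply: connect_trans Ai' (connect1 _); apply/andP; split; last exact/asboolP.
  by apply/eqP => -[ij]; move: Aj; rewrite -ij Ai.
move=> /connectP[p pp pl]; exists (map (fun o : 'I_7 => m o) p).
have mx : x = m (Ordinal ix) by rewrite /m nth_index.
have my : y = m (Ordinal iy) by rewrite /m nth_index.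
split.
- split; last first.
    by have := last_map (fun o : 'I_7 => m o) p (Ordinal ix); rewrite -pl -mx -my.
  have := @homo_path _ _ (fun o : 'I_7 => m o) r (@adj G) (Ordinal ix) p.
  by rewrite -mx; apply=> // i j /andP[ij _]; exact: madj.
- rewrite /= xM /=; apply/allP => w /mapP[i _ ->].
  exact: mM.
move=> u v; pose e := fun u v : G => `[< protected M u v >].
have pe : path e x (map (fun o : 'I_7 => m o) p).
  have := @homo_path _ _ (fun o : 'I_7 => m o) r e (Ordinal ix) p.
  rewrite -mx; apply=> // i j /andP[ij /asboolP[k [l [k7 l7 kl d c]]]].
  apply/asboolP; exists (m k), (m l); split; rewrite ?mM ?madj //.
  by move: d => /and4P[/= *]; apply/and4P; split; apply: mne.
by move=> /(path_zip pe)/asboolP.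
Qed.

Lemma thick_cat x ps y qs z M M' : thick x ps y M -> thick y qs z M' ->
  thick x (ps ++ qs) z (M ++ M').
Proof.
move=> [[a1 l1] m1 p1] [[a2 l2] m2 p2]; split.
- by split; [rewrite cat_path a1 l1|rewrite last_cat l1].
- rewrite -cat_cons all_cat; apply/andP; split.
    by apply: sub_all m1 => w /= wM; rewrite mem_cat wM.
  by move: m2 => /= /andP[_]; apply: sub_all => w /= wM; rewrite mem_cat wM orbT.
move=> u v; rewrite zip_cat_path l1 mem_cat => /orP[/p1|/p2] [p [q [pM qM pq i c]]];
  by exists p, q; rewrite !mem_cat pM qM ?orbT.
Qed.

(** An edge of [M] crosses [uv]; an edge that avoids [M] and also crossed [uv] would be independent
    of it, which is Pattern (I). *)
Lemma thick_chi x ps y M u v p q : thick x ps y M -> (u, v) \in zip (x :: ps) ps ->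
  adj p q -> p \notin M -> q \notin M -> chi D u v p q = false /\ chi D p q u v = false.
Proof.
move=> [[a _] /allP m pr] uvz pq pM qM.
have uv := path_zip a uvz.
have zm (s t : seq G) : (u, v) \in zip s t -> u \in s /\ v \in t.
  elim: s t => [|a1 s IH] [|b1 t] //=; rewrite !inE => /orP[/eqP[-> ->]|/IH[-> ->]].
    by rewrite !eqxx.
  by rewrite !orbT.
have [us vs] := zm _ _ uvz.
have uM : u \in M by apply: m.
have vM : v \in M by apply: m; rewrite inE vs orbT.
have i : indep p q u v.
  by apply/and4P; split; apply/eqP => E; [move: pM|move: pM|move: qM|move: qM]; rewrite E ?uM ?vM.
have K : chi D p q u v = false.
  apply/negP => c; have [r [s [rM sM rs irs crs]]] := pr _ _ uvz.
  have := fan noI uv pq rs i irs c crs => /negP; apply.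
  by apply/and4P; split; apply/eqP => E; [move: pM|move: pM|move: qM|move: qM]; rewrite E ?rM ?sM.
by split => //; rewrite chiC // indepC.
Qed.

Lemma zip_mem (s : seq G) x u v : (u, v) \in zip (x :: s) s -> u \in x :: s /\ v \in x :: s.
Proof.
elim: s x => //= y s IH x; rewrite inE => /orP[/eqP[-> ->]|/IH[h1 h2]].
  by rewrite !inE !eqxx orbT.
by rewrite inE h1 orbT inE h2 orbT.
Qed.

Lemma thick_chi2l x ps y M z qs : thick x ps y M -> path (@adj G) z qs -> apart M (z :: qs) ->
  chi2 D x ps z qs = false.
Proof.
move=> t a /allP ap; apply: chi2_false => u v p q _ _ pz qz uv pq.
apply: (thick_chi t uv (path_zip a pq) _ _).1; apply/negP => /ap; by rewrite ?pz ?qz.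
Qed.

Lemma thick_chi2r x ps y M z qs : thick x ps y M -> path (@adj G) z qs -> apart M (z :: qs) ->
  chi2 D z qs x ps = false.
Proof.
move=> t a /allP ap; apply: chi2_false => p q u v pz qz _ _ pq uv.
apply: (thick_chi t uv (path_zip a pq) _ _).2; apply/negP => /ap; by rewrite ?pz ?qz.
Qed.

Lemma apart_sub (M M' s t : seq G) : all (mem M) s -> all (mem M') t -> apart M M' -> apart s t.
Proof.
move=> /allP sM /allP tM' /allP ap; apply/allP => w /sM /ap.
by apply: contra => /tM'.
Qed.

Lemma apartC (M M' : seq G) : apart M M' = apart M' M.
Proof.
by apply/allP/allP => H w wM; apply/negP => /H; rewrite wM.
Qed.

(** Of the fifteen independent pairs in a K5, only [p01] with [p23] has no thick member, so the odd
    total is carried by this pair. *)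
Lemma K5_thick v0 v1 v2 v3 v4 (p01 p23 m01 m02 m03 m04 m12 m13 m14 m23 m24 m34 : seq G) :
  vpath v0 p01 v1 -> all (mem m01) (v0 :: p01) ->
  vpath v2 p23 v3 -> all (mem m23) (v2 :: p23) ->
  (exists ps, thick v0 ps v2 m02) -> (exists ps, thick v0 ps v3 m03) ->
  (exists ps, thick v0 ps v4 m04) -> (exists ps, thick v1 ps v2 m12) ->
  (exists ps, thick v1 ps v3 m13) -> (exists ps, thick v1 ps v4 m14) ->
  (exists ps, thick v2 ps v4 m24) -> (exists ps, thick v3 ps v4 m34) ->
  [&& apart m01 m23, apart m01 m24, apart m01 m34, apart m02 m13, apart m02 m14, apart m02 m34,
      apart m03 m12, apart m03 m14, apart m03 m24, apart m04 m12, apart m04 m13, apart m04 m23,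
      apart m12 m34, apart m13 m24 & apart m14 m23] ->
  chi2 D v0 p01 v2 p23 = true.
Proof.
move=> P01 i01 P23 i23 [p02 T02] [p03 T03] [p04 T04] [p12 T12] [p13 T13] [p14 T14] [p24 T24] [p34 T34].
move=> /and5P[d1 d2 d3 d4 /and5P[d5 d6 d7 d8 /and5P[d9 d10 d11 d12 /and3P[d13 d14 d15]]]].
have [P02 i02 _] := T02; have [P03 i03 _] := T03; have [P04 i04 _] := T04.
have [P12 i12 _] := T12; have [P13 i13 _] := T13; have [P14 i14 _] := T14.
have [P24 i24 _] := T24; have [P34 i34 _] := T34.
have self (s : seq G) : all (mem s) s by apply/allP.
have K := @K5_odd _ _ D _ _ _ _ _ _ _ _ _ _ _ _ _ _ _ P01 P02 P03 P04 P12 P13 P14 P23 P24 P34.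
have := K (apart_sub i01 i23 d1) (apart_sub i01 i24 d2) (apart_sub i01 i34 d3)
  (apart_sub i02 i13 d4) (apart_sub i02 i14 d5) (apart_sub i02 i34 d6)
  (apart_sub i03 i12 d7) (apart_sub i03 i14 d8) (apart_sub i03 i24 d9)
  (apart_sub i04 i12 d10) (apart_sub i04 i13 d11) (apart_sub i04 i23 d12)
  (apart_sub i12 i34 d13) (apart_sub i13 i24 d14) (apart_sub i14 i23 d15).
have L x ps y M z qs M' : thick x ps y M -> vpath z qs (last z qs) -> all (mem M') (z :: qs) -> apart M M' ->
    chi2 D x ps z qs = false.
  by move=> t [a _] i d; apply: (thick_chi2l t a); apply: apart_sub d.
have Rr x ps y M z qs M' : thick x ps y M -> vpath z qs (last z qs) -> all (mem M') (z :: qs) -> apart M' M ->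
    chi2 D z qs x ps = false.
  by move=> t [a _] i d; apply: (thick_chi2r t a); apply: apart_sub _ i _; [exact: self|rewrite apartC].
have V x ps y : vpath x ps y -> vpath x ps (last x ps) by move=> [].
rewrite (Rr _ _ _ _ _ _ _ T24 (V _ _ _ P01) i01 d2) (Rr _ _ _ _ _ _ _ T34 (V _ _ _ P01) i01 d3).
rewrite (L _ _ _ _ _ _ _ T02 (V _ _ _ P13) i13 d4) (L _ _ _ _ _ _ _ T02 (V _ _ _ P14) i14 d5).
rewrite (L _ _ _ _ _ _ _ T02 (V _ _ _ P34) i34 d6) (L _ _ _ _ _ _ _ T03 (V _ _ _ P12) i12 d7).
rewrite (L _ _ _ _ _ _ _ T03 (V _ _ _ P14) i14 d8) (L _ _ _ _ _ _ _ T03 (V _ _ _ P24) i24 d9).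
rewrite (L _ _ _ _ _ _ _ T04 (V _ _ _ P12) i12 d10) (L _ _ _ _ _ _ _ T04 (V _ _ _ P13) i13 d11).
rewrite (L _ _ _ _ _ _ _ T04 (V _ _ _ P23) i23 d12) (L _ _ _ _ _ _ _ T12 (V _ _ _ P34) i34 d13).
rewrite (L _ _ _ _ _ _ _ T13 (V _ _ _ P24) i24 d14) (L _ _ _ _ _ _ _ T14 (V _ _ _ P23) i23 d15).
by rewrite !addbF.
Qed.

End Thick.

(** * The graph *)

Definition side_thick (k : nat) : seq (nat * nat) :=
  let: (o, u, a, b, c, d) := (k + 1, k + 2, k + 3, k + 4, k + 5, k + 6) in
  [:: (o, u); (o, a); (o, b); (o, c); (o, d); (u, a); (a, c); (c, d); (d, b); (b, u); (u, 0)].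

Definition side_thin (k : nat) : seq (nat * nat) :=
  let: (o, u, a, b, c, d) := (k + 1, k + 2, k + 3, k + 4, k + 5, k + 6) in
  [:: (u, c); (u, d); (a, b); (a, d); (b, c); (0, a); (0, b)].

Definition thick_edges : seq (nat * nat) := side_thick 0 ++ side_thick 6.
Definition thin_edges : seq (nat * nat) := side_thin 0 ++ side_thin 6.

Definition gadget (i : nat) : seq nat :=
  let: (x, y) := nth (0, 0) thick_edges i in [:: x; y] ++ iota (13 + 5 * i) 5.

Definition gadgets : seq (seq nat) := map gadget (iota 0 22).

Definition adjn (i j : nat) : bool :=
  (i != j) && [|| has (fun M => (i \in M) && (j \in M)) gadgets, (i, j) \in thin_edges | (j, i) \in thin_edges].

Lemma adjn_sym : symmetric adjn.
Proof.
move=> i j; rewrite /adjn eq_sym [((i, j) \in _) || _]orbC; congr (_ && (_ || _)).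
by apply: eq_has => M; rewrite andbC.
Qed.

(** 13 named vertices, and five inner vertices for each of the 22 thick edges. *)
Definition order := 123.

Definition gadj (i j : 'I_order) : bool := adjn i j.

Lemma gadj_sym : symmetric gadj.
Proof. by move=> i j; exact: adjn_sym. Qed.

Lemma gadj_irrefl : irreflexive gadj.
Proof. by move=> i; rewrite /gadj /adjn eqxx. Qed.

Definition fan_graph : sgraph := SGraph gadj_sym gadj_irrefl.

Definition vx (n : nat) : fan_graph := insubd (ord0 : 'I_order) n.

Lemma vxK n : n < order -> val (vx n : 'I_order) = n.
Proof. by move=> n_lt; rewrite val_insubd n_lt. Qed.

Lemma vx_adj m n : m < order -> n < order -> adj (vx m) (vx n) = adjn m n.
Proof. by move=> m_lt n_lt; rewrite /= /gadj !vxK. Qed.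

Lemma vx_eq m n : m < order -> n < order -> (vx m == vx n) = (m == n).
Proof. by move=> m_lt n_lt; rewrite -(inj_eq val_inj) !vxK. Qed.

Lemma vx_mem n s : n < order -> all (fun m => m < order) s -> (vx n \in map vx s) = (n \in s).
Proof.
move=> n_lt; elim: s => //= m s IH /andP[m_lt s_lt].
by rewrite !inE vx_eq // IH.
Qed.

Definition ltorder (s : seq nat) : bool := all (fun m => m < order) s.
Definition apartn (s t : seq nat) : bool := all (fun w => w \notin t) s.

Lemma apart_vx s t : ltorder s -> ltorder t -> apartn s t -> @apart fan_graph (map vx s) (map vx t).
Proof.
move=> /allP s_lt t_lt /allP st; apply/allP => w /mapP[i si ->].
by rewrite vx_mem ?st // s_lt.
Qed.

Lemma path_vx x s : ltorder (x :: s) -> path adjn x s -> path (@adj fan_graph) (vx x) (map vx s).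
Proof.
elim: s x => //= y s IH x /and3P[x_lt y_lt s_lt] /andP[xy ys].
by rewrite /gadj !vxK // xy IH //= y_lt.
Qed.

(** The default [[::]] arises only for vertices without a common gadget, and [route] rejects it. *)
Definition gad (x y : nat) : seq nat := head [::] [seq M <- gadgets | (x \in M) && (y \in M)].

Fixpoint route (x : nat) (r : seq nat) : bool :=
  if r is y :: r' then [&& gad x y \in gadgets, x \in gad x y, y \in gad x y & route y r'] else true.

Fixpoint support (x : nat) (r : seq nat) : seq nat :=
  if r is y :: r' then (if r' is [::] then gad x y else gad x y ++ support y r') else [::].

Lemma gadgets_wf : all (fun M => [&& uniq M, size M == 7, ltorder M & all (fun i => all (fun j => (i == j) || adjn i j) M) M]) gadgets.
Proof. by vm_compute. Qed.

(** * Crossings forced on one side *)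

Section Refutation.
Variables (R : realType) (D : drawing R fan_graph).
Hypothesis noI : forall e e1 e2, ~ pattern_I D e e1 e2.

Lemma gadget_thick M x y : M \in gadgets -> x \in M -> y \in M ->
  exists ps, thick D (vx x) ps (vx y) (map vx M).
Proof.
move=> /(allP gadgets_wf)/and4P[uM /eqP sM /allP ltM /allP aM] xM yM.
apply: (K7_thick noI).
- rewrite map_inj_in_uniq // => i j iM jM /eqP.
  by rewrite vx_eq ?ltM // => /eqP.
- by rewrite size_map.
- move=> u v /mapP[i iM ->] /mapP[j jM ->]; rewrite vx_eq ?ltM // vx_adj ?ltM // => ij.
  by have /allP /(_ j jM) := aM i iM; rewrite (negPf ij).
- exact: map_f.
- exact: map_f.
Qed.

Lemma route_thick x y r : route x (y :: r) ->
  exists ps, thick D (vx x) ps (vx (last y r)) (map vx (support x (y :: r))).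
Proof.
elim: r x y => [|z r IH] x y; first by move=> /= /and4P[gM xM yM _]; exact: gadget_thick.
move=> /= /and4P[gM xM yM /(IH y z)[qs tq]].
have [ps tp] := gadget_thick gM xM yM.
by exists (ps ++ qs); rewrite map_cat; apply: thick_cat tq.
Qed.

(** The hypotheses of [K5_thick] in decidable form: the lists [p01] and [p23] are ordinary paths in
    the graph, each [r] lists the ends of consecutive thick edges, and disjointness is tested on the
    full vertex sets of their gadgets. *)
Definition K5ok v0 v1 v2 v3 v4 (p01 p23 r02 r03 r04 r12 r13 r14 r24 r34 : seq nat) : bool :=
  [&& [&& last v0 p01 == v1, last v2 p23 == v3, path adjn v0 p01 & path adjn v2 p23],
      [&& last v0 r02 == v2, last v0 r03 == v3, last v0 r04 == v4 & last v1 r12 == v2],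
      [&& last v1 r13 == v3, last v1 r14 == v4, last v2 r24 == v4 & last v3 r34 == v4],
      [&& route v0 r02, route v0 r03, route v0 r04 & route v1 r12],
      [&& route v1 r13, route v1 r14, route v2 r24 & route v3 r34],
      all (fun r => r != [::]) [:: r02; r03; r04; r12; r13; r14; r24; r34] &
      let: (m01, m23) := (v0 :: p01, v2 :: p23) in
      let: (m02, m03, m04, m12) := (support v0 r02, support v0 r03, support v0 r04, support v1 r12) in
      let: (m13, m14, m24, m34) := (support v1 r13, support v1 r14, support v2 r24, support v3 r34) in
      all ltorder [:: m01; m23; m02; m03; m04; m12; m13; m14; m24; m34] &&
      [&& apartn m01 m23, apartn m01 m24, apartn m01 m34, apartn m02 m13, apartn m02 m14, apartn m02 m34,
      apartn m03 m12, apartn m03 m14, apartn m03 m24, apartn m04 m12, apartn m04 m13, apartn m04 m23,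
      apartn m12 m34, apartn m13 m24 & apartn m14 m23]].

Lemma K5num v0 v1 v2 v3 v4 p01 p23 r02 r03 r04 r12 r13 r14 r24 r34 :
  K5ok v0 v1 v2 v3 v4 p01 p23 r02 r03 r04 r12 r13 r14 r24 r34 ->
  chi2 D (vx v0) (map vx p01) (vx v2) (map vx p23) = true.
Proof.
move=> /and5P[/and4P[/eqP l01 /eqP l23 P01 P23] /and4P[/eqP l02 /eqP l03 /eqP l04 /eqP l12]
  /and4P[/eqP l13 /eqP l14 /eqP l24 /eqP l34] /and4P[t02 t03 t04 t12] /and3P[/and4P[t13 t14 t24 t34] ne]].
move=> /andP[/and5P[q01 q23 q02 q03 /and5P[q04 q12 q13 q14 /and3P[q24 q34 _]]]].
move=> /and5P[d1 d2 d3 d4 /and5P[d5 d6 d7 d8 /and5P[d9 d10 d11 d12 /and3P[d13 d14 d15]]]].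
have T x y r : route x r -> last x r = y -> r != [::] -> exists ps, thick D (vx x) ps (vx y) (map vx (support x r)).
  by case: r => // z r /route_thick + <-.
move: ne; rewrite /= => /and5P[n02 n03 n04 n12 /and5P[n13 n14 n24 n34 _]].
apply: (@K5_thick _ _ D noI (vx v0) (vx v1) (vx v2) (vx v3) (vx v4) _ _ (map vx (v0 :: p01)) (map vx (support v0 r02))
   (map vx (support v0 r03)) (map vx (support v0 r04)) (map vx (support v1 r12)) (map vx (support v1 r13))
   (map vx (support v1 r14)) (map vx (v2 :: p23)) (map vx (support v2 r24)) (map vx (support v3 r34))).
- by split; [apply: path_vx|rewrite last_map l01].
- exact/allP.
- by split; [apply: path_vx|rewrite last_map l23].
- exact/allP.
- exact: T.
- exact: T.
- exact: T.
- exact: T.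
- exact: T.
- exact: T.
- exact: T.
- exact: T.
by rewrite !apart_vx.
Qed.


(** The order is [o u a b c d]. Each of the two sides occurs together with its mirror image, which
    exchanges [a] with [b] and [c] with [d]. *)
Definition cfgs : seq (nat * nat * nat * nat * nat * nat) :=
  [:: (1, 2, 3, 4, 5, 6); (1, 2, 4, 3, 6, 5); (7, 8, 9, 10, 11, 12); (7, 8, 10, 9, 12, 11)].

(** Three K5 with the hub [o] as fifth vertex: on [u c a b], on the same vertices with the path over
    [0] in place of [ab], and on [u c a d]. Connections that are not thick edges follow the
    pentagon: [c d b] in the first two and [u b d] in the third. *)
Definition cfgok (t : nat * nat * nat * nat * nat * nat) : bool :=
  let: (o, u, a, b, c, d) := t in
  [&& K5ok u c a b o [:: c] [:: b] [:: a] [:: b] [:: o] [:: a] [:: d; b] [:: o] [:: o] [:: o],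
      K5ok u c a b o [:: c] [:: 0; b] [:: a] [:: b] [:: o] [:: a] [:: d; b] [:: o] [:: o] [:: o],
      K5ok u c a d o [:: c] [:: d] [:: a] [:: b; d] [:: o] [:: a] [:: d] [:: o] [:: o] [:: o],
      [&& ltorder [:: 0; o; u; a; b; c; d], uniq [:: 0; o; u; a; b; c; d] & all (fun e => adjn e.1 e.2)
        [:: (u, c); (u, d); (a, b); (a, 0); (0, b); (a, d)]],
      [&& route b [:: o], route o [:: a] & route 0 [:: u]] &
      [&& apartn (gad b o) [:: u; c; a; 0], apartn (gad o a) [:: u; c; 0; b],
          apartn (gad 0 u) [:: a; b; c], apartn (gad 0 u) (gad b o ++ gad o a)  &
          ltorder (gad b o ++ gad o a ++ gad 0 u)]].

Lemma cfgs_ok : all cfgok cfgs.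
Proof. by vm_compute. Qed.

Section Config.
Variables o u a b c d : nat.
Hypothesis cfg : (o, u, a, b, c, d) \in cfgs.

Let ok := allP cfgs_ok _ cfg.

(** The second K5 makes [uc] cross exactly one of [a0] and [0b]. It is not [0b], because by the
    third K5 [ad] crosses [uc] too, and [ad] is independent of [0b]. *)
Lemma config_crossings :
  [/\ chi D (vx u) (vx c) (vx a) (vx b), chi D (vx u) (vx c) (vx a) (vx 0) &
      chi D (vx u) (vx c) (vx 0) (vx b) = false].
Proof.
move: ok => /and5P[k1 k2 k3 /and3P[lt_ un /allP adjs] _].
move: lt_ => /and5P[z_lt o_lt u_lt a_lt /and4P[b_lt c_lt d_lt _]].
have := K5num k1; rewrite /= !addbF => uc_ab.
have := K5num k2; rewrite /= !addbF => uc_azb.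
have := K5num k3; rewrite /= !addbF => uc_ad.
have E i j : (i, j) \in [:: (u, c); (u, d); (a, b); (a, 0); (0, b); (a, d)] -> adjn i j.
  by move/adjs.
have uc : adj (vx u) (vx c) by rewrite vx_adj // E // !inE eqxx.
have zb : adj (vx 0) (vx b) by rewrite vx_adj // E // !inE eqxx !orbT.
have ad : adj (vx a) (vx d) by rewrite vx_adj // E // !inE eqxx !orbT.
move: un; rewrite /= !inE !negb_or -!andbA.
move=> /and5P[zo zu za zb_ /and5P[zc zd ou oa /and5P[ob oc od ua /and5P[ub uc_ ud ab /and5P[ac ad_ bc bd /andP[cd _]]]]]].
have uc_zb : chi D (vx u) (vx c) (vx 0) (vx b) = false.
  apply/negP; rewrite chiC //; last by rewrite /indep !vx_eq // !(eq_sym _ 0) !zu !zc ub (eq_sym c) bc.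
  move=> H; have := @fan _ _ D noI (vx u) (vx c) (vx 0) (vx b) (vx a) (vx d) uc zb ad.
  have i1 : indep (vx 0) (vx b) (vx u) (vx c) by rewrite /indep !vx_eq // zu zc (eq_sym b) ub bc.
  have i2 : indep (vx a) (vx d) (vx u) (vx c).
    by rewrite /indep !vx_eq // (eq_sym a u) ua ac (eq_sym d u) ud (eq_sym d c) cd.
  move=> /(_ i1 i2 H); rewrite -chiC //; last by rewrite indepC.
  by move=> /(_ uc_ad); rewrite /indep !vx_eq // za zd (eq_sym b a) ab bd.
by split => //; move: uc_azb; rewrite uc_zb addbF.
Qed.

End Config.

End Refutation.

(** * Coordinates of the weak drawing *)

Local Open Scope Z_scope.

(** In the order [o u a b c d]; the factor [m] reflects the second side in the vertical axis. *)
Definition side_points (m : Z) : seq pt :=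
  [:: (m * 71, 3); (m * 40, 1); (m * 60, 31); (m * 62, -30); (m * 90, 20); (m * 91, -21)].

Definition base_points : seq pt := (0, 7) :: side_points 1 ++ side_points (-1).
Definition base (n : nat) : pt := nth (0, 0) base_points n.

(* In the affine frame where the ends of the thick edge are (0, 0) and (58, 0), these five points complete a
   straight-line fan-planar K7; dividing their height by [flat] puts them in a thin lens around the edge. *)
Definition lens : seq pt := [:: (13, 20); (4, 2054); (23, 138); (23, 428); (56, -2274)].
Definition flat : Z := 16000.

(** The factor [58 * flat] clears the denominators of the inner vertices: 58 comes from the length
    of the frame of [lens] and [flat] from the division of the heights. *)
Definition scale (p : pt) : pt := (58 * flat * p.1, 58 * flat * p.2).

Definition point (n : nat) : pt :=
  if (n < 13)%N then scale (base n) else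
  let: (x, y) := nth (0%N, 0%N) thick_edges ((n - 13) %/ 5) in
  let: (s, h) := nth (0, 0) lens ((n - 13) %% 5) in
  let: (dx, dy) := ((base y).1 - (base x).1, (base y).2 - (base x).2) in
  ((scale (base x)).1 + s * flat * dx - h * dy, (scale (base x)).2 + s * flat * dy + h * dx).

(** In the order of [side_thin]. The edges [uc] and [ud] pass around the side above and below, and
    [ab] passes around its far end, so the closed curve they form surrounds both [a] and [b]. This
    is the Pattern (III) that the weak notion admits. *)
Definition side_bends (m : Z) : seq (seq pt) :=
  [:: [:: (m * 38, 52); (m * 100, 49)]; [:: (m * 39, -51); (m * 101, -50)]; [:: (m * 112, 42); (m * 113, -41)];
      [:: (m * 101, 29)]; [:: (m * 102, -28)]; [::]; [::]].

Local Close Scope Z_scope.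

Definition bends (e : nat * nat) : seq pt :=
  map scale (nth [::] (side_bends 1 ++ side_bends (Z.opp 1)) (index e thin_edges)).

Definition tail (e : nat * nat) : seq pt := rcons (bends e) (point e.2).
Definition esegs (e : nat * nat) : seq (pt * pt) := psegs (point e.1) (tail e).

Definition edges : seq (nat * nat) :=
  flatten [seq [seq e <- [seq (i, j) | i <- M, j <- M] | e.1 < e.2] | M <- gadgets] ++ thin_edges.

Definition common (e f : nat * nat) : option nat :=
  if (e.1 == f.1) || (e.1 == f.2) then Some e.1
  else if (e.2 == f.1) || (e.2 == f.2) then Some e.2 else None.

Definition off (b : pt * pt) (w : pt) : bool := sepZ b (w, w).

(** The polyline is a single segment near its end, as [end_not_crossing] requires; adjacent edges
    are shown by this not to cross at their common vertex. *)
Definition lone_end (w : pt) (L : seq (pt * pt)) : bool :=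
  if [seq a <- L | has_end a w] is [:: a]
  then (a.1 != a.2) && all (fun b => has_end b w || off b w) L else false.

Definition edge_ok (e : nat * nat) (L : seq (pt * pt)) : bool :=
  [&& adjn e.1 e.2, e.1 < order, e.2 < order, simple (point e.1) (tail e) &
   [&& lone_end (point e.1) L, lone_end (point e.2) L &
       all (fun v => [|| v == e.1, v == e.2 | all (fun b => off b (point v)) L]) (iota 0 order)]].

Definition hits (L M : seq (pt * pt)) : seq ((pt * pt) * (pt * pt)) :=
  [seq ab <- [seq (a, b) | a <- L, b <- M] | ~~ sepZ ab.1 ab.2].

(** The crossings of the straight-line K7, with 0 and 1 for the ends of the thick edge and 2 to 6
    for the points of [lens]. The lists of crossings are claims: [pair_ok] fails on a crossing that
    is missing from them. *)
Definition K7_crossings : seq ((nat * nat) * (nat * nat)) :=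
  [:: ((0, 1), (2, 6)); ((0, 1), (3, 6)); ((0, 1), (4, 6)); ((0, 1), (5, 6)); ((0, 4), (2, 3));
      ((0, 4), (2, 5)); ((0, 5), (2, 3)); ((0, 5), (3, 4)); ((1, 2), (3, 6)); ((1, 2), (4, 6));
      ((1, 2), (5, 6)); ((1, 4), (3, 6)); ((1, 4), (5, 6)); ((1, 5), (3, 6)); ((2, 5), (3, 4))].

Definition thin_crossings : seq (nat * nat) := [:: (0, 2); (0, 3); (0, 5); (1, 2); (1, 4); (1, 6); (3, 4)].

Definition upward (i j : nat) : nat * nat := if i < j then (i, j) else (j, i).

Definition crossings : seq ((nat * nat) * (nat * nat)) :=
  [seq (upward (nth 0 M c.1.1) (nth 0 M c.1.2), upward (nth 0 M c.2.1) (nth 0 M c.2.2)) |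
     M <- gadgets, c <- K7_crossings] ++
  [seq (nth (0, 0) (side_thin k) c.1, nth (0, 0) (side_thin k) c.2) | k <- [:: 0; 6], c <- thin_crossings].

Definition partners (e : nat * nat) : seq (nat * nat) :=
  [seq c.2 | c <- crossings & c.1 == e] ++ [seq c.1 | c <- crossings & c.2 == e].

Definition pair_ok (e : nat * nat) L (f : nat * nat) M : bool :=
  if common e f is Some w then all (fun ab => touchZ ab.1 ab.2 (point w)) (hits L M) else
  match hits L M with
  | [::] => true
  | [:: (a, b)] => if crossZ a b then ((e, f) \in crossings) || ((f, e) \in crossings) else false
  | _ => false
  end.

Definition table : seq ((nat * nat) * seq (pt * pt)) := [seq (e, esegs e) | e <- edges].

Definition bypass (e f g : nat * nat) (s : seq pt) : bool :=
  all (fun a => [&& all (sepZ a) (esegs f), all (sepZ a) (esegs g) &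
         all (fun b => [|| sepZ a b, touchZ a b (point e.1) | touchZ a b (point e.2)]) (esegs e)]) (psegs (point e.1) s).

(* Along a triangle with centroid [u], or along a chord of the pentagon, one passes from one end of [e] to the other
   without meeting the edges through [u] that cross [e]. *)
Definition fan_ok (e f g : nat * nat) : bool :=
  if common f g is Some u then
    let: (p, q, r) := (point e.1, point e.2, point u) in
    let apex := (Z.sub (Z.mul 3 r.1) (Z.add p.1 q.1), Z.sub (Z.mul 3 r.2) (Z.add p.2 q.2)) in
    if bypass e f g [:: q] then true else bypass e f g [:: apex; q]
  else false.

Lemma points_uniq : uniq [seq point i | i <- iota 0 order].
Proof. by vm_compute. Qed.

Lemma edges_ok : all (fun x => edge_ok x.1 x.2) table.
Proof. by vm_compute. Qed.

Lemma pairs_ok : pairwise (fun x y => pair_ok x.1 x.2 y.1 y.2) table.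
Proof. by vm_compute. Qed.

Lemma fans_ok : all (fun e => let C := partners e in
  all (fun f => all (fun g => if f == g then true else fan_ok e f g) C) C) edges.
Proof. by vm_compute. Qed.

Local Open Scope classical_set_scope.
Local Open Scope ring_scope.

Lemma tail_neq0 e : tail e != [::].
Proof. by rewrite /tail; case: bends. Qed.

Lemma last_tail p e : last p (tail e) = point e.2.
Proof. by rewrite /tail last_rcons. Qed.

Lemma esegsE e : esegs e = psegs (point e.1) (tail e).
Proof. by []. Qed.

Lemma adjn_edges i j : adjn i j -> ((i, j) \in edges) || ((j, i) \in edges).
Proof.
move=> /andP[ij /orP[/hasP[M MG /andP[iM jM]]|/orP[h|h]]].
- have K k l : k \in M -> l \in M -> (k < l)%N -> (k, l) \in edges.
    move=> kM lM kl; rewrite mem_cat; apply/orP; left; apply/flattenP.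
    exists [seq e <- [seq (i, j) | i <- M, j <- M] | (e.1 < e.2)%N].
      exact: (map_f (fun M => [seq e <- [seq (i, j) | i <- M, j <- M] | (e.1 < e.2)%N])).
    by rewrite mem_filter kl; apply: allpairs_f.
  by move: ij; rewrite neq_ltn => /orP[] h; [rewrite (K _ _ iM jM h)|rewrite (K _ _ jM iM h) orbT].
- by rewrite /edges [X in X || _]mem_cat h orbT.
- by rewrite /edges [X in _ || X]mem_cat h !orbT.
Qed.

Lemma edge_okP e : e \in edges -> edge_ok e (esegs e).
Proof.
move=> eE; have : (e, esegs e) \in table by exact: (map_f (fun e => (e, esegs e))).
exact: (allP edges_ok).
Qed.

Lemma edge_lt e : e \in edges -> (e.1 < order)%N /\ (e.2 < order)%N.
Proof. by move=> /edge_okP/and5P[_ -> ->]. Qed.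

Lemma edge_upward e : e \in edges -> (e.1 < e.2)%N.
Proof.
have : all (fun e : nat * nat => (e.1 < e.2)%N) edges by vm_compute.
by move=> /allP; apply.
Qed.

Lemma pairwise_mem (T : eqType) (r : rel T) (s : seq T) x y :
  pairwise r s -> x \in s -> y \in s -> x != y -> r x y || r y x.
Proof.
elim: s => [//|z s IH] /= /andP[/allP rz ps]; rewrite !inE.
case/predU1P => [->|xs]; case/predU1P => [->|ys]; rewrite ?eqxx //.
- by rewrite rz.
- by rewrite rz // orbT.
- exact: IH.
Qed.

Lemma pair_okP e f : e \in edges -> f \in edges -> e != f ->
  pair_ok e (esegs e) f (esegs f) || pair_ok f (esegs f) e (esegs e).
Proof.
move=> eE fE ef; apply: (pairwise_mem (x := (e, esegs e)) (y := (f, esegs f)) pairs_ok).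
- exact: (map_f (fun e => (e, esegs e))).
- exact: (map_f (fun e => (e, esegs e))).
- by rewrite xpair_eqE (negPf ef).
Qed.

Lemma fan_okP e f g : e \in edges -> f \in partners e -> g \in partners e -> f != g -> fan_ok e f g.
Proof.
move=> eE fp gp fg; have /allP/(_ f fp)/allP/(_ g gp) := allP fans_ok e eE.
by rewrite (negPf fg).
Qed.

Lemma commonC e f : common e f = None -> common f e = None.
Proof. by rewrite /common !(eq_sym f.1) !(eq_sym f.2); do 4 case: eqP => //=. Qed.

Lemma common_mem e f w : common e f = Some w -> ((w == e.1) || (w == e.2)) && ((w == f.1) || (w == f.2)).
Proof.
rewrite /common; case: ifP => [h [<-]|_]; first by rewrite eqxx.
by case: ifP => // h [<-]; rewrite eqxx orbT.
Qed.

Lemma mem_common e f w : (w == e.1) || (w == e.2) -> (w == f.1) || (w == f.2) -> common e f <> None.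
Proof. by rewrite /common => /orP[] /eqP -> h; rewrite h //; case: ifP. Qed.

(** * The drawing over the reals and its patterns *)

Section Weak.
Variable R : realType.
Local Notation plane := (plane R).
Local Notation cov := (@cov R).

Lemma hitsP L M (z : plane) a b : a \in L -> b \in M -> zseg a z -> zseg b z -> (a, b) \in hits L M.
Proof.
move=> aL bM az bz; rewrite mem_filter /=; apply/andP; split; last exact: allpairs_f.
by apply/negP => /zseg_sep; apply; [exact: az|exact: bz].
Qed.

Lemma lone_endP (w : pt) L : lone_end w L ->
  exists2 a, has_end a w && (a.1 != a.2) & forall b, b \in L -> zseg b (zp R w) -> b = a.
Proof.
rewrite /lone_end; case E : [seq a <- L | has_end a w] => [//|a [|//]] /andP[a12 /allP H].
have : a \in [seq a <- L | has_end a w] by rewrite E mem_head.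
rewrite mem_filter => /andP[aw _]; exists a; first by rewrite aw.
move=> b bL bw; have : b \in [seq a <- L | has_end a w].
  rewrite mem_filter bL andbT; have /orP[//|off_b] := H b bL.
  case: (zseg_sep off_b bw); exists 0; first by rewrite lexx ler01.
  by rewrite lerp0.
by rewrite E inE => /eqP.
Qed.

Lemma meet_common e f w (z : plane) : e \in edges -> f \in edges -> e != f -> common e f = Some w ->
  cov (esegs e) z -> cov (esegs f) z ->
  exists v, [/\ (v == e.1) || (v == e.2), (v == f.1) || (v == f.2) & z = zp R (point v)].
Proof.
have K e' f' a b v : pair_ok e' (esegs e') f' (esegs f') -> common e' f' = Some v -> a \in esegs e' ->
    b \in esegs f' -> zseg a z -> zseg b z -> z = zp R (point v).
  rewrite /pair_ok => + C; rewrite C => /allP H aL bM az bz.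
  exact: (zseg_touch (H _ (hitsP aL bM az bz))).
move=> eE fE ef C [a aL az] [b bM bz].
have /orP[h|h] := pair_okP eE fE ef.
  by have /andP[v1 v2] := common_mem C; exists w; split => //; exact: (K _ _ _ _ _ h C aL bM).
case C' : (common f e) => [v|]; last by rewrite (commonC C') in C.
by have /andP[v1 v2] := common_mem C'; exists v; split => //; exact: (K _ _ _ _ _ h C' bM aL).
Qed.

Lemma partnersC e f : ((e, f) \in crossings) || ((f, e) \in crossings) -> f \in partners e.
Proof.
rewrite /partners [f \in _]mem_cat => /orP[h|h]; apply/orP; [left|right].
  by apply/mapP; exists (e, f); rewrite // mem_filter eqxx.
by apply/mapP; exists (f, e); rewrite // mem_filter eqxx.
Qed.

Lemma crossZC a b : crossZ a b = crossZ b a.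
Proof. by rewrite /crossZ; case: (Z.ltb _ _); case: (Z.ltb _ _). Qed.

Lemma meet_apart e f (z : plane) : e \in edges -> f \in edges -> e != f -> common e f = None ->
  cov (esegs e) z -> cov (esegs f) z ->
  f \in partners e /\ exists a b, [/\ a \in esegs e, b \in esegs f, crossZ a b &
    forall a' b' z', a' \in esegs e -> b' \in esegs f -> zseg a' (z' : plane) -> zseg b' z' -> a' = a /\ b' = b].
Proof.
have K e' f' : pair_ok e' (esegs e') f' (esegs f') -> common e' f' = None -> cov (esegs e') z ->
    cov (esegs f') z -> (((e', f') \in crossings) || ((f', e') \in crossings)) /\ exists a b,
    [/\ a \in esegs e', b \in esegs f', crossZ a b & forall a' b' z', a' \in esegs e' -> b' \in esegs f' ->
        zseg a' (z' : plane) -> zseg b' z' -> a' = a /\ b' = b].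
  rewrite /pair_ok => + C [a0 a0L a0z] [b0 b0M b0z]; rewrite C.
  have := hitsP a0L b0M a0z b0z; case E : (hits _ _) => [//|[a b] [|//]] _; case: ifP => // ab cr.
  have : (a, b) \in hits (esegs e') (esegs f') by rewrite E mem_head.
  rewrite mem_filter => /andP[_ /allpairsP[[a1 b1] /= [aL bM [Ea Eb]]]].
  rewrite -Ea in aL; rewrite -Eb in bM.
  split => //; exists a, b; split => // a' b' z' aL' bM' az' bz'.
  have := hitsP aL' bM' az' bz'; rewrite E inE => /eqP[-> ->].
  by [].
move=> eE fE ef C ze zf; have /orP[h|h] := pair_okP eE fE ef.
  by have [/partnersC] := K _ _ h C ze zf.
have [cr [b [a [bM aL ba H]]]] := K _ _ h (commonC C) zf ze.
split; first by apply: partnersC; rewrite orbC.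
exists a, b; split => //; first by rewrite crossZC.
by move=> a' b' z' aL' bM' az' bz'; have [-> ->] := H b' a' z' bM' aL' bz' az'.
Qed.

(* Locking [edges] keeps conversion from evaluating the coordinates when it compares two edges. *)
Definition entry (e : {set fan_graph}) : nat * nat :=
  let s := locked edges in nth (0, 0)%N s (find (fun uv => e == [set vx uv.1; vx uv.2]%SET) s).

Definition code (v : fan_graph) : nat := (v : 'I_order).

Lemma code_lt v : (code v < order)%N.
Proof. exact: ltn_ord. Qed.

Lemma codeK v : vx (code v) = v.
Proof. by apply: (@val_inj _ _ 'I_order); rewrite vxK // code_lt. Qed.

Lemma entryP e : is_edge e -> entry e \in edges /\ e = [set vx (entry e).1; vx (entry e).2]%SET.
Proof.
move=> [u [v [uv ->]]].
have H : has (fun p => [set u; v]%SET == [set vx p.1; vx p.2]%SET) edges.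
  have /orP[h|h] := adjn_edges uv; apply/hasP.
    by exists (code u, code v) => //=; rewrite !codeK.
  by exists (code v, code u) => //=; rewrite !codeK finset.setUC.
rewrite /entry -lock; split; first by rewrite mem_nth // -has_find.
by apply/eqP; exact: (nth_find (0, 0)%N H).
Qed.

Definition dpos (v : fan_graph) : plane := zp R (point (code v)).
Definition dcurve (e : {set fan_graph}) : R -> plane := @pl R (point (entry e).1) (tail (entry e)).

Lemma dpos_vx n : (n < order)%N -> dpos (vx n) = zp R (point n).
Proof. by move=> n_lt; rewrite /dpos /code vxK. Qed.

Lemma point_inj m n : (m < order)%N -> (n < order)%N -> point m = point n -> m = n.
Proof.
move=> mO nO E; have S : size [seq point i | i <- iota 0 order] = order by rewrite size_map size_iota.
apply: (uniqP (point 0) points_uniq); rewrite ?inE ?S //.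
by rewrite !(nth_map 0%N) ?size_iota // !nth_iota.
Qed.

Lemma dpos_inj : injective dpos.
Proof. by move=> u v /zp_inj /(point_inj (code_lt u) (code_lt v)) E; rewrite -(codeK u) E codeK. Qed.

Lemma curve_cov e : curve (dcurve e) = cov (esegs (entry e)).
Proof. by rewrite esegsE curve_pl // tail_neq0. Qed.

Lemma dcurve0 e : dcurve e 0 = zp R (point (entry e).1).
Proof. exact: pl0. Qed.

Lemma dcurve1 e : dcurve e 1 = zp R (point (entry e).2).
Proof. by rewrite /dcurve pl1 last_tail. Qed.

Lemma dcurve_jordan e : is_edge e -> jordan_arc (dcurve e).
Proof. by move=> /entryP[/edge_okP/and5P[_ _ _ sp _] _]; exact: pl_jordan. Qed.

Lemma dcurve_ends e : is_edge e ->
  exists u v, [/\ e = [set u; v]%SET, dcurve e 0 = dpos u & dcurve e 1 = dpos v].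
Proof.
move=> /entryP[/edge_lt[lt1 lt2] E]; exists (vx (entry e).1), (vx (entry e).2); split => //.
  by rewrite dpos_vx // dcurve0.
by rewrite dpos_vx // dcurve1.
Qed.

Lemma mem_entry e v : is_edge e -> (v \in e) = (code v == (entry e).1) || (code v == (entry e).2).
Proof.
move=> /entryP[/edge_lt[lt1 lt2] E]; rewrite {1}E !inE.
by rewrite -{1 2}(codeK v) !vx_eq // code_lt.
Qed.

Lemma dcurve_vertex e : is_edge e -> forall v, curve (dcurve e) (dpos v) -> v \in e.
Proof.
move=> eE v; rewrite curve_cov => -[b bL bv]; rewrite mem_entry //.
have /and5P[_ _ _ _ /and3P[_ _ /allP H]] := edge_okP (entryP eE).1.
have := H (code v); rewrite mem_iota /= add0n code_lt => /(_ isT) /or3P[->//|->|/allP h]; first by rewrite orbT.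
case: (zseg_sep (h b bL) bv); exists 0; first by rewrite lexx ler01.
by rewrite lerp0.
Qed.

Lemma entry_neq e f : is_edge e -> is_edge f -> e != f -> entry e != entry f.
Proof. by move=> /entryP[_ E] /entryP[_ F]; apply: contraNneq => h; rewrite E F h. Qed.

Lemma dcurves_meet_once e f : is_edge e -> is_edge f -> e != f ->
  forall p q, (curve (dcurve e) `&` curve (dcurve f)) p -> (curve (dcurve e) `&` curve (dcurve f)) q -> p = q.
Proof.
move=> eE fE ef p q; rewrite !curve_cov => -[pe pf] [qe qf].
have [eD _] := entryP eE; have [fD _] := entryP fE; have n := entry_neq eE fE ef.
case C : (common (entry e) (entry f)) => [w|].
  have [v [v1 v2 ->]] := meet_common eD fD n C pe pf; have [v' [v1' v2' ->]] := meet_common eD fD n C qe qf.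
  suff -> : v = v' by [].
  apply/eqP; move: n; apply: contraNT => vv'.
  move: (edge_upward eD) (edge_upward fD) v1 v2 v1' v2' vv'.
  by case: (entry e) (entry f) => [i j] [k l] /=; rewrite xpair_eqE; lia.
have [_ [a [b [aL bM ab H]]]] := meet_apart eD fD n C pe pf.
move: pe pf qe qf => [a1 a1L a1z] [b1 b1M b1z] [a2 a2L a2z] [b2 b2M b2z].
have [E1 F1] := H _ _ _ a1L b1M a1z b1z; have [E2 F2] := H _ _ _ a2L b2M a2z b2z.
by apply: (zseg_cross_uniq ab); rewrite -?E1 -?F1 // ?E1 ?F1 -?E2 -?F2.
Qed.

Lemma dcurves_meet e f : is_edge e -> is_edge f -> e != f -> forall p, (curve (dcurve e) `&` curve (dcurve f)) p ->
  (exists v, [/\ v \in e, v \in f & p = dpos v]) \/ proper_crossing (curve (dcurve e)) (curve (dcurve f)) p.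
Proof.
move=> eE fE ef p; rewrite !curve_cov => -[pe pf].
have [eD _] := entryP eE; have [fD _] := entryP fE; have n := entry_neq eE fE ef.
case C : (common (entry e) (entry f)) => [w|].
  have [v [v1 v2 ->]] := meet_common eD fD n C pe pf; left; exists (vx v).
  have v_lt : (v < order)%N by have [l1 l2] := edge_lt eD; case/orP: v1 => /eqP ->.
  by rewrite !mem_entry // /code vxK // v1 v2; split => //; rewrite dpos_vx.
have [_ [a [b [aL bM ab H]]]] := meet_apart eD fD n C pe pf; right.
move: pe pf => [a1 a1L a1z] [b1 b1M b1z]; have [E1 F1] := H _ _ _ a1L b1M a1z b1z.
rewrite E1 in a1z; rewrite F1 in b1z.
apply: (cross_proper aL bM ab a1z b1z) => c cL cz.
  by have [] := H c b p cL bM cz b1z.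
by have [] := H a c p aL cL a1z cz.
Qed.

Lemma dcurves_adjacent e f : is_edge e -> is_edge f -> e != f -> share_endpoint e f ->
  forall p, ~ proper_crossing (curve (dcurve e)) (curve (dcurve f)) p.
Proof.
move=> eE fE ef [u [ue uf]] p cr; have [pe pf] := crossing_curves cr.
have [eD _] := entryP eE; have [fD _] := entryP fE; have n := entry_neq eE fE ef.
move: ue uf; rewrite !mem_entry // => ue uf.
case C : (common (entry e) (entry f)) => [w|]; last by case: (mem_common ue uf C).
rewrite curve_cov in pe cr; rewrite curve_cov in pf.
have [v [v1 v2 E]] := meet_common eD fD n C pe pf; rewrite {}E in cr.
have /and5P[_ _ _ _ /and3P[l1 l2 _]] := edge_okP eD.
have : lone_end (point v) (esegs (entry e)) by case/orP: v1 => /eqP ->.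
move=> /lone_endP[a /andP[aw a12] H]; exact: (end_not_crossing aw a12 H cr).
Qed.

Definition fan_drawing : drawing R fan_graph :=
  Drawing dpos_inj dcurve_jordan dcurve_ends dcurve_vertex dcurves_meet_once dcurves_meet dcurves_adjacent.

Lemma crosses_partner e f x : crosses_at fan_drawing f e x ->
  entry f \in partners (entry e) /\ (cov (esegs (entry f)) x /\ cov (esegs (entry e)) x).
Proof.
move=> [fE eE fe cr]; have [] := crossing_curves cr; rewrite /= !curve_cov => xf xe; split => //.
have [eD _] := entryP eE; have [fD _] := entryP fE.
have ef : e != f by rewrite eq_sym.
have n := entry_neq eE fE ef.
case C : (common (entry e) (entry f)) => [w|]; last by have [] := meet_apart eD fD n C xe xf.
have /andP[w1 w2] := common_mem C; exfalso; apply: (dcurves_adjacent fE eE fe _ cr).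
have w_lt : (w < order)%N by have [l1 l2] := edge_lt eD; case/orP: w1 => /eqP ->.
by exists (vx w); rewrite !mem_entry // /code vxK // w1 w2.
Qed.

Lemma crosses_fan e f g x y : crosses_at fan_drawing f e x -> crosses_at fan_drawing g e y -> f != g ->
  fan_ok (entry e) (entry f) (entry g).
Proof.
move=> cf cg fg; have [fE eE _ _] := cf; have [gE _ _ _] := cg.
apply: fan_okP; [exact: (entryP eE).1|exact: (crosses_partner cf).1|exact: (crosses_partner cg).1|].
exact: entry_neq.
Qed.

Lemma no_pattern_I e f g : ~ pattern_I fan_drawing e f g.
Proof.
move=> [[x cf] [y cg] ns]; have [fE _ _ _] := cf; have [gE _ _ _] := cg.
have [fg|fg] := eqVneq f g.
  have [fD _] := entryP fE; apply: ns; exists (vx (entry f).1); rewrite -fg mem_entry // /code vxK ?eqxx //.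
  exact: (edge_lt fD).1.
have := crosses_fan cf cg fg; rewrite /fan_ok; case C : (common _ _) => [w|//] _.
have /andP[w1 w2] := common_mem C; apply: ns; exists (vx w).
have w_lt : (w < order)%N by have [l1 l2] := edge_lt (entryP fE).1; case/orP: w1 => /eqP ->.
by rewrite !mem_entry // /code vxK // w1 w2.
Qed.

Lemma part_sub (h : R -> plane) p q : part h p q `<=` curve h.
Proof.
move=> z [s [t [r [sI tI _ _ [/andP[r1 r2] ->]]]]]; exists r => //.
move: sI tI r1 r2; rewrite !in_itv /= => /andP[s0 s1] /andP[t0 t1] r1 r2.
by rewrite in_itv /= (le_trans _ r1) ?(le_trans r2) // ?ge_max ?le_min ?s0 ?s1.
Qed.

(** An end of an arc has an extreme parameter, which lies between two parameters only if it equals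
    one of them. *)
Lemma part_ends (h : R -> plane) p q c : jordan_arc h -> c = 0 \/ c = 1 -> part h p q (h c) -> h c = p \/ h c = q.
Proof.
move=> [_ inj] c01 [s [t [r [sI tI hs ht [/andP[r1 r2] E]]]]].
have [/andP[s0 s1] /andP[t0 t1]] : 0 <= s <= 1 /\ 0 <= t <= 1 by move: sI tI; rewrite !in_itv.
have rI : r \in `[0, 1].
  by rewrite in_itv /= (le_trans _ r1) ?(le_trans r2) // ?ge_max ?le_min ?s0 ?s1.
have cI : c \in `[0, 1] by rewrite in_itv /=; case: c01 => ->; rewrite ?lexx ?ler01.
have Er : c = r by exact: inj.
suff : s = c \/ t = c by case=> <-; [left|right].
move: r1 r2; rewrite -Er ge_min le_max; case: c01 => ->.
  by move=> /orP[h0|h0] _; [left|right]; apply/eqP; rewrite eq_le ?s0 ?t0 h0.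
by move=> _ /orP[h0|h0]; [left|right]; apply/eqP; rewrite eq_le ?s1 ?t1 h0.
Qed.

(** The bypass is a connected set in the complement of the closed curve: it misses [f] and [g], and
    meets [e] only in the ends of [e]. Such an end could lie on the part between [x] and [y] only as
    [x] or [y], which are points of [f] and [g]. So both ends of [e] are in one component. *)
Lemma bypass_connects e f g x y u s : crosses_at fan_drawing f e x -> crosses_at fan_drawing g e y ->
  bypass (entry e) (entry f) (entry g) s -> last (point (entry e).1) s = point (entry e).2 -> s != [::] ->
  let Z := closed_curve fan_drawing e f g u x y in
  forall v w, v \in e -> w \in e -> bounded_region Z (dpos v) -> bounded_region Z (dpos w).
Proof.
move=> cf cg /allP by_ ls s0 Z v w ve we [nZ bdd].
have [eE _ _ _] := cf; have [fE {}eE _ _] := cf; have [gE _ _ _] := cg.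
pose P := cov (psegs (point (entry e).1) s).
have avoid z : P z -> ~ cov (esegs (entry f)) z /\ ~ cov (esegs (entry g)) z.
  move=> [a /by_ /and3P[/allP af /allP ag _] az]; split => -[b bL bz].
    exact: (zseg_sep (af b bL) az bz).
  exact: (zseg_sep (ag b bL) az bz).
have [l1 l2] := edge_lt (entryP eE).1.
have E0 := dcurve0 e; have E1 := dcurve1 e.
have P0 : P (dcurve e 0) by rewrite E0 -(pl0 R _ s); apply: pl_cov => //; rewrite lexx ler01.
have P1 : P (dcurve e 1) by rewrite E1 -ls -(pl1 R _ s); apply: pl_cov => //; rewrite ler01 lexx.
have Pe z : P z -> curve (dcurve e) z -> exists2 c, c = 0 \/ c = 1 & z = dcurve e c.
  rewrite curve_cov => -[a /by_ /and3P[_ _ /allP ae] az] [b bL bz].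
  have /or3P[sp|tc|tc] := ae b bL; first by case: (zseg_sep sp az bz).
    by exists 0; [left|rewrite E0; exact: zseg_touch tc az bz].
  by exists 1; [right|rewrite E1; exact: zseg_touch tc az bz].
have PZ : P `<=` ~` Z.
  move=> z Pz; have [nf ng] := avoid z Pz; move=> [[zf|ze]|zg].
  - by apply: nf; rewrite -curve_cov; exact: part_sub zf.
  - have [c c01 E] := Pe z Pz (part_sub ze); rewrite E in ze.
    have := part_ends (dcurve_jordan eE) c01 ze; rewrite -E => -[Ex|Ey].
      by apply: nf; rewrite Ex; exact: (crosses_partner cf).2.1.
    by apply: ng; rewrite Ey; exact: (crosses_partner cg).2.1.
  - by apply: ng; rewrite -curve_cov; exact: part_sub zg.
have Pv v' : v' \in e -> P (dpos v').
  rewrite mem_entry // => /orP[] /eqP E; first by rewrite /dpos E -E0.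
  by rewrite /dpos E -E1.
have cP : connected P by exact: cov_connected.
split; first exact: PZ (Pv w we).
suff <- : connected_component (~` Z) (dpos v) = connected_component (~` Z) (dpos w) by [].
apply: same_connected_component; apply: (connected_component_max (Pv v ve) PZ cP); exact: Pv.
Qed.

(** By the bypass the bounded region contains both ends of [e] or neither, so there is never exactly
    one. *)
Lemma no_pattern_II e f g : ~ pattern_II fan_drawing e f g.
Proof.
move=> [u [x [y [fg cf cg _ [v [[ve bv] uv]]]]]].
have [_ eE _ _] := cf; have [eD eS] := entryP eE; have [l1 l2] := edge_lt eD.
have K w : w \in e -> bounded_region (closed_curve fan_drawing e f g u x y) (dpos w).
  move=> we; have := crosses_fan cf cg fg; rewrite /fan_ok; case: (common _ _) => [c|//].
  by case: ifP => [h _|_ h]; apply: (bypass_connects cf cg h) bv.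
have m1 : vx (entry e).1 \in e by rewrite mem_entry // /code vxK // eqxx.
have m2 : vx (entry e).2 \in e by rewrite mem_entry // /code vxK // eqxx orbT.
have E1 := uv _ (conj m1 (K _ m1)); have E2 := uv _ (conj m2 (K _ m2)).
have /and5P[/andP[n _] _ _ _ _] := edge_okP eD.
by move: n; rewrite -(vx_eq l1 l2) -E1 -E2 eqxx.
Qed.

Lemma fan_graph_weak : weakly_fan_planar R fan_graph.
Proof. by exists fan_drawing => e f g; split; [exact: no_pattern_I|exact: no_pattern_II]. Qed.

End Weak.

(** * The closed curve of a side *)

Lemma itv01W (R : realType) (s : R) : 0 < s < 1 -> 0 <= s /\ s <= 1.
Proof. by case/andP => /ltW ? /ltW. Qed.

Lemma itv01_sub (R : realType) (s t r : R) : 0 <= s -> t <= 1 -> s <= r <= t -> 0 <= r <= 1.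
Proof. by move=> s0 t1 /andP[sr rt]; rewrite (le_trans s0 sr) (le_trans rt t1). Qed.

Section Chains.
Variables (R : realType) (G : sgraph) (D : drawing R G).
Implicit Types (u v w x y p q : G) (r s t : R).

Definition ppieces x (ps : seq G) : seq (piece R) :=
  [seq (darc D e.1 e.2, 0, 1) | e <- zip (x :: ps) ps].

Lemma pall_ppieces (P : piece R -> Prop) x ps :
  (forall u v, (u, v) \in zip (x :: ps) ps -> P (darc D u v, 0, 1)) -> pall P (ppieces x ps).
Proof.
rewrite /ppieces; elim: (zip _ _) => //= -[u v] s IH H; split.
  by apply: H; rewrite inE eqxx.
by apply: IH => u' v' h; apply: H; rewrite inE h orbT.
Qed.

Lemma pall_cat (P : piece R -> Prop) L L' : pall P L -> pall P L' -> pall P (L ++ L').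
Proof. by elim: L => //= q L IH [? /IH H] /H. Qed.

Lemma pall_and (P Q : piece R -> Prop) L : pall P L -> pall Q L -> pall (fun i => P i /\ Q i) L.
Proof. by elim: L => //= q L IH [h1 h2] [h3 h4]; split => //; exact: IH. Qed.

Lemma pall_swap (P : piece R -> piece R -> Prop) L K :
  pall (fun j => pall (fun i => P i j) L) K -> pall (fun i => pall (fun j => P i j) K) L.
Proof.
elim: L => //= p L IH H; split; first by apply: pall_imp H => q [].
by apply: IH; apply: pall_imp H => q [].
Qed.

Lemma darc_wf u v s t : adj u v -> 0 <= s -> s <= t -> t <= 1 -> pwf (darc D u v, s, t).
Proof. move=> uv s0 st t1; split; first by [].
exact: (pcont_sub (darc_cont uv) s0 t1). Qed.

Lemma ppieces_wf x ps : path (@adj G) x ps -> pall (@pwf R) (ppieces x ps).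
Proof.
by move=> a; apply: pall_ppieces => u v /(path_zip a) uv; apply: darc_wf; rewrite ?ler01.
Qed.

Lemma ppieces_telescope x ps (phi : plane R -> bool) : path (@adj G) x ps ->
  \big[addb/false]_(q <- ppieces x ps) (phi (pstart q) (+) phi (pend q)) =
  phi (pos D x) (+) phi (pos D (last x ps)).
Proof.
elim: ps x => [|y ps IH] x /=; first by rewrite big_nil addbb.
move=> /andP[xy ys]; rewrite /ppieces /= big_cons -/(ppieces y ps) IH //.
have [e0 e1] := darc_ends D xy; rewrite /pstart /pend /= e0 e1.
by xor.
Qed.

Lemma big_ppieces x ps (F : piece R -> bool) :
  (forall u v, (u, v) \in zip (x :: ps) ps -> F (darc D u v, 0, 1) = false) ->
  \big[addb/false]_(q <- ppieces x ps) F q = false.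
Proof.
move=> H; rewrite /ppieces big_map big1_seq //= => -[u v] /= h.
exact: H.
Qed.

Lemma pinum0 (p q : piece R) : pwf p -> pwf q -> (forall z, pimg p z -> ~ pimg q z) -> pinum p q = false.
Proof.
move=> [wp cp] [wq cq] H; apply: inum0 => // s t sI tI; apply/eqP => E.
by apply: (H (p.1.1 s)); [exists s|exists t].
Qed.

Lemma pinum_chi u v p q (s t s' t' : R) : adj u v -> adj p q -> indep u v p q -> chi D u v p q = false ->
  0 <= s -> s <= t -> t <= 1 -> 0 <= s' -> s' <= t' -> t' <= 1 ->
  pinum (darc D u v, s, t) (darc D p q, s', t') = false.
Proof.
move=> uv pq i c s0 st t1 s'0 st' t'1; apply: pinum0; try exact: darc_wf.
move=> z [r /= rI ->] [r' /= rI']; apply/eqP.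
by apply: chi_disjoint => //; lra.
Qed.

Lemma vertex_notin_piece u v w s t : adj u v -> w != u -> w != v -> 0 <= s -> t <= 1 ->
  ~ pimg (darc D u v, s, t) (pos D w).
Proof.
move=> uv wu wv s0 t1 [r /= rI /esym E].
have rI' : 0 <= r <= 1 by lra.
by have := darc_vertex uv rI' E; rewrite (negPf wu) (negPf wv).
Qed.

Lemma start_notin_piece u v s t : adj u v -> 0 < s -> t <= 1 ->
  ~ pimg (darc D u v, s, t) (pos D u).
Proof.
move=> uv s0 t1 [r /= rI]; have [<- _] := darc_ends D uv.
have I0 : (0 : R) <= (0 : R) <= 1 by rewrite lexx ler01.
have rI' : 0 <= r <= 1 by lra.
by move=> /(darc_inj uv I0 rI') r0; lra.
Qed.

(** The two edges already meet in their common end [a], and distinct edges meet at most once. *)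
Lemma meet_shared (a z w w' : G) (r r' : R) : adj a z -> adj w w' -> (a == w) || (a == w') -> z != w -> z != w' ->
  0 <= r <= 1 -> 0 <= r' <= 1 -> darc D a z r = darc D w w' r' -> r = 0.
Proof.
move=> az ww aw zw zw' rI rI' E.
have ne : [set a; z]%SET != [set w; w']%SET.
  by apply/eqP => /setP /(_ z); rewrite !inE eqxx orbT (negPf zw) (negPf zw').
have [e0 _] := darc_ends D az; have [f0 f1] := darc_ends D ww.
have I0 : (0 : R) <= (0 : R) <= 1 by rewrite lexx ler01.
have I1 : (0 : R) <= (1 : R) <= 1 by rewrite lexx ler01.
case/orP: aw => /eqP aw.
  have E0 : darc D a z 0 = darc D w w' 0 by rewrite e0 f0 aw.
  by have [] := meet_unique az ww ne I0 I0 rI rI' E0 E.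
have E0 : darc D a z 0 = darc D w w' 1 by rewrite e0 f1 aw.
by have [] := meet_unique az ww ne I0 I1 rI rI' E0 E.
Qed.

Lemma part_darc u v s t r : adj u v -> 0 <= s <= 1 -> 0 <= t <= 1 ->
  Num.min s t <= r <= Num.max s t ->
  part (arc D [set u; v]%SET) (darc D u v s) (darc D u v t) (darc D u v r).
Proof.
move=> uv sI tI rI; rewrite /darc; case: ifP => _.
  by exists s, t, r; split => //; rewrite in_itv.
exists (1 - s), (1 - t), (1 - r); split => //; [by rewrite in_itv /=; lra|by rewrite in_itv /=; lra|].
split => //; move: rI; rewrite ge_min le_max ge_min le_max.
by move=> /andP[/orP[h1|h1] /orP[h2|h2]]; apply/andP; split; apply/orP;
  (left; lra) || (right; lra).
Qed.

Lemma part_sub_curve e (x y z : plane R) : part (arc D e) x y z -> curve (arc D e) z.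
Proof.
move=> [s [t [r [sI tI _ _ [rI ->]]]]]; exists r => //=.
move: sI tI rI; rewrite !in_itv /= ge_min le_max => /andP[s0 s1] /andP[t0 t1].
by move=> /andP[/orP[h1|h1] /orP[h2|h2]]; apply/andP; split; lra.
Qed.

Lemma end_notin_part u v s t : adj u v -> 0 < s < 1 -> 0 < t < 1 ->
  ~ part (arc D [set u; v]%SET) (darc D u v s) (darc D u v t) (pos D u).
Proof.
move=> uv sI tI [s' [t' [r [s'I t'I Es Et [rI E]]]]].
have [e0 e1] := darc_ends D uv.
have [_ inj] := arc_jordan D (edge_adj uv).
have rI' : r \in `[0, 1].
  move: s'I t'I rI; rewrite !in_itv /= ge_min le_max => /andP[s0 s1] /andP[t0 t1].
  by move=> /andP[/orP[h1|h1] /orP[h2|h2]]; apply/andP; split; lra.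
have mI (x : R) : 0 <= x <= 1 -> x \in `[0, 1] by rewrite in_itv.
move: e0 Es Et; rewrite /darc; case: ifP => _ e0 Es Et.
  have h1 : s' = s by apply: inj Es => //; apply: mI; lra.
  have h2 : t' = t by apply: inj Et => //; apply: mI; lra.
  have h3 : r = 0 by apply: inj => //; [apply: mI; lra|rewrite e0 -E].
  by move: rI; rewrite h1 h2 h3 ge_min => /andP[/orP[] ? _]; lra.
have h1 : s' = 1 - s by apply: inj Es => //; apply: mI; lra.
have h2 : t' = 1 - t by apply: inj Et => //; apply: mI; lra.
have h3 : r = 1 by apply: inj => //; [apply: mI; lra|rewrite -E -e0 subr0].
by move: rI; rewrite h1 h2 h3 le_max => /andP[_ /orP[] ?]; lra.
Qed.

Lemma pimg_max (q : piece R) : pwf q -> exists2 z, pimg q z &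
  forall r, q.1.2 <= r <= q.2 -> (q.1.1 r).1 <= z.1.
Proof.
case: q => [[g s] t] [/= st cg].
have [|m] := @EVT_max R (fun r => (g r).1) s t st.
  by apply: ctn_itv; exact: ctn_fst cg.
rewrite in_itv /= => mI H; exists (g m); first by exists m.
by move=> r rI /=; apply: H; rewrite in_itv.
Qed.

Lemma limg_max (q : piece R) L : pall (@pwf R) (q :: L) -> exists2 z, limg (q :: L) z &
  pall (fun p : piece R => forall r, p.1.2 <= r <= p.2 -> (p.1.1 r).1 <= z.1) (q :: L).
Proof.
elim: L q => [|p L IH] q /= [wq wL].
  by have [z zq H] := pimg_max wq; exists z => //; left.
have [z zq H] := pimg_max wq; have [z' zL H'] := IH p wL.
have [zz|zz] := leP z'.1 z.1.
  exists z; first by left.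
  split=> //; apply: pall_imp H' => p' H' r rI; exact: le_trans (H' r rI) zz.
exists z'; first by right.
by split=> // r rI; exact: le_trans (H r rI) (ltW zz).
Qed.

(** Of the points of largest abscissa on the two cycles, the one further right has parity zero with
    respect to the other cycle by [wind_right]. *)
Lemma cycles_nested (L L' : seq (piece R)) : pall (@pwf R) L -> pall (@pwf R) L' ->
  (forall z, limg L z -> wind L' z = true) -> (forall z, limg L' z -> wind L z = true) ->
  L = [::].
Proof.
case: L => // p L; case: L' => [|q L'] wL wL' H H'.
  by have [z zL _] := limg_max wL; have := H z zL; rewrite /wind big_nil.
have [z zL M] := limg_max wL; have [z' zL' M'] := limg_max wL'.
have [zz|zz] := leP z'.1 z.1.
  have := H z zL; rewrite wind_right //; apply: pall_imp M' => r M' t tI.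
  exact: le_trans (M' t tI) zz.
have := H' z' zL'; rewrite wind_right //; apply: pall_imp M => r M t tI.
exact: le_trans (M t tI) (ltW zz).
Qed.

End Chains.

Local Opaque vx gad gadgets.

Section Side.
Variables (R : realType) (D : drawing R fan_graph).
Hypothesis strong : strongly_fan_planar_drawing D.

Let noI e e1 e2 : ~ pattern_I D e e1 e2.
Proof. by have [] := strong e e1 e2. Qed.

(** The closed curve of [uc], [ab] and [ud] as a chain of pieces. [lo] and [hi] are the sorted
    parameters of the two crossings on [ab], as their order along [ab] is unknown. *)
Definition loop (u a b c d : nat) (s1 lo hi s3 : R) : seq (piece R) :=
  [:: (darc D (vx u) (vx c), 0, s1); (darc D (vx a) (vx b), lo, hi); (darc D (vx u) (vx d), 0, s3)].

Section OneSide.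
Variables o u a b c d : nat.
Hypothesis cfg : (o, u, a, b, c, d) \in cfgs.
Hypothesis cfg' : (o, u, b, a, d, c) \in cfgs.

Local Notation O := (vx o).
Local Notation U := (vx u).
Local Notation A := (vx a).
Local Notation B := (vx b).
Local Notation C := (vx c).
Local Notation E := (vx d).
Local Notation Z := (vx 0).

Let ok := allP cfgs_ok _ cfg.

Lemma config_lt : ltorder [:: 0; o; u; a; b; c; d]%N.
Proof. by move: ok => /and5P[_ _ _ /and3P[]]. Qed.

Lemma config_adjs : [/\ adj U C, adj U E, adj A B, adj A Z & adj Z B].
Proof.
move: ok => /and5P[_ _ _ /and3P[_ _ /allP H] _].
move: config_lt => /and5P[z_lt o_lt u_lt a_lt /and4P[b_lt c_lt d_lt _]].
by split; rewrite vx_adj //; [apply: (H (u, c))|apply: (H (u, d))|apply: (H (a, b))|apply: (H (a, 0%N))|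
  apply: (H (0%N, b))]; rewrite !inE eqxx ?orbT.
Qed.

Let ne : uniq [:: Z; O; U; A; B; C; E].
Proof.
have -> : [:: Z; O; U; A; B; C; E] = map vx [:: 0; o; u; a; b; c; d]%N by [].
have lt_ := allP config_lt.
rewrite map_inj_in_uniq; first by move: ok => /and5P[_ _ _ /and3P[]].
by move=> i j iI jI /eqP; rewrite vx_eq ?lt_ // => /eqP.
Qed.

Let nes : [/\ [/\ Z != O, Z != U, Z != A, Z != B & Z != C /\ Z != E],
   [/\ O != U, O != A, O != B, O != C & O != E],
   [/\ U != A, U != B, U != C & U != E],
   [/\ A != B, A != C & A != E] & [/\ B != C, B != E & C != E]].
Proof.
move: ne; rewrite /= !inE !negb_or -!andbA.
by move=> /and5P[? ? ? ? /and5P[? ? ? ? /and5P[? ? ? ? /and5P[? ? ? ? /and5P[? ? ? ? /andP[? _]]]]]].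
Qed.

Let cr1 := config_crossings noI cfg.
Let cr2 := config_crossings noI cfg'.

Let gadgets_apart :
  [/\ apart (map vx (gad b o)) [:: U; C; A; Z], apart (map vx (gad o a)) [:: U; C; Z; B],
      apart (map vx (gad 0 u)) [:: A; B; C] & apart (map vx (gad 0 u)) (map vx (gad b o ++ gad o a))].
Proof.
move: ok => /and5P[_ _ _ _ /andP[_ /and5P[a1 a2 a3 a4]]].
rewrite /ltorder !all_cat => /and3P[l1 l2 l3].
move: config_lt => /and5P[z_lt o_lt u_lt a_lt /and4P[b_lt c_lt d_lt _]].
have K s t : ltorder s -> ltorder t -> apartn s t -> @apart fan_graph (map vx s) (map vx t) by exact: apart_vx.
split.
- by apply: (K (gad b o) [:: u; c; a; 0%N]) => //; rewrite /ltorder /= u_lt c_lt a_lt.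
- by apply: (K (gad o a) [:: u; c; 0%N; b]) => //; rewrite /ltorder /= u_lt c_lt b_lt.
- by apply: (K (gad 0 u) [:: a; b; c]) => //; rewrite /ltorder /= a_lt b_lt c_lt.
- by apply: (K (gad 0 u) (gad b o ++ gad o a)) => //; rewrite /ltorder all_cat l1.
Qed.

Let routes : [/\ exists ps, thick D B ps O (map vx (gad b o)), exists ps, thick D O ps A (map vx (gad o a)) &
   exists ps, thick D Z ps U (map vx (gad 0 u))].
Proof.
move: ok => /and5P[_ _ _ _ /andP[/and3P[r1 r2 r3] _]].
by split; [exact: (route_thick noI r1)|exact: (route_thick noI r2)|exact: (route_thick noI r3)].
Qed.

Let notin (M : seq fan_graph) (s : seq fan_graph) w : apart M s -> w \in s -> w \notin M.
Proof. by move=> /allP H ws; apply/negP => /H; rewrite ws. Qed.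

(** If [ab] came first on [uc], two cycles would cross exactly once: [K], made of [ab] and thick
    paths from [b] over [o] to [a], and [L], which follows [uc] up to [a0], then [a0] to [0], and
    returns to [u] on a thick path. The delicate pair is [a0] with the thick path that ends at [a]:
    an edge of that path which avoids [a] and crosses [a0] would be independent of [uc], which
    crosses [a0] too. *)
Lemma crossing_order (s1 t1 s2 t2 : R) : 0 < s1 < 1 -> 0 < t1 < 1 -> 0 < s2 < 1 -> 0 < t2 < 1 ->
  darc D U C s1 = darc D A B t1 -> darc D U C s2 = darc D A Z t2 -> s2 < s1.
Proof.
move=> s1I t1I s2I t2I E1 E2.
have [uc ue ab az zb] := config_adjs.
have [[ZO ZU ZA ZB [ZC _]] [OU OA OB OC _] [UA UB UC _] [AB AC _] [BC _ _]] := nes.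
have [g1 g2 g3 g4] := gadgets_apart.
have [[ps1 T1] [ps2 T2] [ps3 T3]] := routes.
have [[a1 l1] /allP m1 _] := T1; have [[a2 l2] /allP m2 _] := T2; have [[a3 l3] /allP m3 _] := T3.
have uc_az : indep U C A Z by rewrite /indep UA !(eq_sym _ Z) ZU ZC (eq_sym C) AC.
have uc_ab : indep U C A B by rewrite /indep UA UB !(eq_sym C) AC BC.
rewrite ltNge; apply/negP; rewrite le_eqVlt => /orP[/eqP s12|s12].
  have E3 : darc D A Z t2 = darc D A B t1 by rewrite -E1 -E2 s12.
  have : t2 = 0 by apply: (@meet_shared _ _ D A Z A B t2 t1) => //; rewrite ?eqxx //; lra.
  by lra.
have [s20 s21] := itv01W s2I; have [t20 t21] := itv01W t2I.
have /andP[t2p _] := t2I; have /andP[s1p _] := s1I; have /andP[t1p t11] := t1I.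
have sub1 (s t r : R) := @itv01_sub R s t r.
have t2r (r : R) : t2 <= r <= 1 -> r != 0 by move=> /andP[tr _]; rewrite gt_eqF // (lt_le_trans t2p).
pose K := (darc D A B, 0, 1) :: (ppieces D B ps1 ++ ppieces D O ps2).
pose L := (darc D U C, 0, s2) :: (darc D A Z, t2, 1) :: ppieces D Z ps3.
have [eu0 eu1] := darc_ends D uc; have [ea0 ea1] := darc_ends D ab; have [ez0 ez1] := darc_ends D az.
have cK : cycle K.
  move=> phi; rewrite /K big_cons big_cat /= !ppieces_telescope // l1 l2 /pstart /pend /= ea0 ea1.
  by xor.
have cL : cycle L.
  move=> phi; rewrite /L !big_cons ppieces_telescope // l3 /pstart /pend /= eu0 ez1 E2.
  by xor.
have wK : pall (@pwf R) K.
  by split; [apply: darc_wf => //; lra|apply: pall_cat; apply: ppieces_wf].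
have wL : pall (@pwf R) L.
  by split; [apply: darc_wf => //; lra|split; [apply: darc_wf => //; lra|apply: ppieces_wf]].
have zin x ps y M w w' : thick D x ps y M -> (w, w') \in zip (x :: ps) ps -> [/\ adj w w', w \in M & w' \in M].
  move=> [[aa _] /allP mm _] h; have [h1 h2] := zip_mem h.
  by split; [exact: path_zip h|exact: mm|exact: mm].
have nin (M : seq fan_graph) x y : x \in M -> y \notin M -> x != y by move=> xM; apply: contraNneq => <-.
have vK w : (w \in [:: A; B]) || (w \in map vx (gad b o)) || (w \in map vx (gad o a)) ->
    [/\ w != U, w != C, w != Z & w \notin map vx (gad 0 u)].
  rewrite -orbA => /or3P[]; last first.
  - move=> h; split; try by apply: (nin _ _ _ h); apply: (notin g2); rewrite !inE eqxx ?orbT.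
    by apply/negP => /(allP g4); rewrite map_cat mem_cat h orbT.
  - move=> h; split; try by apply: (nin _ _ _ h); apply: (notin g1); rewrite !inE eqxx ?orbT.
    by apply/negP => /(allP g4); rewrite map_cat mem_cat h.
  rewrite !inE => /orP[] /eqP ->; split; rewrite // 1?eq_sym //; apply: (notin g3); rewrite !inE eqxx ?orbT //.
have endK w : (w \in [:: A; B]) || (w \in map vx (gad b o)) || (w \in map vx (gad o a)) ->
    pall (fun p : piece R => ~ pimg p (pos D w)) L.
  move=> h; have [wU wC wZ wM] := vK w h; split; first by apply: vertex_notin_piece.
  split.
    have [->|wA] := eqVneq w A; first exact: start_notin_piece.
    by apply: vertex_notin_piece.
  apply: pall_ppieces => x y /(zin _ _ _ _ _ _ T3)[xy xM yM].
  by apply: vertex_notin_piece => //; rewrite 1?eq_sym; exact: (nin _ _ _ _ wM).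
have swap : pall (fun p => pall (fun q => ~ pimg p (pstart q) /\ ~ pimg p (pend q)) K) L.
  have ends (x y : fan_graph) : adj x y ->
     (x \in [:: A; B]) || (x \in map vx (gad b o)) || (x \in map vx (gad o a)) ->
     (y \in [:: A; B]) || (y \in map vx (gad b o)) || (y \in map vx (gad o a)) ->
     pall (fun p : piece R => ~ pimg p (pstart (darc D x y, 0, 1)) /\ ~ pimg p (pend (darc D x y, 0, 1))) L.
    move=> xy hx hy; have [e0 e1] := darc_ends D xy.
    apply: pall_imp (pall_and (endK x hx) (endK y hy)) => p.
    by rewrite -e0 -e1.
  have P1 : pall (fun q => pall (fun p => ~ pimg p (pstart q) /\ ~ pimg p (pend q)) L) K.
    split; first by apply: ends; rewrite // !inE eqxx ?orbT.
    apply: pall_cat; apply: pall_ppieces => x y.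
      by move=> /(zin _ _ _ _ _ _ T1)[xy xM yM]; apply: ends; rewrite // ?xM ?yM ?orbT.
    by move=> /(zin _ _ _ _ _ _ T2)[xy xM yM]; apply: ends; rewrite // ?xM ?yM ?orbT.
  exact: pall_swap P1.
pose F (p : piece R) := \big[addb/false]_(q <- K) pinum p q.
have S3 : \big[addb/false]_(p <- ppieces D Z ps3) F p = false.
  apply: big_ppieces => x y h; have [xy xM yM] := zin _ _ _ _ _ _ T3 h.
  have other x' y' : adj x' y' ->
      (x' \in [:: A; B]) || (x' \in map vx (gad b o)) || (x' \in map vx (gad o a)) ->
      (y' \in [:: A; B]) || (y' \in map vx (gad b o)) || (y' \in map vx (gad o a)) ->
      pinum (darc D x y, 0, 1) (darc D x' y', 0, 1) = false.
    move=> xy' /vK[_ _ _ nx] /vK[_ _ _ ny]; apply: pinum_chi; rewrite ?ler01 //.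
      by apply/and4P; split; (apply: nin; [eassumption|eassumption]).
    by apply: (thick_chi noI T3 h xy' _ _).1.
  rewrite /F /K big_cons big_cat /= other ?inE ?eqxx ?orbT // addFb.
  rewrite !big_ppieces //.
    move=> x' y' h'; have [xy' xM' yM'] := zin _ _ _ _ _ _ T2 h'.
    by apply: other; rewrite // ?xM' ?yM' !orbT.
  move=> x' y' h'; have [xy' xM' yM'] := zin _ _ _ _ _ _ T1 h'.
  by apply: other; rewrite // ?xM' ?yM' !orbT.
have tz x ps y M p q (s t : R) : thick D x ps y M -> adj p q -> p \notin M -> q \notin M ->
    0 <= s -> s <= t -> t <= 1 ->
    \big[addb/false]_(i <- ppieces D x ps) pinum (darc D p q, s, t) i = false.
  move=> T pq pM qM s0 st t1_; apply: big_ppieces => x' y' h; have [xy' xM' yM'] := zin _ _ _ _ _ _ T h.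
  apply: pinum_chi; rewrite ?ler01 //.
    by apply/and4P; split; rewrite eq_sym; (apply: nin; [eassumption|eassumption]).
  by apply: (thick_chi noI T h pq _ _).2.
have S1 : F (darc D U C, 0, s2) = true.
  rewrite /F /K big_cons big_cat /=.
  rewrite (tz _ _ _ _ U C 0 s2 T1) //; try by apply: (notin g1); rewrite !inE eqxx ?orbT.
  rewrite (tz _ _ _ _ U C 0 s2 T2) //; try by apply: (notin g2); rewrite !inE eqxx ?orbT.
  rewrite !addbF; exact: (inum_subarcs uc ab uc_ab (lexx _) s1p s12 s21 (lexx _) t1p t11 (lexx _) E1).
have S2 : F (darc D A Z, t2, 1) = false.
  rewrite /F /K big_cons big_cat /=.
  rewrite (tz _ _ _ _ A Z t2 1 T1) //; try by apply: (notin g1); rewrite !inE eqxx ?orbT.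
  have -> : pinum (darc D A Z, t2, 1) (darc D A B, 0, 1) = false.
    apply: pinum0; [by apply: darc_wf|by apply: darc_wf; rewrite ?ler01|].
    move=> z [r /= rI ->] [r' /= rI'] Er.
    apply/negP: (t2r r rI); rewrite negbK; apply/eqP.
    by apply: (@meet_shared _ _ D A Z A B r r'); rewrite ?eqxx ?(sub1 _ _ _ _ _ rI).
  rewrite !addFb; apply: big_ppieces => x y h; have [xy xM yM] := zin _ _ _ _ _ _ T2 h.
  have [|xU xC xZ _] := vK x; first by rewrite xM !orbT.
  have [|yU yC yZ _] := vK y; first by rewrite yM !orbT.
  have [adjA|] := boolP ((A == x) || (A == y)).
    apply: pinum0; [by apply: darc_wf|by apply: darc_wf; rewrite ?ler01|].
    move=> z [r /= rI ->] [r' /= rI'] Er.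
    apply/negP: (t2r r rI); rewrite negbK; apply/eqP.
    by apply: (@meet_shared _ _ D A Z x y r r'); rewrite ?(sub1 _ _ _ _ _ rI) // eq_sym.
  rewrite negb_or => /andP[Ax Ay].
  have i1 : indep A Z x y by rewrite /indep Ax Ay !(eq_sym Z) xZ yZ.
  have i2 : indep x y A Z by rewrite indepC.
  apply: pinum_chi; rewrite ?ler01 //.
  apply/negP; rewrite (chiC D az xy i1) => c_; have [_ uc_az_ _] := cr1.
  have := fan noI az xy uc i2 uc_az c_ uc_az_.
  by rewrite /indep xU xC yU yC.
have EL : \big[addb/false]_(p <- L) F p =
    F (darc D U C, 0, s2) (+) (F (darc D A Z, t2, 1) (+) \big[addb/false]_(p <- ppieces D Z ps3) F p).
  by rewrite /L !big_cons.
have : \big[addb/false]_(p <- L) F p = false := wind_cycles cK cL wK wL swap.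
by rewrite EL S1 S2 S3.
Qed.

(** The edge from [a] to [0] meets the loop exactly once: it crosses [uc] before [uc] reaches [ab],
    by [crossing_order], it does not cross [ud] by the mirrored configuration, and it meets [ab]
    only in [a]. So the parities of [a] and [0] differ, and that of [a] is zero. *)
Lemma side_curve : exists s1 lo hi s3,
  [/\ 0 < s1 < 1, 0 < lo, lo <= hi, hi < 1 & 0 < s3 < 1] /\
  [/\ darc D U C s1 = darc D A B lo \/ darc D U C s1 = darc D A B hi,
      cycle (loop u a b c d s1 lo hi s3) & wind (loop u a b c d s1 lo hi s3) (pos D Z) = true].
Proof.
have [uc ue ab az zb] := config_adjs.
have [[ZO ZU ZA ZB [ZC ZE]] [OU OA OB OC _] [UA UB UC UE] [AB AC AE] [BC BE CE]] := nes.
have [uc_ab uc_az uc_zb] := cr1.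
have [ue_ba ue_bz ue_za] := cr2.
have ba : adj B A by rewrite adj_sym.
have za : adj Z A by rewrite adj_sym.
have i_ucaz : indep U C A Z by rewrite /indep UA !(eq_sym _ Z) ZU ZC (eq_sym C) AC.
have i_ucab : indep U C A B by rewrite /indep UA UB !(eq_sym C) AC BC.
have i_ueba : indep U E B A by rewrite /indep UA UB !(eq_sym E) AE BE.
have i_ueab : indep U E A B by rewrite /indep UA UB !(eq_sym E) AE BE.
have i_ueza : indep U E Z A by rewrite /indep UA !(eq_sym _ Z) ZU ZE (eq_sym E) AE.
have i_azue : indep A Z U E by rewrite /indep (eq_sym A) UA ZU AE ZE.
have ue_ab : chi D U E A B.
  have i1 : indep B A U E by rewrite indepC.
  have i2 : indep A B U E by rewrite indepC.
  by rewrite (chiC D ue ab i_ueab) (chi_swap D ab ue i2) -(chiC D ue ba i_ueba).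
have az_ue : chi D A Z U E = false.
  by rewrite (chi_swap D az ue i_azue) -(chiC D ue za i_ueza).
have [s1 [t1 [s1I t1I E1 X1]]] := crs_params uc ab i_ucab (elimT (chiP D uc ab i_ucab) uc_ab).
have [s2 [t2 [s2I t2I E2 _]]] := crs_params uc az i_ucaz (elimT (chiP D uc az i_ucaz) uc_az).
have [s3 [t3 [s3I t3I E3 X3]]] := crs_params ue ab i_ueab (elimT (chiP D ue ab i_ueab) ue_ab).
have s21 := crossing_order s1I t1I s2I t2I E1 E2.
have [eu0 eu1] := darc_ends D uc; have [ea0 ea1] := darc_ends D ab; have [ez0 ez1] := darc_ends D az.
have [ed0 ed1] := darc_ends D ue.
pose lo := Num.min t1 t3; pose hi := Num.max t1 t3.
have lohi : (lo = t1 /\ hi = t3) \/ (lo = t3 /\ hi = t1).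
  by rewrite /lo /hi; have [t13|t31] := leP t1 t3; [left|right].
have [lo0 lh h1] : [/\ 0 < lo, lo <= hi & hi < 1].
  move: t1I t3I => /andP[t10 t11] /andP[t30 t31].
  by rewrite /lo /hi lt_min gt_max t10 t11 t30 t31 ge_min !le_max !lexx.
have [s10 s11] := itv01W s1I; have [s30 s31] := itv01W s3I.
have lo0' := ltW lo0; have hi1' := ltW h1.
have /andP[s2p _] := s2I; have /andP[t2p t21] := t2I; have l01 : (0 : R) <= 1 := ler01.
have I01 (s t r : R) := @itv01_sub R s t r.
have lor (r : R) : lo <= r <= hi -> r != 0 by move=> /andP[lr _]; rewrite gt_eqF // (lt_le_trans lo0).
have loI : lo <= lo <= hi by rewrite lexx.
have hiI : lo <= hi <= hi by rewrite lexx andbT.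
exists s1, lo, hi, s3; split; first by split.
set L := loop _ _ _ _ _ _ _ _ _.
have Elo : darc D U C s1 = darc D A B lo \/ darc D U C s1 = darc D A B hi.
  by case: lohi => -[h h']; [left; rewrite h|right; rewrite h'].
have cL : cycle L.
  move=> phi; rewrite /L /loop !big_cons big_nil /pstart /pend /= eu0 ed0 E1 E3.
  by case: lohi => -[-> ->]; xor.
have wL : pall (@pwf R) L.
  by split; [exact: darc_wf|split; [exact: darc_wf|split; [exact: darc_wf|]]].
split => //.
pose CC := closed_curve D [set A; B]%SET [set U; C]%SET [set U; E]%SET U (darc D U C s1) (darc D U E s3).
have LC : limg L `<=` CC.
  move=> z [[r /= rI ->]|[[r /= rI ->]|[[r /= rI ->]|[]]]].
  - left; left; rewrite -eu0; apply: part_darc => //; first by rewrite lexx.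
      by rewrite s10.
    by rewrite (min_l s10) (max_r s10).
  - left; right; rewrite E1 E3; apply: part_darc => //; [by case/andP: t1I => ? ?; rewrite !ltW|by case/andP: t3I => ? ?; rewrite !ltW].
  - right; rewrite -ed0; apply: part_darc => //; first by rewrite s30.
      by rewrite lexx.
    by rewrite (min_r s30) (max_l s30).
have nA : ~ CC (pos D A).
  move=> [[|]|] => [/part_sub_curve H|H|/part_sub_curve H].
  - by have := arc_vertex (edge_adj uc) H; rewrite !inE (eq_sym A) (negPf UA) (negPf AC).
  - by move: H; rewrite E1 E3; exact: end_notin_part.
  - by have := arc_vertex (edge_adj ue) H; rewrite !inE (eq_sym A) (negPf UA) (negPf AE).
have wA : wind L (pos D A) = false.
  apply: (wind_unbounded cL wL LC nA) => bA.
  (* If [a] lay in the bounded region, then [ab], [uc] and [ud] would form Pattern (III) or (II),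
     according to whether [b] does too. Beyond Pattern (I), this is the one place where the strong
     condition enters. *)
  have BA : bounded_region CC (pos D A) by [].
  have c1 : crosses_at D [set U; C]%SET [set A; B]%SET (darc D U C s1).
    by split => //; [exact: edge_adj|exact: edge_adj|exact: indep_neq].
  have c3 : crosses_at D [set U; E]%SET [set A; B]%SET (darc D U E s3).
    by split => //; [exact: edge_adj|exact: edge_adj|exact: indep_neq].
  have ee : [set U; C]%SET != [set U; E]%SET.
    by apply/eqP => /setP /(_ C); rewrite !inE eqxx orbT (negPf CE) (eq_sym C) (negPf UC).
  have [_ n2 n3] := strong [set A; B]%SET [set U; C]%SET [set U; E]%SET.
  have [BB|nBB] := pselect (bounded_region CC (pos D B)).
    apply: n3; exists U, (darc D U C s1), (darc D U E s3); split => //; first by rewrite !inE eqxx.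
    by move=> v; rewrite !inE => /orP[] /eqP ->.
  apply: n2; exists U, (darc D U C s1), (darc D U E s3); split => //; first by rewrite !inE eqxx.
  exists A; split; first by rewrite !inE eqxx.
  by move=> v; rewrite !inE => -[/orP[] /eqP -> //].
have := @wind_inum _ L (darc D A Z, 0, 1) cL.
rewrite /pstart /pend /= ez0 ez1 wA addFb => <-.
- rewrite /L /loop !big_cons big_nil.
  have -> : pinum (darc D A Z, 0, 1) (darc D U C, 0, s1) = true.
    by apply: (@inum_subarcs _ _ D A Z U C t2 s2) => //; rewrite indepC.
  have -> : pinum (darc D A Z, 0, 1) (darc D U E, 0, s3) = false by apply: pinum_chi.
  have -> // : pinum (darc D A Z, 0, 1) (darc D A B, lo, hi) = false.
  apply: pinum0; [exact: darc_wf|exact: darc_wf|move=> z [r /= rI ->] [r' /= rI'] Er].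
  apply/negP: (lor r' rI'); rewrite negbK; apply/eqP.
  by apply: (@meet_shared _ _ D A B A Z r' r); rewrite ?eqxx ?(I01 _ _ _ _ _ rI') // eq_sym.
- exact: darc_wf.
- by [].
have nAB (r : R) : lo <= r <= hi -> ~ pimg (darc D A Z, 0, 1) (darc D A B r).
  move=> rI [r' /= rI' Er]; apply/negP: (lor r rI); rewrite negbK; apply/eqP.
  by apply: (@meet_shared _ _ D A B A Z r r'); rewrite ?eqxx ?(I01 _ _ _ _ _ rI) // eq_sym.
have nU : ~ pimg (darc D A Z, 0, 1) (pos D U).
  by apply: vertex_notin_piece; rewrite // eq_sym.
rewrite /L /loop /= eu0 ed0 E3; split; last split; last by split => //; split => //; case: lohi => -[h h']; rewrite -?h -?h'; apply: nAB.
  by split => //; case: Elo => ->; apply: nAB.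
by split; apply: nAB.
Qed.

End OneSide.

Lemma path_const (f : fan_graph -> bool) x ps :
  (forall u v, (u, v) \in zip (x :: ps) ps -> f u = f v) -> f x = f (last x ps).
Proof.
elim: ps x => //= y ps IH x H; rewrite (H x y) ?inE ?eqxx //; apply: IH => u v h.
by apply: H; rewrite inE h orbT.
Qed.

End Side.

(** * Two sides *)

Section Final.
Variables (R : realType) (D : drawing R fan_graph).
Hypothesis strong : strongly_fan_planar_drawing D.

Let noI e e1 e2 : ~ pattern_I D e e1 e2.
Proof. by have [] := strong e e1 e2. Qed.

Definition sides_apart (t t' : nat * nat * nat * nat * nat) : bool :=
  let: (u, a, b, c, d) := t in let: (u', a', b', c', d') := t' in
  [&& apartn [:: u'; a'; b'; c'; d'] [:: u; a; b; c; d], apartn (gad 0 u') [:: u; a; b; c; d] &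
      ltorder (gad 0 u')].

Section Linked.
Variables (o u a b c d o' u' a' b' c' d' : nat).
Hypothesis cfg1 : (o, u, a, b, c, d) \in cfgs.
Hypothesis cfg1' : (o, u, b, a, d, c) \in cfgs.
Hypothesis cfg2 : (o', u', a', b', c', d') \in cfgs.
Hypothesis apart12 : sides_apart (u, a, b, c, d) (u', a', b', c', d').
Hypothesis route2 : route 0 [:: u'].

Variables (s1 lo hi s3 : R).
Hypothesis s1I : 0 < s1 < 1.
Hypothesis lo0 : 0 < lo.
Hypothesis lohi : lo <= hi.
Hypothesis hi1 : hi < 1.
Hypothesis s3I : 0 < s3 < 1.
Local Notation L := (loop D u a b c d s1 lo hi s3).
Hypothesis cL : cycle L.
Hypothesis wZ : wind L (pos D (vx 0)) = true.

Local Notation U := (vx u).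
Local Notation A := (vx a).
Local Notation B := (vx b).
Local Notation C := (vx c).
Local Notation E := (vx d).

Let bounds : [/\ 0 <= s1, s1 <= 1, 0 <= lo, hi <= 1 & 0 <= s3 /\ s3 <= 1].
Proof.
have [? ?] := itv01W s1I; have [? ?] := itv01W s3I.
by split => //; [exact: ltW lo0|exact: ltW hi1].
Qed.

Lemma wind_edge p q (s t : R) : adj p q -> p \notin [:: U; A; B; C; E] -> q \notin [:: U; A; B; C; E] ->
  chi D p q U C = false -> chi D p q A B = false -> chi D p q U E = false ->
  0 <= s -> s <= t -> t <= 1 -> wind L (darc D p q s) = wind L (darc D p q t).
Proof.
move=> pq pn qn x1 x2 x3 s0 st t1.
have [s10 s11 lo0' hi1' [s30 s31]] := bounds.
have [uc ue ab _ _] := config_adjs cfg1.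
have {}pn w : w \in [:: U; A; B; C; E] -> p != w by move=> h; apply: contraNneq pn => ->.
have {}qn w : w \in [:: U; A; B; C; E] -> q != w by move=> h; apply: contraNneq qn => ->.
have i1 : indep p q U C by apply/and4P; split; rewrite ?pn ?qn // !inE eqxx ?orbT.
have i2 : indep p q A B by apply/and4P; split; rewrite ?pn ?qn // !inE eqxx ?orbT.
have i3 : indep p q U E by apply/and4P; split; rewrite ?pn ?qn // !inE eqxx ?orbT.
have wp : pwf (darc D p q, s, t) by exact: darc_wf.
have wL : pall (@pwf R) L by split; [exact: darc_wf|split; [exact: darc_wf|split; [exact: darc_wf|]]].
have I01 (x y r : R) := @itv01_sub R x y r.
have dj v w (r : R) : adj v w -> indep p q v w -> chi D p q v w = false -> 0 <= r <= 1 ->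
    ~ pimg (darc D p q, s, t) (darc D v w r).
  move=> vw i ch rI [r' /= rI' Er].
  by have := chi_disjoint pq vw i ch (I01 _ _ _ s0 t1 rI') rI; rewrite Er eqxx.
have z01 : (0 : R) <= (0 : R) <= 1 by rewrite lexx ler01.
have H : \big[addb/false]_(i <- L) pinum (darc D p q, s, t) i = wind L (darc D p q s) (+) wind L (darc D p q t).
  apply: (wind_inum cL wp wL); split; last split; last split => //=; split => /=; apply: dj => //.
  - by rewrite s10.
  - by rewrite lo0' (le_trans lohi).
  - by rewrite hi1' (le_trans lo0').
  - by rewrite s30.
have : \big[addb/false]_(i <- L) pinum (darc D p q, s, t) i = false.
  by rewrite /loop !big_cons big_nil !pinum_chi.
by rewrite H; case: (wind _ _); case: (wind _ _).
Qed.

Let lt1 := config_lt cfg1.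
Let lt2 := config_lt cfg2.

Let other_side : [/\ apart [:: vx u'; vx a'; vx b'; vx c'; vx d'] [:: U; A; B; C; E] &
   apart (map vx (gad 0 u')) [:: U; A; B; C; E]].
Proof.
move: apart12 => /and3P[h1 h2 h3].
move: lt1 => /and5P[_ _ u_lt a_lt /and4P[b_lt c_lt d_lt _]].
move: lt2 => /and5P[_ _ u_lt' a_lt' /and4P[b_lt' c_lt' d_lt' _]].
have K s t : ltorder s -> ltorder t -> apartn s t -> @apart fan_graph (map vx s) (map vx t) by exact: apart_vx.
split.
  by apply: (K [:: u'; a'; b'; c'; d'] [:: u; a; b; c; d]); rewrite // /ltorder /= ?u_lt ?a_lt ?b_lt ?c_lt ?d_lt ?u_lt' ?a_lt' ?b_lt' ?c_lt' ?d_lt'.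
by apply: (K (gad 0 u') [:: u; a; b; c; d]); rewrite // /ltorder /= ?u_lt ?a_lt ?b_lt ?c_lt ?d_lt.
Qed.

(** Each piece of the loop is already crossed by another of its edges: [uc] and [ud] by [ab], and
    [ab] by [uc]. A crossing with an edge independent of all of them would be Pattern (I). *)
Let thin_edge p q : adj p q -> p \notin [:: U; A; B; C; E] -> q \notin [:: U; A; B; C; E] ->
  [/\ chi D p q U C = false, chi D p q A B = false & chi D p q U E = false].
Proof.
move=> pq pn qn.
have [uc ue ab _ _] := config_adjs cfg1.
have [uc_ab _ _] := config_crossings noI cfg1; have [ue_ba _ _] := config_crossings noI cfg1'.
have {}pn w : w \in [:: U; A; B; C; E] -> p != w by move=> h; apply: contraNneq pn => ->.
have {}qn w : w \in [:: U; A; B; C; E] -> q != w by move=> h; apply: contraNneq qn => ->.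
have i1 : indep p q U C by apply/and4P; split; rewrite ?pn ?qn // !inE eqxx ?orbT.
have i2 : indep p q A B by apply/and4P; split; rewrite ?pn ?qn // !inE eqxx ?orbT.
have i3 : indep p q U E by apply/and4P; split; rewrite ?pn ?qn // !inE eqxx ?orbT.
have ba : adj B A by rewrite adj_sym.
have i2' : indep p q B A by apply/and4P; split; rewrite ?pn ?qn // !inE eqxx ?orbT.
have un : uniq [:: u; a; b; c; d].
  by have := allP cfgs_ok _ cfg1 => /and5P[_ _ _ /and3P[_ + _] _] /=; case/and3P.
have uneq : uniq [:: U; A; B; C; E].
  have -> : [:: U; A; B; C; E] = map vx [:: u; a; b; c; d] by [].
  have := allP lt1 => lt_.
  rewrite map_inj_in_uniq; first exact: un.
  have lto i : i \in [:: u; a; b; c; d] -> (i < order)%N by move=> iI; apply: lt_; rewrite 2!in_cons iI !orbT.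
  by move=> i j /lto i_lt /lto j_lt /eqP; rewrite vx_eq // => /eqP.
move: uneq; rewrite /= !inE !negb_or -!andbA => /and5P[UA UB UC UE /and5P[AB AC AE BC /and3P[BE CE _]]].
have j1 : indep A B U C by rewrite /indep !(eq_sym _ U) UA UB AC BC.
have j2 : indep U C A B by rewrite indepC.
have j3 : indep B A U E by rewrite /indep !(eq_sym _ U) UA UB AE BE.
have j4 : indep U E B A by rewrite indepC.
split; apply/negP => h.
- have := fan noI uc pq ab i1 j1 h; rewrite (chiC D ab uc j1) => /(_ uc_ab).
  by rewrite i2.
- by have := fan noI ab pq uc i2 j2 h uc_ab; rewrite i1.
- have := fan noI ue pq ba i3 j3 h; rewrite (chiC D ba ue j3) => /(_ ue_ba).
  by rewrite i2'.
Qed.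

Variables (s1' lo' hi' s3' : R).
Hypothesis s1I' : 0 < s1' < 1.
Hypothesis lo0' : 0 < lo'.
Hypothesis lohi' : lo' <= hi'.
Hypothesis hi1' : hi' < 1.
Hypothesis s3I' : 0 < s3' < 1.
Hypothesis link' : darc D (vx u') (vx c') s1' = darc D (vx a') (vx b') lo' \/
                   darc D (vx u') (vx c') s1' = darc D (vx a') (vx b') hi'.

(** The thick path from [0] to [u'] is not crossed by the first loop, so [u'] has the parity of [0].
    From [u'] the second loop is traced along [u'c'], then through the crossing given by [link']
    along [a'b'], and along [u'd']; by [thin_edge] none of these edges crosses the first loop. *)
Lemma linked z : limg (loop D u' a' b' c' d' s1' lo' hi' s3') z -> wind L z = true.
Proof.
have [uc ue ab _ _] := config_adjs cfg2.
have [/allP o1 o2] := other_side.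
have nin w : w \in [:: vx u'; vx a'; vx b'; vx c'; vx d'] -> w \notin [:: U; A; B; C; E] by exact: o1.
have thin p q (s t : R) : adj p q -> p \in [:: vx u'; vx a'; vx b'; vx c'; vx d'] ->
    q \in [:: vx u'; vx a'; vx b'; vx c'; vx d'] -> 0 <= s -> s <= t -> t <= 1 ->
    wind L (darc D p q s) = wind L (darc D p q t).
  move=> pq /nin pn /nin qn s0 st t1; have [h1 h2 h3] := thin_edge pq pn qn.
  exact: wind_edge.
have wU : wind L (pos D (vx u')) = true.
  have [ps T] := route_thick noI route2; have [[aa l] /allP mm _] := T.
  rewrite -wZ /= -l; apply/esym; apply: (path_const (f := fun w => wind L (pos D w))) => v w h.
  have vw := path_zip aa h; have [vM wM] := zip_mem h.
  have vn : v \notin [:: U; A; B; C; E] by apply: (allP o2); apply: mm.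
  have wn : w \notin [:: U; A; B; C; E] by apply: (allP o2); apply: mm.
  have [uc1 ue1 ab1 _ _] := config_adjs cfg1.
  have nM y : y \in [:: U; A; B; C; E] -> y \notin map vx (gad 0 u').
    by move=> yI; apply/negP => /(allP o2); rewrite yI.
  have [e0 e1] := darc_ends D vw; rewrite -e0 -e1.
  apply: wind_edge => //.
  - by apply: (thick_chi noI T h uc1 _ _).1; apply: nM; rewrite !inE eqxx ?orbT.
  - by apply: (thick_chi noI T h ab1 _ _).1; apply: nM; rewrite !inE eqxx ?orbT.
  - by apply: (thick_chi noI T h ue1 _ _).1; apply: nM; rewrite !inE eqxx ?orbT.
have [s10 s11] := itv01W s1I'.
have l0 := ltW lo0'; have h1 := ltW hi1'.
have [s30 s31] := itv01W s3I'.
have [eu0 _] := darc_ends D uc; have [ed0 _] := darc_ends D ue.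
have W1 r : 0 <= r <= s1' -> wind L (darc D (vx u') (vx c') r) = true.
  move=> /andP[r0 r1]; rewrite -(thin (vx u') (vx c') 0 r) ?inE ?eqxx ?orbT ?eu0 //.
  exact: le_trans r1 s11.
have Wlo : wind L (darc D (vx a') (vx b') lo') = true.
  have W : wind L (darc D (vx u') (vx c') s1') = true by apply: W1; rewrite s10 lexx.
  case: link' => K; first by rewrite -K.
  by rewrite (thin (vx a') (vx b') lo' hi') ?inE ?eqxx ?orbT // -K.
move=> [[r /= rI ->]|[[r /= /andP[r0 r1] ->]|[[r /= /andP[r0 r1] ->]|[]]]].
- exact: W1.
- rewrite -(thin (vx a') (vx b') lo' r) ?inE ?eqxx ?orbT //.
  exact: le_trans r1 h1.
- rewrite -(thin (vx u') (vx d') 0 r) ?inE ?eqxx ?orbT ?ed0 //.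
  exact: le_trans r1 s31.
Qed.

End Linked.

Lemma sides_ok : [&& sides_apart (2, 3, 4, 5, 6)%N (8, 9, 10, 11, 12)%N,
  sides_apart (8, 9, 10, 11, 12)%N (2, 3, 4, 5, 6)%N, route 0 [:: 2%N] & route 0 [:: 8%N]].
Proof. by vm_compute. Qed.

Lemma not_strong : False.
Proof.
have [c1 c1' c2 c2'] : [/\ (1, 2, 3, 4, 5, 6)%N \in cfgs, (1, 2, 4, 3, 6, 5)%N \in cfgs,
   (7, 8, 9, 10, 11, 12)%N \in cfgs & (7, 8, 10, 9, 12, 11)%N \in cfgs] by [].
have /and4P[a12 a21 r1 r2] := sides_ok.
have [s1 [lo [hi [s3 [[p1 p2 p3 p4 p5] [l1 y1 w1]]]]]] := side_curve strong c1 c1'.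
have [s1' [lo' [hi' [s3' [[q1 q2 q3 q4 q5] [l2 y2 w2]]]]]] := side_curve strong c2 c2'.
have [s10 s11] := itv01W p1; have [s30 s31] := itv01W p5; have lo0 := ltW p2; have hi1 := ltW p4.
have [s10' s11'] := itv01W q1; have [s30' s31'] := itv01W q5; have lo0' := ltW q2; have hi1' := ltW q4.
have [uc ue ab _ _] := config_adjs c1; have [uc' ue' ab' _ _] := config_adjs c2.
have wL : pall (@pwf R) (loop D 2 3 4 5 6 s1 lo hi s3).
  by split; [exact: darc_wf|split; [exact: darc_wf|split; [exact: darc_wf|]]].
have wL' : pall (@pwf R) (loop D 8 9 10 11 12 s1' lo' hi' s3').
  by split; [exact: darc_wf|split; [exact: darc_wf|split; [exact: darc_wf|]]].
suff : loop D 2 3 4 5 6 s1 lo hi s3 = [::] by [].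
apply: (cycles_nested wL wL') => z zL.
  exact: (linked c2 c2' c1 a21 r1 q1 q2 q3 q4 q5 y2 w2 p1 p2 p3 p4 p5 l1 zL).
exact: (linked c1 c1' c2 a12 r2 p1 p2 p3 p4 p5 y1 w1 q1 q2 q3 q4 q5 l2 zL).
Qed.

End Final.

Theorem theorem1 (R : realType) :
  exists G : sgraph, weakly_fan_planar R G /\ ~ strongly_fan_planar R G.
Proof.
exists fan_graph; split; first exact: fan_graph_weak.
by move=> [D]; exact: not_strong.
Qed.
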